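(* Let $X=T[(\theta_n,\mathcal{F}_n)_{n=1}^\infty]$, $\alpha_n=\iota(\mathcal{F}_n)>1$ for all $n$, $\alpha=\sup_n\alpha_n$, and assume $\alpha\neq\alpha_n$ for all $n$ and $\alpha=\omega^{\omega^\xi}$ with $0<\xi<\omega_1$. Suppose condition $(\dagger)$ holds: there exists $\varepsilon>0$ such that for every ordinal $\beta<\omega^\xi$ there is $m\in\mathbb{N}$ with $\gamma(\varepsilon,m)+2+\beta<\ell(\alpha_m)$. Then for every infinite $M\subseteq\mathbb{N}$, the closed linear span $[(e_n)_{n\in M}]$ of the subsequence $(e_n)_{n\in M}$ of the unit vector basis of $X$ contains an $\ell^1$-$\mathcal{S}_{\omega^\xi}$-spreading model.
   Context: Regular families, $\mathcal{F}$-admissibility, the index $\iota$, Schreier families $\mathcal{S}_\beta$ (defined for limit $\beta$ via a fixed sequence strictly increasing to $\beta$: $\mathcal{S}_\beta=\{F:F\in\mathcal{S}_{\beta_n}\text{ for some } n\le\min F\}$, with $\mathcal{S}_0$ the singletons and $\emptyset$, $\mathcal{S}_1=\{F:|F|\le\min F\}$, $\mathcal{S}_{\beta+1}=\mathcal{S}_1[\mathcal{S}_\beta]$ where $\mathcal{M}[\mathcal{N}]$ is the set of unions of $\mathcal{M}$-admissible sequences of members of $\mathcal{N}$). A sequence $E_1<\dots<E_k$ of finite sets ($\max E_i<\min E_{i+1}$) is $\mathcal{F}$-admissible if $\{\min E_i\}\in\mathcal{F}$. A regular family is hereditary, spreading and compact in $2^{\mathbb{N}}$; $\iota(\mathcal{F})$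 is its Cantor–Bendixson index (the $\beta$ with $\mathcal{F}^{(\beta)}=\{\emptyset\}$). $T[(\theta_n,\mathcal{F}_n)_{n=1}^\infty]$, for regular $\mathcal{F}_n$ and $(\theta_n)$ nonincreasing null in $(0,1)$, is the completion of $c_{00}$ under $\|x\|=\max\{\|x\|_{c_0},\sup_n\sup\theta_n\sum_{i=1}^k\|E_ix\|\}$, inner sup over $\mathcal{F}_n$-admissible $(E_i)$, $E x$ the restriction of $x$ to $E$; $(e_n)$ is the unit vector basis. For a nonzero ordinal with Cantor normal form $\omega^{\beta_1}m_1+\dots+\omega^{\beta_n}m_n$ ($\beta_1>\dots>\beta_n$), $\ell$ of it is $\beta_1$. For $m\in\mathbb{N}$, $\varepsilon>0$: $\gamma(\varepsilon,m)=\max\{\ell(\alpha_{n_s}\cdots\alpha_{n_1}): s\ge1,\ n_1,\dots,n_s\in\mathbb{N},\ \varepsilon\theta_{n_1}\cdots\theta_{n_s}>\theta_m\}$ (ordinal products; $\max\emptyset=0$). A normalized sequence $(x_n)$ is an $\ell^1$-$\mathcal{F}$-spreading model if for some $K$, $\|\sum_{n\in F}a_nx_n\|\ge K^{-1}\sum_{n\in F}|a_n|$ for all $F\in\mathcal{F}$ and all scalars. *)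

(* Defs.v *)
From mathcomp Require Import all_boot all_order all_algebra.
From mathcomp Require Import boolp classical_sets cardinality reals topology
  normedtype sequences.

Set Implicit Arguments.
Unset Strict Implicit.
Unset Printing Implicit Defensive.

Import Order.TTheory GRing.Theory Num.Theory numFieldNormedType.Exports.
Local Open Scope classical_set_scope.
Local Open Scope ring_scope.

(* Countable ordinals as Brouwer trees.  [BL f] denotes sup_n (f n).        *)
(* Every countable ordinal (< omega_1) is denoted by some tree and every    *)
(* tree denotes a countable ordinal.  Order is the semantic one.            *)
Inductive bord : Type :=
| BZ : bord
| BS : bord -> bord
| BL : (nat -> bord) -> bord.

Fixpoint ole (x y : bord) {struct x} : Prop :=
  match x with
  | BZ => True
  | BS x' =>
      (fix olt_aux (y : bord) : Prop :=
         match y with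
         | BZ => False
         | BS y' => ole x' y'
         | BL g => exists n, olt_aux (g n)
         end) y
  | BL f => forall n, ole (f n) y
  end.

Definition olt (x y : bord) : Prop := ole (BS x) y.
Definition oeq (x y : bord) : Prop := ole x y /\ ole y x.

Fixpoint ofin (n : nat) : bord :=
  match n with O => BZ | S n => BS (ofin n) end.

Definition oomega : bord := BL ofin.

Fixpoint oadd (a b : bord) : bord :=
  match b with
  | BZ => a
  | BS b => BS (oadd a b)
  | BL f => BL (fun n => oadd a (f n))
  end.

Fixpoint omul (a b : bord) : bord :=
  match b with
  | BZ => BZ
  | BS b => oadd (omul a b) a
  | BL f => BL (fun n => omul a (f n))
  end.

Fixpoint wexp (b : bord) : bord :=
  match b with
  | BZ => BS BZ
  | BS b => omul (wexp b) oomega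
  | BL f => BL (fun n => wexp (f n))
  end.

(* ell a L : L is the leading exponent of the Cantor normal form of a,
   i.e.  a = omega^L * m + r  with 1 <= m < omega and r < omega^L. *)
Definition is_ell (a L : bord) : Prop :=
  exists (m : nat) (r : bord),
    (0 < m)%N /\ olt r (wexp L) /\ oeq a (oadd (omul (wexp L) (ofin m)) r).

(* Families of subsets of N = {1,2,...}  (represented inside nat, 0 unused) *)
Definition Npos : set nat := [set n | (0 < n)%N].

Definition setof (s : seq nat) : set nat := [set x | x \in s].

(* agreement on the basic clopen neighbourhood {0,...,k-1} of 2^N *)
Definition agree (A B : set nat) (k : nat) : Prop :=
  forall i, (i < k)%N -> (A i <-> B i).

Definition hereditary (F : set (set nat)) : Prop :=
  forall A B, F A -> B `<=` A -> F B.

Definition spreading (F : set (set nat)) : Prop :=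
  forall s t : seq nat, sorted ltn s -> sorted ltn t -> size s = size t ->
    all2 leq s t -> F (setof s) -> F (setof t).

(* compact in 2^N (2^N being compact Hausdorff: closed in 2^N) *)
Definition compact2N (F : set (set nat)) : Prop :=
  forall A, (forall k, exists B, F B /\ agree B A k) -> F A.

Definition regular (F : set (set nat)) : Prop :=
  (forall A, F A -> finite_set A /\ A `<=` Npos) /\
  hereditary F /\ spreading F /\ compact2N F.

Definition derived (F : set (set nat)) : set (set nat) :=
  [set A | forall k, exists B, F B /\ B <> A /\ agree B A k].

Fixpoint CBder (F : set (set nat)) (b : bord) : set (set nat) :=
  match b with
  | BZ => F
  | BS b => derived (CBder F b)
  | BL f => \bigcap_n CBder F (f n)
  end.

Definition CB_index (F : set (set nat)) (b : bord) : Prop :=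
  CBder F b = [set set0].

Definition blocks (Es : seq (seq nat)) : Prop :=
  all (fun E => [&& sorted ltn E, E != [::] & all (fun i => (0 < i)%N) E]) Es /\
  sorted (fun E E' => (last 0%N E < head 0%N E')%N) Es.

Definition admissible (F : set (set nat)) (Es : seq (seq nat)) : Prop :=
  blocks Es /\ F (setof (map (head 0%N) Es)).

Definition compose (Mf Nf : set (set nat)) : set (set nat) :=
  [set A | exists Es, admissible Mf Es /\ (forall E, E \in Es -> Nf (setof E))
                       /\ A = setof (flatten Es)].

Definition S0 : set (set nat) :=
  [set A | A = set0 \/ exists n, (0 < n)%N /\ A = [set n]].

Definition S1 : set (set nat) :=
  [set A | exists s, [/\ sorted ltn s, all (fun i => (0 < i)%N) s,
                        A = setof s & (size s <= head 0%N s)%N]].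

(* Schreier families along a tree: at a limit node BL f the fixed
   sequence beta_n (n >= 1) is f (n-1); so "n <= min F" becomes k < min F. *)
Fixpoint schreier (t : bord) : set (set nat) :=
  match t with
  | BZ => S0
  | BS b => compose S1 (schreier b)
  | BL f => [set A | exists k, schreier (f k) A /\ forall i, A i -> (k < i)%N]
  end.

Inductive subtree : bord -> bord -> Prop :=
| st_refl t : subtree t t
| st_S u b : subtree u b -> subtree u (BS b)
| st_L u f n : subtree u (f n) -> subtree u (BL f).

(* A tree encoding a (global) choice of fundamental sequences: every limit
   node has a strictly increasing sequence, and equal ordinals are encoded
   by the same subtree (so the choice depends only on the ordinal). *)
Definition schreier_tree (t : bord) : Prop :=
  (forall f, subtree (BL f) t -> forall n, olt (f n) (f n.+1)) /\
  (forall u v, subtree u t -> subtree v t -> oeq u v -> u = v).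

Section Space.
Variable R : realType.

Definition is_lub (S : set R) (r : R) : Prop :=
  (forall s, S s -> s <= r) /\ (forall u, (forall s, S s -> s <= u) -> r <= u).

Definition c00 (x : nat -> R) : Prop :=
  x 0%N = 0 /\ exists k, forall i, (k <= i)%N -> x i = 0.

Definition restrict (E : seq nat) (x : nat -> R) : nat -> R :=
  fun i => if i \in E then x i else 0.

Definition tsirelson_norm (theta : nat -> R) (F : nat -> set (set nat))
    (N : (nat -> R) -> R) : Prop :=
  forall x, c00 x ->
    is_lub [set r | (exists i, r = `|x i|) \/
                    (exists n Es, admissible (F n) Es /\
                       r = theta n * \sum_(E <- Es) N (restrict E x))]
           (N x).

Definition trunc (k : nat) (y : nat -> R) : nat -> R :=
  fun i => if (i < k)%N then y i else 0.

(* elements of the completion X, realised as coordinate sequences whose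
   initial segments are Cauchy for N *)
Definition inX (N : (nat -> R) -> R) (y : nat -> R) : Prop :=
  y 0%N = 0 /\
  forall e : R, 0 < e -> exists k0, forall k l, (k0 <= k)%N -> (k0 <= l)%N ->
    N (fun i => trunc k y i - trunc l y i) < e.

Definition normX (N : (nat -> R) -> R) (y : nat -> R) : R :=
  limn (fun k => N (trunc k y)).

Definition l1_spreading_model_in (N : (nat -> R) -> R) (M : set nat)
    (Fam : set (set nat)) (xs : nat -> nat -> R) : Prop :=
  (forall n, inX N (xs n) /\ (forall i, ~ M i -> xs n i = 0) /\
             normX N (xs n) = 1) /\
  exists K : R, 0 < K /\
    forall s : seq nat, uniq s -> Fam (setof s) -> forall a : nat -> R,
      K^-1 * \sum_(n <- s) `|a n| <= normX N (fun i => \sum_(n <- s) a n * xs n i).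

Definition prod_alpha (alpha : nat -> bord) : seq nat -> bord :=
  fix P ns := match ns with
              | [::] => BS BZ
              | n :: ns' => omul (P ns') (alpha n)
              end.

Definition gamma_set (theta : nat -> R) (alpha : nat -> bord) (eps : R) (m : nat)
  : set bord :=
  [set L | exists ns : seq nat, ns <> [::] /\
       theta m < eps * \prod_(n <- ns) theta n /\ is_ell (prod_alpha alpha ns) L].

Definition is_gamma (theta : nat -> R) (alpha : nat -> bord) (eps : R) (m : nat)
    (g : bord) : Prop :=
  (forall L, gamma_set theta alpha eps m L -> ole L g) /\
  (gamma_set theta alpha eps m g \/
   (gamma_set theta alpha eps m = set0 /\ oeq g BZ)).

Definition dagger (theta : nat -> R) (alpha : nat -> bord) (xi : bord) : Prop :=
  exists eps : R, 0 < eps /\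
    forall beta, olt beta (wexp xi) ->
      exists m g L, is_gamma theta alpha eps m g /\ is_ell (alpha m) L /\
        olt (oadd (oadd g (ofin 2)) beta) L.

End Space.

(* Main.v *)
Require Import Defs.
From mathcomp Require Import all_boot all_order all_algebra.
From mathcomp Require Import boolp classical_sets cardinality reals topology
  normedtype sequences.
From mathcomp Require Import zify ring lra.
Import Order.TTheory GRing.Theory Num.Theory numFieldNormedType.Exports.
Local Open Scope classical_set_scope.
Local Open Scope ring_scope.

Set Implicit Arguments.
Unset Strict Implicit.
Unset Printing Implicit Defensive.

(* The spreading model consists of normalized ruler vectors
     x_i = sum_(q <= i) (1 / theta_(m_q)) c_i^q,
   where c_i^q is a probability measure with the following properties.
   - Its support is so large that the union of the supports of the c_i^q,
     i in A, belongs to F_(m_q) for every A in the Schreier family of order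
     beta_q with q < min A.  Hence one operation theta_(m_q) gives the lower
     estimate sum |a_i| for all such A, and these A form S_(omega^xi).
   - It has tiny mass on the products F_(n_1)[...[F_(n_s)]] that are not light
     for theta_(m_q): this is what (dagger) makes possible, since the indices of
     those products are below that of F_(m_q) by a prescribed margin.
   - The supports of c_i^0, c_i^1, ... are interleaved like the marks of a ruler:
     the gap in front of a point of c_i^q carries the same mass of c_i^(q+1).
   For the upper estimate a norming functional is written as a tree.  A leaf at a
   point of level q contributes substantially only if its weight lies in a window
   [lam q, theta_(m_q) / eps].  Interleaving shows that the masses, at the various
   levels q, of the leaves for which q is the only window entered after a given
   one add up to at most 1 + small, since such leaves sit in disjoint intervals;
   and each earlier window entered gains a factor that is summable. *)

(** * Ordinals *)

(** Interleaving has an ordinal price. The level-[q] points of [x_i] come out of nested averagings,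
    one game of rank [wexp (rho k)] for each [k <= q], so they use up rank omega^(rho_q + ... +
    rho_0) of F_(m_q), and the union over a Schreier set multiplies this by omega^(f q). When m_q is
    chosen, rho_0, ..., rho_(q-1) and f q are already known; they go into the ordinal beta of
    (dagger), which is why (dagger) is needed for arbitrarily large beta below omega^xi. Only rho_q
    depends on m_q: it has to exceed the exponents of all products not light for m_q, and these are
    controlled by gamma(eps, m_q) and by finitely many earlier paths. The new exponent stands on the
    left of the old sum, just as gamma stands on the left of beta, so noncommutativity does no harm.
    A second difficulty is that [N] is known only as a solution of the implicit norm equation.
    Homogeneity and the upper estimate are therefore derived by approximating [N x] by norming
    trees. *)

Lemma ole_S a b : ole (BS a) (BS b) = ole a b. Proof. by []. Qed.

Lemma ole_BL a g n : ole a (g n) -> ole a (BL g).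
Proof.
elim: a => [|a IH|f IH] //; last by move=> H k; apply: IH.
by move=> H; exists n.
Qed.

Lemma ole_refl a : ole a a.
Proof. by elim: a => [|a IH|f IH] // n; apply: (@ole_BL _ _ n). Qed.
#[local] Hint Resolve ole_refl : core.

Lemma ole_trans b a c : ole a b -> ole b c -> ole a c.
Proof.
elim: a b c => [|a IHa|f IHf] b c //; last by move=> H1 H2 n; apply: IHf (H1 n) H2.
elim: b c => [|b IHb|g IHg] c //.
- elim: c => [|c IHc|h IHh] //; first by move=> /=; apply: IHa.
  by move=> H1 [n H2]; exists n; apply: IHh.
- by move=> [n H1] H2; apply: IHg H1 (H2 n).
Qed.

Lemma ole_olt_total a b : ole a b \/ olt b a.
Proof.
elim: a b => [|a IHa|f IHf] b; first by left.
- elim: b => [|b IHb|g IHg]; first by right.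
  + by case: (IHa b); [left|right].
  + have [[n Hn]|H] := pselect (exists n, ole (BS a) (g n)); first by left; exists n.
    right => n; case: (IHg n) => // H'; case: H; by exists n.
- have [H|/existsNP[n Hn]] := pselect (forall n, ole (f n) b); first by left.
  by right; case: (IHf n b) => // H; exists n.
Qed.

Lemma ole_total a b : ole a b \/ ole b a.
Proof.
case: (ole_olt_total a b) => [|H]; [by left|right].
apply: ole_trans H; elim: b => [|b IH|f IH] //= n.
by apply: ole_trans (IH n) _; rewrite /= -/(ole (f n) _); apply: (@ole_BL _ _ n).
Qed.

Lemma ole_BS a : ole a (BS a).
Proof.
elim: a => [|b IH|f IH] //= n.
by apply: ole_trans (IH n) _; rewrite ole_S; apply: (@ole_BL _ _ n).
Qed.

Lemma oltW a b : olt a b -> ole a b.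
Proof. by apply: ole_trans; apply: ole_BS. Qed.

Lemma ole_lt_trans a b c : ole a b -> olt b c -> olt a c.
Proof. by move=> H; apply: ole_trans. Qed.

Lemma olt_le_trans a b c : olt a b -> ole b c -> olt a c.
Proof. exact: ole_trans. Qed.

Lemma olt_irr a : ~ olt a a.
Proof.
elim: a => [|a IH|f IH] // [n H]; apply: (IH n).
by apply: ole_lt_trans (H : olt (BL f) (f n)); apply: (@ole_BL _ _ n).
Qed.

Lemma not_ole a b : ~ ole a b -> olt b a.
Proof. by case: (ole_olt_total a b). Qed.

Lemma oadd0 b : oadd BZ b = b.
Proof. by elim: b => [|b /= ->|f IH] //=; congr BL; apply: funext. Qed.

Lemma oaddA a b c : oadd (oadd a b) c = oadd a (oadd b c).
Proof. by elim: c => [|c /= ->|f IH] //=; congr BL; apply: funext. Qed.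

Lemma omulDr a b c : omul a (oadd b c) = oadd (omul a b) (omul a c).
Proof. by elim: c => [|c /= ->|f IH] //=; [rewrite oaddA|congr BL; apply: funext]. Qed.

Lemma omulA a b c : omul (omul a b) c = omul a (omul b c).
Proof. by elim: c => [|c /= ->|f IH] //=; [rewrite omulDr|congr BL; apply: funext]. Qed.

Lemma omul1 a : omul a (BS BZ) = a. Proof. exact: oadd0. Qed.

Lemma omul1l a : omul (BS BZ) a = a.
Proof. by elim: a => [|a /= ->|f IH] //=; congr BL; apply: funext. Qed.

Lemma wexpD a b : wexp (oadd a b) = omul (wexp a) (wexp b).
Proof.
elim: b => [|b /= ->|f IH] //=; first by rewrite oadd0.
- by congr BL; apply: funext => n; rewrite -omulA.
- by congr BL; apply: funext.
Qed.

Lemma ole_addr a b : ole a (oadd a b).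
Proof.
elim: b => [|b IH|f IH] //=; first exact: ole_trans IH (ole_BS _).
exact: (@ole_BL _ _ 0%N (IH 0%N)).
Qed.

Lemma oadd_monor a b c : ole b c -> ole (oadd a b) (oadd a c).
Proof.
elim: b c => [|b IH|f IH] c; first by move=> _; apply: ole_addr.
- by elim: c => [|c IHc|g IHg] //=; [apply: IH|move=> [n H]; exists n; apply: IHg].
- by move=> H n; apply: IH.
Qed.

Lemma oadd_monol a b c : ole a b -> ole (oadd a c) (oadd b c).
Proof.
by move=> H; elim: c => [|c IH|f IH] //= n; apply: (@ole_BL _ _ n).
Qed.

Lemma ole_addl a b : ole b (oadd a b).
Proof. by rewrite -{1}(oadd0 b); apply: oadd_monol. Qed.

Lemma oadd_mono a b c d : ole a b -> ole c d -> ole (oadd a c) (oadd b d).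
Proof. by move=> H1 H2; apply: ole_trans (oadd_monol _ H1) (oadd_monor _ H2). Qed.

Lemma omul_monor a b c : ole b c -> ole (omul a b) (omul a c).
Proof.
elim: b c => [|b IH|f IH] c //.
- elim: c => [|c IHc|g IHg] //=; first by move=> H; apply: oadd_monol; apply: IH.
  by move=> [n H]; apply: (@ole_BL _ _ n); apply: IHg.
- by move=> H n; apply: IH.
Qed.

Lemma omul_monol a b c : ole a b -> ole (omul a c) (omul b c).
Proof.
move=> H; elim: c => [|c IH|f IH] //=; first exact: oadd_mono.
by move=> n; apply: (@ole_BL _ _ n).
Qed.

Lemma omul_mono a b c d : ole a b -> ole c d -> ole (omul a c) (omul b d).
Proof. by move=> H1 H2; apply: ole_trans (omul_monol _ H1) (omul_monor _ H2). Qed.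

Lemma wexp_pos a : ole (BS BZ) (wexp a).
Proof.
elim: a => [|a IH|f IH] //; last by exists 0%N; apply: (IH 0%N).
by exists 1%N; rewrite /= oadd0.
Qed.

Lemma wexp_mono a b : ole a b -> ole (wexp a) (wexp b).
Proof.
elim: a b => [|a IH|f IH] b; first by move=> _; apply: wexp_pos.
- elim: b => [|b IHb|g IHg] //; first by move=> H; apply: omul_monol; apply: IH.
  by move=> [n H]; apply: (@ole_BL _ (fun n => wexp (g n)) n); apply: IHg.
- by move=> H n; apply: IH.
Qed.

Lemma ofin_mono n m : (n <= m)%N -> ole (ofin n) (ofin m).
Proof.
elim: n m => [|n IH] [|m] //= H; exact: IH.
Qed.

Lemma ofinD n m : ofin (n + m) = oadd (ofin n) (ofin m).
Proof. by rewrite addnC; elim: m => //= m <-. Qed.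

Lemma wexp_lt_S a : olt (wexp a) (wexp (BS a)).
Proof.
exists 2%N => /=; rewrite oadd0.
exact: (@oadd_monor _ (BS BZ) _ (wexp_pos a)).
Qed.

Lemma wexp_lt a b : olt a b -> olt (wexp a) (wexp b).
Proof. by move=> H; apply: olt_le_trans (wexp_lt_S a) (wexp_mono H). Qed.

Lemma wexp_lt_inv a b : olt (wexp a) (wexp b) -> olt a b.
Proof.
move=> H; apply: not_ole => H'; apply: (@olt_irr (wexp a)).
by apply: olt_le_trans H _; apply: wexp_mono.
Qed.

Lemma ole_wexp a : ole a (wexp a).
Proof.
elim: a => [|a IH|f IH] //; first exact: ole_lt_trans IH (wexp_lt_S a).
by move=> n; apply: (@ole_BL _ (fun n => wexp (f n)) n).
Qed.

(** Mostly applied to exponents: omega^xi is itself a power of omega, so finitely many exponents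
    below it can be added. *)
Lemma wexp_add_closed x a b :
  olt a (wexp x) -> olt b (wexp x) -> olt (oadd a b) (wexp x).
Proof.
elim: x a b => [|x IH|f IH] a b.
- by move=> Ha Hb; apply: (@oadd_mono a BZ b BZ).
- move=> [n Ha] [m Hb]; exists (n + m)%N.
  change (olt (oadd a b) (omul (wexp x) (ofin (n + m)))); rewrite ofinD omulDr.
  apply: (@ole_trans (oadd a (omul (wexp x) (ofin m)))).
    exact: (@oadd_monor a (BS b) _ Hb).
  by apply: oadd_monol; apply: oltW.
- move=> [n Ha] [m Hb].
  have [H|H] := ole_total (f n) (f m); [exists m|exists n]; apply: IH => //.
    by apply: olt_le_trans Ha _; apply: wexp_mono.
  by apply: olt_le_trans Hb _; apply: wexp_mono.
Qed.

(** At a limit the remainder is the supremum of the remainders of those [f n] that reach [b]; the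
    other indices get a remainder that adds nothing to [b]. If no [f n] reaches [b], the two
    ordinals are equal. *)
Lemma osub_ex a b : ole b a -> exists r, oeq a (oadd b r).
Proof.
elim: a => [|a IH|f IH] H.
- by exists BZ; split.
- case: (ole_olt_total b a) => [/IH[r [H1 H2]]|H']; first by exists (BS r).
  by exists BZ; split.
- have [[n0 Hn0]|Hn] := pselect (exists n, ole b (f n)); last first.
    exists BZ; split=> //= n; case: (ole_olt_total b (f n)) => [H'|/oltW //].
    by case: Hn; exists n.
  have /choice[r Hr] : forall n, exists r, ole (f n) (oadd b r) /\
      (ole (oadd b r) (f n) \/ ole (oadd b r) b).
    move=> n; case: (ole_olt_total b (f n)) => [/IH[r [H1 H2]]|/oltW H'].
      by exists r; split => //; left.
    by exists BZ; split => //; right.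
  exists (BL r); split => n; first by apply: (@ole_BL _ _ n); apply: (Hr n).1.
  case: (Hr n).2 => H'; first exact: ole_BL H'.
  by apply: ole_trans H' _; apply: ole_BL Hn0.
Qed.

(** Descent along the tree [BS a]: it stops at the first successor step whose power of omega is at
    most [a], and at limits follows a child that still bounds [a]. *)
Lemma wexp_between a : olt BZ a -> exists L, ole (wexp L) a /\ olt a (wexp (BS L)).
Proof.
move=> a0.
have : olt a (wexp (BS a)) by apply: ole_lt_trans (ole_wexp a) (wexp_lt_S a).
elim: (BS a) => [H|c IH H|f IH [n H]]; last exact: IH H.
- by case: (@olt_irr a); apply: (@ole_lt_trans a BZ a H a0).
- by case: (ole_olt_total (wexp c) a) => [|/IH //]; exists c.
Qed.

Lemma omul_between a w n : olt a (omul w (ofin n)) ->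
  exists m, ole (omul w (ofin m)) a /\ olt a (omul w (ofin m.+1)).
Proof.
elim: n => [//|n IH] H; case: (ole_olt_total (omul w (ofin n)) a) => [|/IH //].
by exists n.
Qed.

Lemma is_ell_ex a : olt BZ a -> exists L, is_ell a L.
Proof.
move=> /wexp_between[L [H1 [n]]] /omul_between[m [Hm Hm1]]; exists L.
have [r [Hr1 Hr2]] := osub_ex Hm.
exists m, r; split; last split; last by split.
- case: m Hm Hm1 {Hr1 Hr2} => // _; rewrite /= oadd0 => H.
  by case: (@olt_irr a); apply: olt_le_trans H H1.
- apply: not_ole => H; apply: (@olt_irr a); apply: olt_le_trans Hm1 _.
  by apply: ole_trans (oadd_monor _ H) _.
Qed.

Lemma is_ell_bounds a L : is_ell a L -> ole (wexp L) a /\ olt a (wexp (BS L)).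
Proof.
move=> [m [r [m0 [Hr [H1 H2]]]]]; split.
- case: m m0 H1 H2 => // m _ H1; apply: ole_trans => /=.
  by apply: ole_trans (ole_addr _ _); apply: ole_addl.
- exists m.+1; apply: ole_lt_trans H1 _; exact: (@oadd_monor _ (BS r)).
Qed.

(** * Derivatives of families of finite sets *)

(* The order on finite increasing lists generated by passing to subsets and by
   spreading. *)
Fixpoint dom (s t : seq nat) : bool :=
  match s with
  | [::] => t == [::]
  | x :: s' => dom s' t || (if t is y :: t' then (x <= y)%N && dom s' t' else true)
  end.

Lemma dom_nil s : dom s [::].
Proof. by elim: s => //= x s ->. Qed.

Lemma dom_refl s : dom s s.
Proof. by elim: s => //= x s ->; rewrite leqnn orbT. Qed.

Lemma dom_catP a b t : dom (a ++ b) t ->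
  exists t1 t2, [/\ t = t1 ++ t2, dom a t1 & dom b t2].
Proof.
elim: a t => [|x a IH] t; first by move=> H; exists [::], t.
rewrite cat_cons [dom _ _]/= => /orP[/IH[t1 [t2 [-> H1 H2]]]|].
  by exists t1, t2; split=> //=; rewrite H1.
case: t => [_|y t /andP[xy /IH[t1 [t2 [-> H1 H2]]]]].
  by exists [::], [::]; split; rewrite ?dom_nil.
by exists (y :: t1), t2; split=> //=; rewrite xy H1 orbT.
Qed.

Lemma dom_cat a b c d : dom a c -> dom b d -> dom (a ++ b) (c ++ d).
Proof.
elim: a c => [|x a IH] c /=; first by move=> /eqP ->.
move=> /orP[H1|]; first by move=> H2; rewrite IH.
case: c => [|y c /andP[xy H1] H2] /=; last by rewrite xy IH ?orbT.
by move=> _ H2; have /= := IH [::] (dom_nil _) H2 => ->.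
Qed.

Lemma dom_subseq t s : subseq t s -> dom s t.
Proof.
elim: s t => [|x s IH] [|y t] //=; first by rewrite dom_nil.
by case: eqP => [->|_] /IH ->; rewrite ?leqnn ?orbT.
Qed.

Lemma domP s t : dom s t -> exists s0, subseq s0 s /\ all2 leq s0 t.
Proof.
elim: s t => [|x s IH] t /=; first by move=> /eqP ->; exists [::].
move=> /orP[/IH[s0 [H1 H2]]|].
  by exists s0; split=> //; exact: subseq_trans H1 (subseq_cons _ _).
case: t => [_|y t /andP[xy /IH[s0 [H1 H2]]]]; first by exists [::].
by exists (x :: s0); split; rewrite /= ?eqxx ?xy.
Qed.

Lemma dom_head s y t : sorted ltn s -> dom s (y :: t) -> (head 0%N s <= y)%N.
Proof.
elim: s => [//|x s IH] /= Hp /orP[|/andP[] //] H.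
apply: leq_trans (IH (path_sorted Hp) H).
by case: s Hp H {IH} => //= z s /andP[/ltnW].
Qed.

Lemma dom_singl x y : (x <= y)%N -> dom [:: x] [:: y].
Proof. by move=> H /=; rewrite H. Qed.

Lemma path_rcons_gt x s n : path ltn x s -> (last x s < n)%N -> path ltn x (rcons s n).
Proof. by move=> H1 H2; rewrite rcons_path H1. Qed.

Lemma subset_subseq s t : sorted ltn s -> sorted ltn t -> {subset s <= t} -> subseq s t.
Proof.
move=> Hs Ht H.
have -> : s = [seq x <- t | x \in s].
  apply: (irr_sorted_eq ltn_trans ltnn) => //.
    exact: sorted_filter ltn_trans _ _ Ht.
  by move=> x; rewrite mem_filter; case Hx: (x \in s) => //=; rewrite H.
exact: filter_subseq.
Qed.

Section Der.
Variables (T : Type) (ab : nat -> T -> bool).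

(** Cantor-Bendixson derivation as a game: [s] survives one more derivation if it can be prolonged
    by moves arbitrarily far out. The moves are natural numbers for the families [F n], and blocks
    of ruler vectors in the construction. *)
Fixpoint der (H : seq T -> Prop) (b : bord) : seq T -> Prop :=
  match b with
  | BZ => H
  | BS b => fun s => forall N, exists x, ab N x /\ der H b (rcons s x)
  | BL f => fun s => forall n, der H (f n) s
  end.

Lemma der_sub (H H' : seq T -> Prop) b s :
  (forall s, H s -> H' s) -> der H b s -> der H' b s.
Proof.
move=> HH; elim: b s => [|b IH|f IH] s /=; first exact: HH.
  by move=> Hs N; have [x [Hx /IH]] := Hs N; exists x.
by move=> Hs n; apply: IH.
Qed.

Lemma der_oadd H a b s : der H (oadd a b) s <-> der (der H a) b s.
Proof.
elim: b s => [|b IH|f IH] s //=.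
  by split=> Hs N; have [x [Hx /IH]] := Hs N; exists x.
by split=> Hs n; apply/IH.
Qed.

Lemma der_shift H H' s0 s1 b s : (forall s, H (s0 ++ s) -> H' (s1 ++ s)) ->
  der H b (s0 ++ s) -> der H' b (s1 ++ s).
Proof.
move=> HH; elim: b s => [|b IH|f IH] s /=; first exact: HH.
  move=> Hs N; have [x [Hx]] := Hs N; rewrite rcons_cat => /IH Hsx; exists x.
  by rewrite rcons_cat.
by move=> Hs n; apply: IH.
Qed.

Lemma der_mono H a b s : (forall s x, H (rcons s x) -> H s) ->
  ole a b -> der H b s -> der H a s.
Proof.
move=> HH.
have der0 b' s' : der H b' s' -> H s'.
  elim: b' s' => [|b' IH|f IH] s' //=; last by move=> /(_ 0%N) /IH.
  by move=> /(_ 0%N) [x [_ /IH /HH]].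
elim: a b s => [|a IH|f IH] b s; first by move=> _ /der0.
  elim: b s => [|b IHb|g IHg] s //.
    by move=> Hab Hs N; have [x [Hx Hs']] := Hs N; exists x; split => //; apply: IH Hs'.
  by move=> [n Hn] /(_ n); apply: IHg.
by move=> Hab Hs n; apply: IH Hs.
Qed.

End Der.

(** The values [f n] are linearly ordered although [f] need not be monotone, so the largest of
    finitely many witnesses serves all of [l]. *)
Lemma BL_common (I : eqType) (l : seq I) (A : I -> bord -> Prop) (f : nat -> bord) :
  (forall x a b, x \in l -> ole a b -> A x a -> A x b) ->
  (forall x, x \in l -> exists n, A x (f n)) ->
  exists n, forall x, x \in l -> A x (f n).
Proof.
elim: l => [|x l IH] up H; first by exists 0%N.
have xl y : y \in l -> y \in x :: l by rewrite inE => ->; rewrite orbT.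
have [n Hn] : exists n, forall x, x \in l -> A x (f n).
  by apply: IH => [y a b /xl|y /xl]; [apply: up|apply: H].
have [m Hm] := H x (mem_head _ _).
have [nm|mn] := ole_total (f n) (f m); [exists m|exists n] => y.
- by rewrite inE => /orP[/eqP -> //|yl]; apply: up nm (Hn _ yl); apply: xl.
- by rewrite inE => /orP[/eqP ->|/Hn //]; apply: up mn Hm; apply: mem_head.
Qed.

Notation nder := (der ltn).

(** Hereditary spreading families as sets of increasing lists of positive integers; closure under
    [dom] is heredity and spreading in one. *)
Definition lfam (H : seq nat -> Prop) :=
  (forall s, H s -> path ltn 0%N s) /\
  (forall s t, H s -> dom s t -> path ltn 0%N t -> H t).

Lemma lfam_rcons H s x : lfam H -> H (rcons s x) -> H s.
Proof.
move=> [H1 H2] Hs; have := H1 _ Hs; rewrite rcons_path => /andP[Hp _].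
by apply: H2 Hs _ Hp; apply: dom_subseq; apply: subseq_rcons.
Qed.

Lemma lfam_der H b : lfam H -> lfam (nder H b).
Proof.
move=> HH; elim: b => [//|b IH|f IH].
- split=> [s /(_ 0%N)[n [_ /(lfam_rcons IH)]]|]; first by apply: IH.1.
  move=> s t Hs st Ht N; have [x [Hx Hsx]] := Hs (maxn N (last 0%N t)).
  exists x; split; first by apply: leq_ltn_trans Hx; rewrite leq_maxl.
  apply: IH.2 Hsx _ _.
    by rewrite -!cats1; apply: dom_cat => //; apply: dom_refl.
  by apply: path_rcons_gt => //; apply: leq_ltn_trans Hx; rewrite leq_maxr.
- split=> [s /(_ 0%N)|s t Hs st Ht n]; first by apply: (IH _).1.
  by apply: (IH n).2 st Ht.
Qed.

Lemma nder_mono H a b s : lfam H -> ole a b -> nder H b s -> nder H a s.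
Proof. by move=> HH; apply: der_mono => s' x; apply: lfam_rcons. Qed.

Lemma nder0 H b s : lfam H -> nder H b s -> H s.
Proof. by move=> HH; apply: (@nder_mono H BZ b). Qed.

(** Spreading upgrades arbitrarily far extensions to all extensions beyond one point. *)
Lemma nder_ev H b s : lfam H -> nder H (BS b) s ->
  exists N, forall n, (N < n)%N -> nder H b (rcons s n).
Proof.
move=> HH /(_ 0%N)[n0 [_ Hn0]]; exists n0 => n nn.
have Hp := (lfam_der b HH).1 _ Hn0.
apply: (lfam_der b HH).2 Hn0 _ _.
  by rewrite -!cats1; apply: dom_cat; rewrite ?dom_refl // dom_singl // ltnW.
by move: Hp; rewrite !rcons_path => /andP[-> Hl] /=; apply: ltn_trans Hl nn.
Qed.

(** A single extension [n], however small, spreads to all larger ones; so outside the derivative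
    there is none. *)
Lemma nder_evN H b s : lfam H -> ~ nder H (BS b) s ->
  forall n, ~ nder H b (rcons s n).
Proof.
move=> HH Hs n Hn; apply: Hs => N.
exists (maxn n N).+1; split; first by rewrite /= ltnS leq_maxr.
have Hp := (lfam_der b HH).1 _ Hn.
apply: (lfam_der b HH).2 Hn _ _.
  by rewrite -!cats1; apply: dom_cat; rewrite ?dom_refl // dom_singl // ltnW // ltnS leq_maxl.
move: Hp; rewrite !rcons_path => /andP[-> Hl] /=; apply: ltn_trans Hl _.
by rewrite ltnS leq_maxl.
Qed.

Lemma nder_nilS H b : (forall s, nder H b s -> s = [::]) -> ~ nder H (BS b) [::].
Proof. by move=> Hb /(_ 0%N)[n [_ /Hb]]. Qed.

(** By [nder_evN] a family whose derivative misses [s] admits no extension at all, so finitely many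
    failures can be realized together. *)
Lemma nder_bigcup (l : seq nat) (H : nat -> seq nat -> Prop) b s :
  (forall k, k \in l -> lfam (H k)) ->
  nder (fun s => exists2 k, k \in l & H k s) b s -> exists2 k, k \in l & nder (H k) b s.
Proof.
move=> HH; elim: b s => [|b IH|f IH] s /=; first by [].
- move=> Hs; apply: contrapT => Hn.
  have [N HN] : exists N, forall n, (N < n)%N -> forall k, k \in l -> ~ nder (H k) b (rcons s n).
    exists 0%N => n _ k kl; apply: nder_evN => //; first exact: HH.
    by move=> Hk; apply: Hn; exists k.
  by have [x [Nx /IH[k kl /HN]]] := Hs N; apply.
- move=> Hs; apply: contrapT => Hn.
  have [n Hn'] : exists n, forall k, k \in l -> ~ nder (H k) (f n) s.
    apply: (@BL_common _ l (fun k b => ~ nder (H k) b s)) => [k a b kl ab|k kl].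
      by apply: contra_not; apply: nder_mono ab; apply: HH.
    by apply: contrapT => /forallNP Hk; apply: Hn; exists k => // n; apply: contrapT.
  by have [k kl Hk] := IH n s (Hs n); apply: (Hn' k kl Hk).
Qed.

(** * From families of sets to families of lists *)

Definition lf (F : set (set nat)) (s : seq nat) : Prop := path ltn 0%N s /\ F (setof s).

Lemma regular_lfam F : regular F -> lfam (lf F).
Proof.
move=> [_ [her [spr _]]]; split=> [s []//|s t [Hs HF] /domP[s0 [s0s st]] Ht].
have Hs0 : path ltn 0%N s0 by apply: subseq_path s0s Hs; apply: ltn_trans.
split => //; apply: (spr s0) => //; first exact: path_sorted Hs0.
- exact: path_sorted Ht.
- by move: st; rewrite all2E => /andP[/eqP].
- by apply: her HF _ => x; apply: (mem_subseq s0s).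
Qed.

Lemma agree_sub (A B : set nat) k : (forall i, A i -> (i < k)%N) -> agree B A k ->
  A `<=` B.
Proof. by move=> Ak H i Ai; apply/(H i (Ak i Ai)). Qed.

Lemma agree_new (A B : set nat) k : (forall i, A i -> (i < k)%N) -> agree B A k ->
  B <> A -> exists n, [/\ B n, ~ A n & (k <= n)%N].
Proof.
move=> Ak H BA; apply: contrapT => Hn; apply: BA.
apply/seteqP; split; last exact: agree_sub Ak H.
move=> n Bn; apply: contrapT => An; apply: Hn; exists n; split=> //.
by rewrite leqNgt; apply/negP => nk; apply: An; apply/(H n nk).
Qed.

Lemma finite_bounded (A : set nat) : finite_set A -> exists k, forall i, A i -> (i < k)%N.
Proof.
move=> /finite_seqP[s ->]; exists (\max_(i <- s) i).+1 => i /= si.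
by rewrite ltnS; apply: (@leq_bigmax_seq _ s xpredT id).
Qed.

Lemma CBder_props F b : regular F ->
  [/\ forall A, CBder F b A -> F A, hereditary (CBder F b) & compact2N (CBder F b)].
Proof.
move=> [fin [her [_ cpt]]]; elim: b => [//|b [sub1 her1 cpt1]|f IH].
- have dsub A : derived (CBder F b) A -> CBder F b A.
    by move=> HA; apply: cpt1 => k; have [B [? []]] := HA k; exists B.
  split; first by move=> A /dsub /sub1.
  + move=> A B HA BA k.
    have [K HK] := finite_bounded (fin _ (sub1 _ (dsub _ HA))).1.
    have HK' i : A i -> (i < maxn k K)%N.
      by move=> /HK iK; rewrite leq_max iK orbT.
    have [C [HC [CA agC]]] := HA (maxn k K).
    have [n [Cn An _]] := agree_new HK' agC CA.
    (* Transplanting the new points of [C] from [A] to its subset [B] gives a set near [B] but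
       different from it. *)
    exists (B `|` (C `\` A)); split; last split.
    * by apply: her1 HC _ => x [/BA Ax|[]//]; apply: (agree_sub HK' agC).
    * by move=> E; apply/An/BA; rewrite -E; right.
    * move=> i ik; split; last by left.
      by move=> [//|[Ci]]; case; by apply/(agC i) => //; rewrite leq_max ik.
  + move=> A HA k; have [B [HB AB]] := HA k.
    have [E|BA] := pselect (B = A); first by move: (HB k); rewrite E.
    (* [B] differs from [A] at [j], so a [C] that agrees with [B] up to and including [j] also
       differs from [A]. *)
    have [j Hj] : exists j, ~ (B j <-> A j).
      by apply: contrapT => /forallNP H; apply: BA; apply/seteqP;
         split=> j; have /contrapT[] := H j.
    have [C [HC [CB agC]]] := HB (maxn k j.+1).
    exists C; split=> //; split.
      by move=> E; apply: Hj; rewrite -E -(agC j) // leq_max leqnn orbT.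
    by move=> i ik; rewrite (agC i) ?AB // leq_max ik.
- split=> [A /(_ 0%N I)|A B HA BA n _|A HA n _].
  + by have [+ _ _] := IH 0%N; apply.
  + by have [_ hn _] := IH n; apply: hn (HA n I) BA.
  + have [_ _ cn] := IH n; apply: cn => k; have [B [HB ?]] := HA k.
    by exists B; split=> //; apply: HB.
Qed.

Lemma setof_rcons s n x : setof (rcons s n) x <-> x = n \/ setof s x.
Proof.
rewrite /setof /= mem_rcons inE; split; first by move=> /orP[/eqP|]; [left|right].
by move=> [->|->]; rewrite ?eqxx ?orbT.
Qed.

Lemma path_le_last x s y : path ltn x s -> y \in x :: s -> (y <= last x s)%N.
Proof.
elim: s x y => [|z s IH] x y /=; first by rewrite inE => _ /eqP ->.
move=> /andP[xz Hp]; rewrite inE => /orP[/eqP ->|]; last exact: IH.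
by apply: leq_trans (ltnW xz) _; apply: IH => //; rewrite mem_head.
Qed.

(** A set near [setof s] but different from it has a point beyond [s]; heredity lets all its other
    new points be deleted, so the topological derivative is the game derivative. *)
Lemma CBder_nder F b s : regular F -> path ltn 0%N s ->
  (CBder F b (setof s) <-> nder (lf F) b s).
Proof.
move=> HF; elim: b s => [|b IH|f IH] s Hs /=; first by rewrite /lf; intuition.
- have bnd N i : setof s i -> (i < maxn N.+1 (last 0%N s).+1)%N.
    move=> si; rewrite leq_max !ltnS orbC path_le_last // inE.
    by rewrite (si : i \in s) orbT.
  split=> H N.
  + have [B [HB [Bs ag]]] := H (maxn N.+1 (last 0%N s).+1).
    have [n [Bn sn nN]] := agree_new (@bnd N) ag Bs.
    move: nN; rewrite geq_max => /andP[Nn sn'].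
    exists n; split => //; apply/IH; first exact: path_rcons_gt.
    have [_ her _] := CBder_props b HF.
    apply: her HB _ => x /setof_rcons[->//|]; exact: (agree_sub (@bnd N) ag).
  + have [n [Nn Hn]] := H (maxn N.+1 (last 0%N s).+1).
    have ns : (last 0%N s < n)%N.
      by apply: leq_ltn_trans Nn; apply: leq_trans (leqnSn _) _; rewrite leq_maxr.
    exists (setof (rcons s n)); split; first by apply/IH => //; apply: path_rcons_gt.
    split.
      move=> E; have : setof s n by rewrite -E; apply/setof_rcons; left.
      by move=> /(bnd N); rewrite ltnNge ltnW.
    move=> i iN; rewrite setof_rcons; split; last by right.
    move=> [E|//]; move: iN Nn; rewrite E /= => nN.
    rewrite gtn_max => /andP[/ltnW + _]; by rewrite ltnNge ltnW.
- by split=> H n; [apply/(IH n) => //; apply: H|move=> _; apply/(IH n)].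
Qed.

(** * Composition of families and its index *)

Definition lcomp (H G : seq nat -> Prop) (s : seq nat) : Prop :=
  path ltn 0%N s /\
  exists Es, [/\ flatten Es = s, all (fun E => E != [::]) Es,
                 H (map (head 0%N) Es) & forall E, E \in Es -> G E].

Lemma heads_subseq (Es : seq (seq nat)) : all (fun E => E != [::]) Es ->
  subseq (map (head 0%N) Es) (flatten Es).
Proof.
elim: Es => [//|[//|e E] Es IH] /= H; rewrite eqxx.
exact: subseq_trans (IH H) (suffix_subseq _ _).
Qed.

Lemma path_heads x (Es : seq (seq nat)) : all (fun E => E != [::]) Es ->
  path ltn x (flatten Es) -> path ltn x (map (head 0%N) Es).
Proof. by move=> /heads_subseq; apply: subseq_path; apply: ltn_trans. Qed.

Lemma flatten_subseq (E : seq nat) Es : E \in Es -> subseq E (flatten Es).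
Proof.
elim: Es => [//|D Es IH] /=; rewrite inE => /orP[/eqP ->|/IH].
  exact: prefix_subseq.
by move=> H; apply: subseq_trans H (suffix_subseq _ _).
Qed.

Lemma path_subseq x (s t : seq nat) : subseq s t -> path ltn x t -> path ltn x s.
Proof. by apply: subseq_path; apply: ltn_trans. Qed.

(** Each block of [Es] leaves a possibly empty piece of [t], and the nonempty pieces form [Es'].
    Their minima are not smaller than those of the blocks, so admissibility survives. *)
Lemma dom_flatten Es t : all (fun E => E != [::]) Es -> sorted ltn (flatten Es) ->
  dom (flatten Es) t ->
  exists Es', [/\ flatten Es' = t, all (fun E => E != [::]) Es',
    dom (map (head 0%N) Es) (map (head 0%N) Es') &
    forall E', E' \in Es' -> exists2 E, E \in Es & dom E E'].
Proof.
elim: Es t => [|E Es IH] t; first by move=> _ _ /eqP ->; exists [::].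
move=> /= /andP[E0 HEs] Hs /dom_catP[t1 [t2 [-> d1 d2]]].
have [Es' [<- H1 H2 H3]] := IH _ HEs (subseq_sorted ltn_trans (suffix_subseq _ _) Hs) d2.
case: t1 d1 => [|y t1] d1.
  exists Es'; split=> //; first by rewrite H2.
  by move=> E' /H3[D DE ?]; exists D => //; rewrite inE DE orbT.
exists ((y :: t1) :: Es'); split=> //=.
  rewrite H2 andbT (@dom_head E y t1) ?orbT //.
  exact: (subseq_sorted ltn_trans (prefix_subseq _ _) Hs).
move=> E'; rewrite inE => /orP[/eqP ->|/H3[D DE ?]]; first by exists E; rewrite ?mem_head.
by exists D => //; rewrite inE DE orbT.
Qed.

Lemma lcomp_lfam H G : lfam H -> lfam G -> lfam (lcomp H G).
Proof.
move=> HH HG; split=> [s []//|s t [Hs [Es [Ef E0 EH EG]]] st Ht]; split=> //.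
rewrite -Ef in st Hs; have [Es' [Ef' E0' dE HE]] := dom_flatten E0 (path_sorted Hs) st.
exists Es'; split=> //.
  by apply: HH.2 EH dE _; apply: path_heads => //; rewrite Ef'.
move=> E' E'Es; have [E EEs dEE] := HE _ E'Es.
apply: HG.2 (EG _ EEs) dEE _; apply: path_subseq (flatten_subseq E'Es) _.
by rewrite Ef'.
Qed.

(** A cut at the boundary of two blocks is assigned to the earlier one; hence [E1] is nonempty while
    [E2] may be empty. *)
Lemma flatten_split (Ds : seq (seq nat)) s C : s != [::] -> flatten Ds = s ++ C ->
  exists D0 E1 E2 D1, [/\ Ds = D0 ++ (E1 ++ E2) :: D1, E1 != [::],
    s = flatten D0 ++ E1 & C = E2 ++ flatten D1].
Proof.
elim: Ds s => [|D Ds IH] s s0; first by case: s s0.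
move=> /= E; have [sD|Ds'] := leqP (size s) (size D).
  have Es : s = take (size s) D.
    by move: (congr1 (take (size s)) E); rewrite takel_cat // take_size_cat.
  exists [::], s, (drop (size s) D), Ds; rewrite /= {1}Es cat_take_drop; split=> //.
  move: (congr1 (drop (size s)) E); rewrite [RHS]drop_size_cat // drop_cat.
  move: sD; rewrite leq_eqVlt => /orP[/eqP Esz|->] //.
  by rewrite Esz ltnn subnn drop0 drop_size => <-.
have Es : s = D ++ drop (size D) s.
  have E2 : take (size D) s = D.
    by move: (congr1 (take (size D)) E); rewrite take_size_cat // takel_cat // ltnW.
  by rewrite -{1}E2 cat_take_drop.
have s'0 : drop (size D) s != [::] by rewrite -size_eq0 size_drop subn_eq0 -ltnNge.
have E' : flatten Ds = drop (size D) s ++ C.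
  by move: E; rewrite {1}Es -catA => /eqP; rewrite eqseq_cat // => /andP[_ /eqP].
have [D0 [E1 [E2 [D1 [H1 H2 H3 H4]]]]] := IH _ s'0 E'.
exists (D :: D0), E1, E2, D1; split=> //=; first by rewrite H1.
by rewrite -catA -H3.
Qed.

(* If no decomposition of [s] has its sequence of minima in the derivative, then
   in an extension of [s] the last block of [s] absorbs everything new. *)
Lemma lcomp_der1 H G g s : lfam H -> lfam G -> ole (BS BZ) g ->
  (forall s, nder G g s -> s = [::]) ->
  nder (lcomp H G) g s -> lcomp (nder H (BS BZ)) G s.
Proof.
move=> HH HG g1 HGg Hs; have HL := lcomp_lfam HH HG.
apply: contrapT => Hn.
have Hps : path ltn 0%N s by have [] := nder0 HL Hs.
have Hdec Es n : flatten Es = s -> all (fun E => E != [::]) Es ->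
    (forall E, E \in Es -> G E) -> ~ H (rcons (map (head 0%N) Es) n).
  move=> E1 E2 E3; apply: (@nder_evN H BZ) => // Hd; apply: Hn; split=> //.
  by exists Es.
have [s0|s0] := eqVneq s [::].
  have [n [_ [_ [Ds [D1 D2 D3 D4]]]]] := nder_mono HL g1 Hs 0%N.
  have := Hdec [::] n; rewrite s0 => /(_ erefl erefl); apply => //=.
  have -> // : [:: n] = map (head 0%N) Ds.
  move: D1 D2; rewrite s0 /=.
  by case: Ds {D3 D4} => [//|[//|d [|? ?]] [|[|? ?] ?]] //= [->].
(* [s] is replaced by its last point alone. Every continuation [C] lies in the block of that point,
   so the singleton would have rank [g] in [G], which [HGg] forbids. *)
have : nder G g [:: last 0%N s].
  apply: (@der_shift _ _ (lcomp H G) G s [:: last 0%N s] g [::]); last by rewrite cats0.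
  move=> C [HpC [Ds [D1 D2 D3 D4]]].
  have [D0 [E1 [E2 [D1' [H1 H2 H3 H4]]]]] := flatten_split s0 D1.
  have GE : G (E1 ++ E2) by apply: D4; rewrite H1 mem_cat mem_head orbT.
  have D0Ds E : E \in D0 -> E \in Ds by rewrite H1 mem_cat => ->.
  have D1e : D1' = [::].
    case: D1' H1 H4 => [//|D D1'] H1 H4; exfalso.
    apply: (Hdec (rcons D0 E1) (head 0%N D)).
    - by rewrite flatten_rcons.
    - rewrite all_rcons H2 /=; apply/allP => E /D0Ds; exact: (allP D2).
    - move=> E; rewrite mem_rcons inE => /orP[/eqP ->|/D0Ds /D4 //].
      apply: HG.2 GE _ _; first by apply: dom_subseq; apply: prefix_subseq.
      by apply: path_subseq Hps; rewrite H3; apply: suffix_subseq.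
    - have Hh : path ltn 0%N (map (head 0%N) Ds) by apply: HH.1.
      have Hsub : subseq (rcons (map (head 0%N) (rcons D0 E1)) (head 0%N D)) (map (head 0%N) Ds).
        rewrite H1 map_rcons map_cat /= -!cats1 -catA; apply: cat_subseq => //=.
        by case: (E1) H2 => //= e E1' _; rewrite !eqxx sub0seq.
      by apply: HH.2 D3 (dom_subseq Hsub) (path_subseq Hsub Hh).
  have GEp := HG.1 _ GE.
  have Hsub : subseq ([:: last 0%N s] ++ C) (E1 ++ E2).
    rewrite H4 D1e /= cats0 H3 last_cat.
    have [E1' [x ->]] : exists E1' x, E1 = rcons E1' x.
      by case/lastP: (E1) H2 => // E1' x _; exists E1', x.
    by rewrite last_rcons -cats1 -catA; apply: suffix_subseq.
  exact: HG.2 GE (dom_subseq Hsub) (path_subseq Hsub GEp).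
by move=> /HGg.
Qed.

(** Every run of [g] derivations of the composition costs one derivation of the outer family, whence
    the product with the inner index on the left. *)
Lemma lcomp_der H G g b s : lfam H -> lfam G -> ole (BS BZ) g ->
  (forall s, nder G g s -> s = [::]) ->
  nder (lcomp H G) (omul g b) s -> lcomp (nder H b) G s.
Proof.
move=> HH HG g1 HGg; elim: b s => [//|b IH|f IH] s.
  move=> /= /der_oadd Hs.
  have {}Hs : nder (lcomp (nder H b) G) g s by apply: der_sub Hs.
  exact: (@lcomp_der1 (nder H b) G g s (lfam_der b HH)).
move=> Hs; have Hps : path ltn 0%N s by have [] := IH 0%N s (Hs 0%N).
split=> //; apply: contrapT => Hn.
(* [s] has finitely many decompositions, with minima among the sublists in [l]; hence at a limit one
   [f n] rules out all of them. *)
pose l := [seq mask (val m) s | m : (size s).-tuple bool].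
have inl m : subseq m s -> m \in l.
  move=> /subseqP[mm szm ->]; apply/mapP; have szm' : size mm == size s by apply/eqP.
  by exists (Tuple szm'); rewrite ?mem_enum.
pose dec m := exists Es, [/\ flatten Es = s, all (fun E => E != [::]) Es,
   m = map (head 0%N) Es & forall E, E \in Es -> G E].
have [n Hl] : exists n, forall m, m \in l -> dec m -> ~ nder H (f n) m.
  apply: (@BL_common _ l (fun m b => dec m -> ~ nder H b m)) => [m a b ml ab Hd dm|m ml].
    by apply: contra_not (Hd dm); apply: nder_mono.
  apply: contrapT => /forallNP Hm; apply: Hn.
  have [dm|ndm] := pselect (dec m); last by case: (Hm 0%N) => /ndm.
  have [Es [E1 E2 E3 E4]] := dm; exists Es; split=> //; rewrite -E3 => n.
  by apply: contrapT => H'; apply: (Hm n).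
have [_ [Es [E1 E2 E3 E4]]] := IH n s (Hs n).
apply: (Hl (map (head 0%N) Es)) => //; last by exists Es.
by apply: inl; rewrite -E1; apply: heads_subseq.
Qed.

(* The sets of leaves of type [ns] of trees built with the families [F n]: the
   node at depth [i] of a branch uses [F (nth ns i)]. *)
Fixpoint Fam (F : nat -> set (set nat)) (ns : seq nat) : seq nat -> Prop :=
  match ns with
  | [::] => fun s => path ltn 0%N s /\ (size s <= 1)%N
  | n :: ns => lcomp (lf (F n)) (Fam F ns)
  end.

Lemma dom_size s t : dom s t -> (size t <= size s)%N.
Proof.
move=> /domP[s0 [/size_subseq s0s]]; rewrite all2E => /andP[/eqP <- _] //.
Qed.

Lemma Fam_lfam F ns : (forall n, regular (F n)) -> lfam (Fam F ns).
Proof.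
move=> HF; elim: ns => [|n ns IH] /=; last exact: lcomp_lfam (regular_lfam (HF n)) IH.
split=> [s []//|s t [_ Hs] /dom_size st Ht]; split=> //; exact: leq_trans st Hs.
Qed.

Lemma prod_alpha_pos alpha ns : (forall n, ole (BS BZ) (alpha n)) ->
  ole (BS BZ) (prod_alpha alpha ns).
Proof.
move=> Ha; elim: ns => [//|n ns IH] /=.
exact: (@omul_mono (BS BZ) _ (BS BZ) _ IH (Ha n)).
Qed.

Lemma Fam_index F alpha ns s : (forall n, regular (F n)) ->
  (forall n, CB_index (F n) (alpha n)) -> (forall n, ole (BS BZ) (alpha n)) ->
  nder (Fam F ns) (prod_alpha alpha ns) s -> s = [::].
Proof.
move=> HF HI Ha; elim: ns s => [|n ns IH] s /=.
  by case: s => // x s /(_ 0%N)[n [_ [_]]]; rewrite size_rcons.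
move=> /(lcomp_der (regular_lfam (HF n)) (Fam_lfam _ HF) (prod_alpha_pos _ Ha) IH).
move=> [_ [Es [<- _ Hh _]]]; have Hp := (lfam_der (alpha n) (regular_lfam (HF n))).1 _ Hh.
move: Hh => /(CBder_nder _ (HF n) Hp); rewrite (HI n) => E.
case: Es E {Hp} => [//|D Es] /= E.
by have : set0 (head 0%N D) by rewrite -E /setof /= mem_head.
Qed.

(** * Lists of blocks and Schreier families *)

Lemma path_flatten x (Es : seq (seq nat)) : all (fun E => E != [::]) Es ->
  path ltn x (flatten Es) =
  [&& all (sorted ltn) Es, (if Es is E :: _ then (x < head 0%N E)%N else true) &
      sorted (fun E E' => (last 0%N E < head 0%N E')%N) Es].
Proof.
elim: Es x => [//|[//|e E] Es IH] x /= H; rewrite cat_path IH //.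
case: Es {IH} H => [|D Es] H /=; first by rewrite !andbT andbC.
by case: (x < e)%N; rewrite ?andbF //= !andbA.
Qed.

Lemma blocksE Es : blocks Es <->
  all (fun E => E != [::]) Es /\ path ltn 0%N (flatten Es).
Proof.
split.
  move=> [/allP H1 H2].
  have E0 : all (fun E => E != [::]) Es by apply/allP => E /H1 /and3P[].
  split=> //; rewrite path_flatten // H2 andbT; apply/andP; split.
    by apply/allP => E /H1 /and3P[].
  case: Es H1 {H2 E0} => // E Es /(_ E (mem_head _ _)) /and3P[_].
  by case: E => //= e E _ /andP[].
move=> [E0 Hp]; split; last by move: Hp; rewrite path_flatten // => /and3P[].
apply/allP => E EEs; have HpE := path_subseq (flatten_subseq EEs) Hp.
rewrite (path_sorted HpE) (allP E0 _ EEs) /=; apply/allP => i iE.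
move: HpE; rewrite (path_sortedE ltn_trans) => /andP[/allP H _]; exact: H.
Qed.

Lemma setof_inj s t : path ltn 0%N s -> path ltn 0%N t -> setof s = setof t -> s = t.
Proof.
move=> Hs Ht E; apply: (irr_sorted_eq ltn_trans ltnn); rewrite ?(path_sorted Hs) ?(path_sorted Ht) //.
move=> x; apply/idP/idP => Hx; first by change (setof t x); rewrite -E.
by change (setof s x); rewrite E.
Qed.

Lemma lf_compose Mf Nf s : lf (compose Mf Nf) s <-> lcomp (lf Mf) (lf Nf) s.
Proof.
split.
  move=> [Hs [Es [[/blocksE[E0 Hp] EM] [EN E]]]]; split=> //; exists Es.
  rewrite (setof_inj Hs Hp E); split=> //; first by split=> //; apply: path_heads.
  by move=> D DEs; split; [apply: path_subseq (flatten_subseq DEs) Hp|apply: EN].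
move=> [Hs [Es [Ef E0 [Hh EM] EN]]]; split=> //; exists Es; split; last split.
- by split=> //; apply/blocksE; rewrite Ef.
- by move=> D /EN[].
- by rewrite Ef.
Qed.

Lemma lfam_ext H H' : (forall s, H s <-> H' s) -> lfam H' -> lfam H.
Proof.
move=> E [H1 H2]; split=> [s /E /H1 //|s t /E Hs st Ht].
by apply/E; apply: H2 Hs st Ht.
Qed.

Lemma setof1 x : setof [:: x] = [set x].
Proof. by apply/seteqP; split=> y; rewrite /setof /= inE => /eqP. Qed.

Lemma lf_S0 s : lf S0 s <-> path ltn 0%N s /\ (size s <= 1)%N.
Proof.
split=> [[Hs [E|[n [n0 E]]]]|[Hs]].
- by split=> //; rewrite (@setof_inj s [::]) // E; apply/seteqP; split=> x.
- by split=> //; rewrite (@setof_inj s [:: n]) //= ?n0 // setof1.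
- case: s Hs => [|x [|//]] /= Hs _; split=> //; first by left; apply/seteqP; split=> x.
  by right; exists x; rewrite setof1; move: Hs => /andP[].
Qed.

Lemma lf_S1 s : lf S1 s <-> path ltn 0%N s /\ (size s <= head 0%N s)%N.
Proof.
split=> [[Hs [s' [Hs' /allP p' E szs]]]|[Hs szs]].
  split=> //; rewrite (@setof_inj s s') // (path_sortedE ltn_trans) Hs' andbT.
  exact/allP.
split=> //; exists s; split=> //; first exact: path_sorted Hs.
by move: Hs; rewrite (path_sortedE ltn_trans) => /andP[].
Qed.

Lemma S1_lfam : lfam (lf S1).
Proof.
apply: (lfam_ext lf_S1); split=> [s []//|s [//|y t] [Hs szs] st Ht]; split=> //.
apply: leq_trans (dom_size st) _; apply: leq_trans szs _.
exact: dom_head (path_sorted Hs) st.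
Qed.

Lemma lf_schreier_BL f s :
  lf (schreier (BL f)) s <-> exists k, lf (schreier (f k)) s /\ path ltn k s.
Proof.
split=> [[Hs [k [Hk sk]]]|[k [[Hs Hk] sk]]].
  exists k; split=> //; rewrite (path_sortedE ltn_trans) (path_sorted Hs) andbT.
  by apply/allP => x xs; apply: sk.
split=> //; exists k; split=> // i si.
by move: sk; rewrite (path_sortedE ltn_trans) => /andP[/allP + _]; apply.
Qed.

Lemma path_dom x s t : path ltn x s -> dom s t -> path ltn 0%N t -> path ltn x t.
Proof.
case: t => [//|y t] Hs st /= /andP[_ ->]; rewrite andbT.
have := dom_head (path_sorted Hs) st; apply: leq_trans.
by case: s Hs st => [//|z s] /= /andP[].
Qed.

Lemma schreier_lfam t : lfam (lf (schreier t)).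
Proof.
elim: t => [|b IH|f IH].
- apply: (lfam_ext lf_S0); split=> [s []//|s t [_ Hs] /dom_size st Ht].
  by split=> //; apply: leq_trans st Hs.
- by apply: (lfam_ext (lf_compose S1 (schreier b))); apply: lcomp_lfam S1_lfam IH.
- apply: (lfam_ext (lf_schreier_BL f)); split=> [s [k [[]]] //|s t [k [Hk sk]] st Ht].
  by exists k; split; [apply: (IH k).2 st Ht|apply: path_dom sk st Ht].
Qed.

(** A member starting at [x] has at most [x] points, and each derivation takes one of the free
    places. *)
Lemma S1_index s : nder (lf S1) oomega s -> s = [::].
Proof.
case: s => [//|x s] H; exfalso.
have Hn n s' : nder (lf S1) (ofin n) (x :: s') -> (size (x :: s') + n <= x)%N.
  elim: n s' => [|n IH] s'; first by move=> /lf_S1 [_]; rewrite addn0.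
  by move=> /(_ 0%N)[m [_ /IH]]; rewrite /= size_rcons; lia.
by have := Hn x.+1 s (H x.+1); rewrite /=; lia.
Qed.

(** At a limit, a member with first point [x] lies in one of the finitely many [schreier (f k)] with
    [k < x], to which [nder_bigcup] applies. *)
Lemma schreier_index t s : nder (lf (schreier t)) (wexp t) s -> s = [::].
Proof.
elim: t s => [|b IH|f IH] s.
- move=> /(_ 0%N)[n [_ /lf_S0[_]]]; by rewrite size_rcons; case: s.
- move=> Hs; have {}Hs : nder (lcomp (lf S1) (lf (schreier b))) (wexp (BS b)) s.
    by apply: der_sub Hs => s'; move/lf_compose.
  have [_ [Es [<- E0 /S1_index Hh _]]] := lcomp_der S1_lfam (schreier_lfam b) (wexp_pos b) IH Hs.
  by case: Es Hh {E0}.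
- case: s => [//|x s] Hs; exfalso.
  have : nder (fun c => exists2 k, k \in iota 0 x & lf (schreier (f k)) c)
      (wexp (BL f)) ((x :: s) ++ [::]).
    apply: (@der_shift _ _ (lf (schreier (BL f))) _ (x :: s)); last by rewrite cats0.
    move=> c /lf_schreier_BL[k [Hk]] /= /andP[kx _]; exists k => //.
    by rewrite mem_iota.
  rewrite cats0 => /nder_bigcup[k _|k _ Hk]; first exact: schreier_lfam.
  by have := IH k _ (Hk k).
Qed.

(** * Averages with small mass on small families *)

Definition sfam (P : seq nat -> Prop) :=
  (forall s, P s -> sorted ltn s) /\ (forall s t, P s -> subseq t s -> P t).

Lemma lfam_sfam H : lfam H -> sfam H.
Proof.
move=> [H1 H2]; split=> [s /H1 /path_sorted //|s t Hs ts].
by apply: H2 Hs (dom_subseq ts) (path_subseq ts (H1 _ Hs)).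
Qed.

Lemma sfam_der P b : sfam P -> sfam (nder P b).
Proof.
move=> HP; elim: b => [//|b [IH1 IH2]|f IH]; split => /=.
- move=> s /(_ 0%N)[n [_ /IH1]]; apply: (subseq_sorted ltn_trans).
  exact: subseq_rcons.
- move=> s t Hs ts N; have [n [Nn Hn]] := Hs N; exists n; split=> //.
  by apply: IH2 Hn _; rewrite -!cats1; apply: cat_subseq.
- by move=> s /(_ 0%N) /(IH 0%N).1.
- by move=> s t Hs ts n; apply: (IH n).2 (Hs n) ts.
Qed.

Lemma sfam_mono P a b s : sfam P -> ole a b -> nder P b s -> nder P a s.
Proof.
by move=> [_ HP]; apply: der_mono => s' x /HP; apply; apply: subseq_rcons.
Qed.

Lemma nat_common (I : eqType) (l : seq I) (A : I -> nat -> Prop) :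
  (forall x a b, x \in l -> (a <= b)%N -> A x a -> A x b) ->
  (forall x, x \in l -> exists n, A x n) -> exists n, forall x, x \in l -> A x n.
Proof.
elim: l => [|x l IH] up H; first by exists 0%N.
have xl y : y \in l -> y \in x :: l by rewrite inE => ->; rewrite orbT.
have [n Hn] : exists n, forall x, x \in l -> A x n.
  by apply: IH => [y a b /xl|y /xl]; [apply: up|apply: H].
have [m Hm] := H x (mem_head _ _).
exists (maxn n m) => y; rewrite inE => /orP[/eqP ->|yl].
- by apply: up Hm; rewrite ?mem_head // leq_maxr.
- by apply: up (Hn _ yl); [apply: xl|rewrite leq_maxl].
Qed.

Lemma sorted_filter_split N (C : seq nat) : sorted ltn C ->
  [seq x <- C | (x <= N)%N] ++ [seq x <- C | (N < x)%N] = C.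
Proof.
elim: C => [//|x C IH] HC /=; have HC' := path_sorted HC.
case: leqP => xN /=; first by rewrite IH.
have -> : [seq x <- C | (x <= N)%N] = [::].
  apply/eqP; rewrite -(negbK (_ == _)) -has_filter; apply/hasPn => y yC.
  move: HC; rewrite /= (path_sortedE ltn_trans) => /andP[/allP /(_ y yC) xy _].
  by rewrite -ltnNge; apply: ltn_trans xN xy.
have -> // : [seq x <- C | (N < x)%N] = C.
apply/all_filterP/allP => y yC.
move: HC; rewrite /= (path_sortedE ltn_trans) => /andP[/allP /(_ y yC) xy _].
exact: ltn_trans xN xy.
Qed.

Section Averaging.
Variables (R : realType) (T : Type) (ab : nat -> T -> bool) (pt : T -> nat).
Hypothesis ab_pt : forall N x, ab N x -> (N < pt x)%N.
Hypothesis ab_le : forall M N x, (M <= N)%N -> ab N x -> ab M x.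

Fixpoint chain (N : nat) (r : seq T) : bool :=
  if r is x :: r' then ab N x && chain (pt x) r' else true.

Definition chain_end N (r : seq T) := last N (map pt r).

Lemma chain_cat N r1 r2 : chain N (r1 ++ r2) = chain N r1 && chain (chain_end N r1) r2.
Proof. by elim: r1 N => [//|x r IH] N /=; rewrite IH andbA. Qed.

Lemma chain_path N r : chain N r -> path ltn N (map pt r).
Proof. by elim: r N => [//|x r IH] N /= /andP[/ab_pt -> /IH ->]. Qed.

Definition mass (run : seq (R * T)) (C : seq nat) : R :=
  \sum_(e <- run | pt e.2 \in C) e.1.

(** Repeated averages for games: if [H] has rank [wexp rho] at [s0] and finitely many hereditary
    families lack this rank, some probability measure on one run inside [H] is nearly invisible to
    them. Moves carry a point [pt x] because later they are whole blocks, tested at their ends. *)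
Definition average_stmt (rho : bord) := forall (I : eqType) (l : seq I)
  (P : I -> seq nat -> Prop) H s0 N (delta : R), 0 < delta ->
  (forall x, x \in l -> sfam (P x)) ->
  (forall x, x \in l -> ~ nder (P x) (wexp rho) [::]) ->
  der ab H (wexp rho) s0 ->
  exists run : seq (R * T), [/\ H (s0 ++ map snd run), chain N (map snd run),
    all (fun e => 0 <= e.1) run, \sum_(e <- run) e.1 = 1 &
    forall x, x \in l -> forall C, P x C -> mass run C <= delta].

Lemma mass_le_total (run : seq (R * T)) C : all (fun e => 0 <= e.1) run ->
  mass run C <= \sum_(e <- run) e.1.
Proof.
rewrite /mass; elim: run => [|e run IH] /=; first by rewrite !big_nil.
move=> /andP[e0 /IH H]; rewrite !big_cons; case: ifP => _; first by rewrite lerD2l.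
by apply: le_trans H _; rewrite lerDr.
Qed.

(* [t] bounds the number of blocks on which a member [B' ++ C] of [P x] can have
   mass more than [delta]: each such block lowers the multiple of [wexp rho]
   below which the initial part of the member has its rank. *)
Lemma average_iter rho (I : eqType) (l : seq I) (P : I -> seq nat -> Prop) k
    (delta : R) : average_stmt rho -> 0 < delta ->
  (forall x, x \in l -> sfam (P x)) ->
  forall K H s0 N, der ab H (omul (wexp rho) (ofin K)) s0 ->
  exists run : seq (R * T), [/\ H (s0 ++ map snd run), chain N (map snd run),
    all (fun e => 0 <= e.1) run, \sum_(e <- run) e.1 = K%:R &
    forall x, x \in l -> forall t, (t <= k)%N -> forall B',
      all (fun i => (i <= N)%N) B' ->
      ~ nder (P x) (omul (wexp rho) (ofin t)) B' ->
      forall C, P x (B' ++ C) -> mass run C <= t%:R + K%:R * delta].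
Proof.
move=> avg d0 HP; elim=> [|K IH] H s0 N Hs.
  exists [::]; split=> //=; rewrite ?cats0 ?big_nil // => x _ t _ B' _ _ C _.
  by rewrite /mass big_nil mul0r addr0.
pose w := wexp rho.
(* The part of a member up to [N] is a subset of an interval, so [L] is finite. For [j] in [L] this
   part has rank below [t.+1] copies of [w]; hence the continuations that keep [t] copies form a
   family without rank [w], and [avg] applies to it. *)
pose Q (j : I * (nat * seq nat)) C := nder (P j.1) (omul w (ofin j.2.1)) (j.2.2 ++ C).
pose subs := [seq mask (val m) (iota 0 N.+1) | m : N.+1.-tuple bool].
pose L := [seq j <- [seq (x, p) | x <- l, p <- [seq (t, B) | t <- iota 0 k, B <- subs]] |
            `[< ~ nder (P j.1) (omul w (ofin j.2.1.+1)) j.2.2 >]].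
have HL j : j \in L -> j.1 \in l /\ ~ nder (P j.1) (omul w (ofin j.2.1.+1)) j.2.2.
  rewrite mem_filter => /andP[/asboolP Hj /allpairsP[[x p] /= [xl _ E]]].
  by split=> //; rewrite E.
have HQ j : j \in L -> sfam (Q j).
  move=> /HL[jl _]; have [D1 D2] := sfam_der (omul w (ofin j.2.1)) (HP _ jl).
  split=> [c /D1|c c' /D2 Hc c'c]; first exact: (subseq_sorted ltn_trans (suffix_subseq _ _)).
  by apply: Hc; apply: cat_subseq.
have HQ' j : j \in L -> ~ nder (Q j) w [::].
  move=> /HL[jl]; apply: contra_not => Hj; apply/(der_oadd _ _ (omul w (ofin j.2.1)) w).
  rewrite -(cats0 j.2.2).
  exact: (@der_shift _ _ (Q j) _ [::] j.2.2 w [::] _ Hj).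
have [run1 [H1 ch1 pos1 sum1 mass1]] :=
  avg _ L Q (der ab H (omul w (ofin K))) s0 N delta d0 HQ HQ'
    ((der_oadd _ _ _ _ _).1 Hs).
pose N1 := chain_end N (map snd run1).
have [run2 [H2 ch2 pos2 sum2 mass2]] := IH H _ N1 H1.
have run1N e : e \in [seq pt e.2 | e <- run1] -> (e <= N1)%N.
  move=> He; apply: path_le_last (chain_path ch1) _.
  by rewrite inE -map_comp He orbT.
have NN1 : (N <= N1)%N by apply: path_le_last (chain_path ch1) (mem_head _ _).
have run2N e : e \in [seq pt e.2 | e <- run2] -> (N1 < e)%N.
  move=> He; have := chain_path ch2; rewrite (path_sortedE ltn_trans) => /andP[/allP + _].
  by apply; rewrite -map_comp.
exists (run1 ++ run2); split.
- by rewrite map_cat catA.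
- by rewrite map_cat chain_cat ch1.
- by rewrite all_cat pos1.
- by rewrite big_cat /= sum1 sum2 -natr1 addrC.
move=> x xl t tk B' B'N Ht C HC.
have [HPs HPsub] := HP x xl.
have sB' : sorted ltn (B' ++ C) by apply: HPs HC.
have sC : sorted ltn C := subseq_sorted ltn_trans (suffix_subseq _ _) sB'.
case: t tk Ht => [|t] tk Ht.
  by case: Ht; apply: HPsub HC _; apply: prefix_subseq.
pose C1 := [seq y <- C | (y <= N1)%N]; pose C2 := [seq y <- C | (N1 < y)%N].
have CE : C1 ++ C2 = C by apply: sorted_filter_split.
have mem_le (r : seq (R * T)) (A B : seq nat) :
    (forall p, p \in [seq pt e.2 | e <- r] -> (p \in A) = (p \in B)) -> mass r A = mass r B.
  rewrite /mass; elim: r => [|e r IHr] HAB; first by rewrite !big_nil.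
  rewrite !big_cons HAB ?mem_head // IHr // => p pr.
  by apply: HAB; rewrite inE pr orbT.
have mE : mass (run1 ++ run2) C = mass run1 C1 + mass run2 C2.
  rewrite {1}/mass big_cat /= -!/(mass _ _); congr (_ + _); apply: mem_le => p Hp.
    by rewrite mem_filter run1N.
  by rewrite mem_filter run2N.
have B1N : all (fun i => (i <= N1)%N) (B' ++ C1).
  rewrite all_cat; apply/andP; split; last exact: filter_all.
  by apply/allP => i /(allP B'N) iN; apply: leq_trans NN1.
have HC' : P x ((B' ++ C1) ++ C2) by rewrite -catA CE.
have down a : ~ nder (P x) a B' -> ~ nder (P x) a (B' ++ C1).
  apply: contra_not => Hd; apply: (sfam_der a (HP x xl)).2 Hd _.
  exact: prefix_subseq.
(* Either [t] copies of [w] survive and the first block has mass at most [delta], or they do not and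
   its full mass is paid for by lowering [t.+1] to [t]. *)
have [HQC|HQC] := pselect (nder (P x) (omul w (ofin t)) (B' ++ C1)).
- have jL : (x, (t, B')) \in L.
    rewrite mem_filter; apply/andP; split; first exact/asboolP.
    apply/allpairsP; exists (x, (t, B')); split=> //=.
    apply/allpairsP; exists (t, B'); split=> //=; first by rewrite mem_iota.
    have B'sub : subseq B' (iota 0 N.+1).
      apply: subset_subseq => [||i /(allP B'N)]; last by rewrite mem_iota.
        exact: (subseq_sorted ltn_trans (prefix_subseq _ _) sB').
      exact: iota_ltn_sorted.
    move: B'sub => /subseqP[mm szm E]; rewrite size_iota in szm.
    have szm' : size mm == N.+1 by apply/eqP.
    by apply/mapP; exists (Tuple szm'); rewrite ?mem_enum.
  have m1 := mass1 _ jL C1 HQC.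
  have m2 := mass2 x xl t.+1 tk (B' ++ C1) B1N (down _ Ht) C2 HC'.
  rewrite mE; apply: le_trans (lerD m1 m2) _.
  rewrite -[K.+1%:R]natr1 mulrDl mul1r; lra.
- have m1 := mass_le_total C1 pos1; rewrite sum1 in m1.
  have m2 := mass2 x xl t (ltnW tk) (B' ++ C1) B1N HQC C2 HC'.
  rewrite mE; apply: le_trans (lerD m1 m2) _.
  rewrite -[K.+1%:R]natr1 -[t.+1%:R]natr1 mulrDl mul1r; lra.
Qed.

Lemma average rho : average_stmt rho.
Proof.
elim: rho => [|rho IH|f IH] I l P H s0 N delta d0 HP Hw Hs.
(* Lacking rank 1 means that the singletons in the families are bounded; one move beyond them
   receives all the mass. *)
- have [k Hk] : exists k, forall x, x \in l -> forall n, (k < n)%N -> ~ P x [:: n].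
    apply: (@nat_common _ l (fun x k => forall n, (k < n)%N -> ~ P x [:: n])) => [x a b _ ab1 Ha n bn|x xl].
      by apply: Ha; apply: leq_ltn_trans bn.
    apply: contrapT => /forallNP Hk; apply: (Hw x xl) => k; have := Hk k.
    by move=> /existsNP[n /not_implyP[kn /contrapT Hn]]; exists n.
  have [x [Nx Hx]] := Hs (maxn N k).
  exists [:: (1, x)]; split=> /=; rewrite ?cats1 ?big_seq1 ?ler01 ?andbT //.
    by apply: ab_le Nx; rewrite leq_maxl.
  move=> y yl C HC; rewrite /mass big_cons big_nil; case: ifP => [xC|_]; last exact: ltW.
  have := Hk y yl (pt x); have := ab_pt Nx; rewrite gtn_max => /andP[_ ->] /(_ isT) [].
  by apply: (HP y yl).2 HC _; rewrite sub1seq.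
- have [k Hk] : exists k, forall x, x \in l -> ~ nder (P x) (omul (wexp rho) (ofin k)) [::].
    apply: (@BL_common _ l (fun x b => ~ nder (P x) b [::]) (fun n => omul (wexp rho) (ofin n)))
       => [x a b xl ab1|x xl].
      by apply: contra_not; apply: sfam_mono ab1; apply: HP.
    by have /existsNP := Hw x xl.
  have d2 : 0 < delta / 2 by rewrite divr_gt0.
  (* With [K] blocks of accuracy [delta / 2] the exceptional mass [k] is at most [K * delta / 2], so
     division by [K] leaves at most [delta]. *)
  pose K := (Num.truncn (2 * k%:R / delta)).+1.
  have HK : 2 * k%:R / delta <= K%:R by apply/ltW/truncnS_gt.
  have K0 : 0 < K%:R :> R by rewrite ltr0n.
  have [run [H1 ch pos sm ms]] := @average_iter rho I l P k (delta / 2) IH d2 HP K H s0 N (Hs K).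
  exists [seq (e.1 / K%:R, e.2) | e <- run]; split.
  + by rewrite -map_comp.
  + by rewrite -map_comp.
  + rewrite all_map; apply: sub_all pos => e /= e0; exact: divr_ge0.
  + by rewrite big_map /= -mulr_suml sm divff // gt_eqF.
  + move=> x xl C HC; rewrite /mass big_map /= -mulr_suml ler_pdivrMr //.
    apply: le_trans (ms x xl k (leqnn k) [::] isT (Hk x xl) C HC) _.
    rewrite ler_pdivrMr // in HK; lra.
- have [n Hn] : exists n, forall x, x \in l -> ~ nder (P x) (wexp (f n)) [::].
    apply: (@BL_common _ l (fun x b => ~ nder (P x) b [::]) (fun n => wexp (f n)))
       => [x a b xl ab1|x xl].
      by apply: contra_not; apply: sfam_mono ab1; apply: HP.
    by have /existsNP := Hw x xl.
  exact: (IH n _ l P H s0 N delta d0 HP Hn (Hs n)).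
Qed.
End Averaging.

(** * Ruler vectors *)

(** [((p, q), w)] is a mass [w] at the point [p], belonging to level [q]. *)
Definition elt (R : realType) := ((nat * nat) * R)%type.

Definition meas (R : realType) (z : seq (elt R)) (a : pred (nat * nat)) : R :=
  \sum_(e <- z | a e.1) e.2.

Definition scale (R : realType) (c : R) (z : seq (elt R)) : seq (elt R) :=
  [seq (e.1, c * e.2) | e <- z].

Section Meas.
Variable R : realType.
Implicit Types (z : seq (elt R)) (a b : pred (nat * nat)).

Lemma meas_cat z1 z2 a : meas (z1 ++ z2) a = meas z1 a + meas z2 a.
Proof. by rewrite /meas big_cat. Qed.

Lemma meas_cons e z a : meas (e :: z) a = (if a e.1 then e.2 else 0) + meas z a.
Proof. by rewrite /meas big_cons; case: ifP; rewrite ?add0r. Qed.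

Lemma meas_nil a : meas [::] a = 0 :> R. Proof. exact: big_nil. Qed.

Lemma meas_rcons e z a : meas (rcons z e) a = meas z a + (if a e.1 then e.2 else 0).
Proof. by rewrite -cats1 meas_cat meas_cons meas_nil addr0. Qed.

Lemma meas_scale c z a : meas (scale c z) a = c * meas z a.
Proof. by rewrite /meas big_map /= mulr_sumr. Qed.

Lemma meas_flatten (I : Type) (s : seq I) (f : I -> seq (elt R)) a :
  meas (flatten [seq f i | i <- s]) a = \sum_(i <- s) meas (f i) a.
Proof.
elim: s => [|i s IH] /=; first by rewrite meas_nil big_nil.
by rewrite meas_cat big_cons IH.
Qed.

Lemma meas_ge0 z a : all (fun e => 0 <= e.2) z -> 0 <= meas z a.
Proof.
move=> /allP H; rewrite /meas big_seq_cond; apply: sumr_ge0 => e /andP[ez _]; exact: H.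
Qed.

Lemma meas_le z a b : all (fun e => 0 <= e.2) z ->
  (forall e, e \in z -> a e.1 -> b e.1) -> meas z a <= meas z b.
Proof.
elim: z => [|e z IH]; first by rewrite !meas_nil.
move=> /= /andP[e0 z0] H; rewrite !meas_cons lerD ?IH //.
  by case: ifP => [/H ->|]; rewrite ?mem_head //; case: ifP.
by move=> e' e'z; apply: H; rewrite inE e'z orbT.
Qed.

Lemma meas_eq z a b :
  (forall e, e \in z -> a e.1 = b e.1) -> meas z a = meas z b.
Proof.
move=> H; rewrite /meas big_seq_cond [RHS]big_seq_cond; apply: eq_bigl => e.
by case ez: (e \in z) => //=; rewrite H.
Qed.

Lemma meas0 z a : (forall e, e \in z -> ~~ a e.1) -> meas z a = 0.
Proof.
by move=> H; rewrite /meas big_seq_cond big1 // => e /andP[/H/negP].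
Qed.

End Meas.

Definition points (R : realType) (z : seq (elt R)) : seq nat := [seq e.1.1 | e <- z].
Definition level_points (R : realType) (q : nat) (z : seq (elt R)) : seq nat :=
  [seq e.1.1 | e <- z & e.1.2 == q].

Definition before (R : realType) q (z : seq (elt R)) t :=
  meas z [pred x | (x.2 == q) && (x.1 < t)%N].
(** The default [0] means that in [ruler] the finest level may not be ahead once the last level-[q]
    point is passed. *)
Definition next_weight (R : realType) q (z : seq (elt R)) t : R :=
  head 0 [seq e.2 | e <- z & (e.1.2 == q) && (t <= e.1.1)%N].
Definition level_mass (R : realType) q (z : seq (elt R)) :=
  meas z [pred x | x.2 == q].

(* Level [i] is the finest one: it fills with mass [w] the gap in front of a
   point of weight [w] of any coarser level [q]. *)
Definition ruler (R : realType) q i (z : seq (elt R)) := forall t,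
  before q z t <= before i z t <= before q z t + next_weight q z t.

Section Ruler.
Variable R : realType.
Implicit Types z : seq (elt R).

Lemma next_weight_ge0 q z t : all (fun e => 0 <= e.2) z -> 0 <= next_weight q z t.
Proof.
move=> /allP H; rewrite /next_weight; case E: [seq e.2 | e <- _ & _] => [//|x s] /=.
have : x \in [seq e.2 | e <- z & (e.1.2 == q) && (t <= e.1.1)%N] by rewrite E mem_head.
by move=> /mapP[e]; rewrite mem_filter => /andP[_ /H e0 ->].
Qed.

Lemma before_all q z t : (forall e, e \in z -> (e.1.1 < t)%N) ->
  before q z t = level_mass q z.
Proof. by move=> H; apply: meas_eq => e /H /= ->; rewrite andbT. Qed.

Lemma before_none q z t : (forall e, e \in z -> (t <= e.1.1)%N) -> before q z t = 0.
Proof. by move=> H; apply: meas0 => e /H /=; rewrite leqNgt => /negPf ->; rewrite andbF. Qed.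

Lemma before_le_mass q z t : all (fun e => 0 <= e.2) z -> before q z t <= level_mass q z.
Proof. by move=> z0; apply: meas_le => // e _ /andP[]. Qed.

(** Equal masses in [z1] bring the two cumulative sums together at the junction, so no discrepancy
    is carried into [z2]. *)
Lemma ruler_cat q i z1 z2 : all (fun e => 0 <= e.2) z1 -> all (fun e => 0 <= e.2) z2 ->
  sorted ltn (points (z1 ++ z2)) -> level_mass q z1 = level_mass i z1 ->
  ruler q i z1 -> ruler q i z2 -> ruler q i (z1 ++ z2).
Proof.
move=> z10 z20 srt bal r1 r2 t; rewrite /before !meas_cat -!/(before _ _ _).
have lt12 e1 e2 : e1 \in z1 -> e2 \in z2 -> (e1.1.1 < e2.1.1)%N.
  move: srt; rewrite /points map_cat (sorted_pairwise ltn_trans) pairwise_cat.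
  move=> /andP[/allrelP H _] h1 h2; apply: H; exact: map_f.
have [/allP H1|] := boolP (all (fun e => e.1.1 < t)%N z1).
  rewrite !(@before_all _ z1) // bal -addrA !lerD2l.
  have -> : next_weight q (z1 ++ z2) t = next_weight q z2 t; last exact: r2.
  rewrite /next_weight filter_cat map_cat.
  have -> // : [seq e <- z1 | (e.1.2 == q) && (t <= e.1.1)%N] = [::].
  apply/eqP; rewrite -(negbK (_ == _)) -has_filter; apply/hasPn => e /H1 et.
  by rewrite negb_and -ltnNge et orbT.
move=> /allPn[e0 e0z1 He0].
have t2 e : e \in z2 -> (t <= e.1.1)%N.
  by move=> ez; apply: ltnW; apply: leq_ltn_trans (lt12 _ _ e0z1 ez); rewrite leqNgt.
rewrite !(@before_none _ z2) // !addr0; have /andP[-> /= r1t] := r1 t.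
have [Hh|Hh] := boolP (has (fun e => (e.1.2 == q) && (t <= e.1.1)%N) z1).
  apply: le_trans r1t _; rewrite lerD2l /next_weight filter_cat map_cat.
  rewrite has_filter in Hh.
  by case: [seq e <- z1 | _] Hh.
(* Level [q] of [z1] is complete before [t], so balance bounds level [i] there. *)
have -> : before q z1 t = level_mass q z1.
  apply: meas_eq => e ez1 /=; case: eqP => //= eq.
  by move/hasPn: Hh => /(_ e ez1); rewrite eq eqxx /= -ltnNge => ->.
rewrite bal; apply: le_trans (before_le_mass i t z10) _.
by rewrite lerDl next_weight_ge0 // all_cat z10.
Qed.

Lemma before_scale c q z t : before q (scale c z) t = c * before q z t.
Proof. exact: meas_scale. Qed.

Lemma ruler_scale c q i z : 0 <= c -> ruler q i z -> ruler q i (scale c z).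
Proof.
move=> c0 r t; rewrite !before_scale.
have -> : next_weight q (scale c z) t = c * next_weight q z t.
  rewrite /next_weight /scale filter_map -map_comp.
  by case: [seq x <- z | _] => //=; rewrite mulr0.
by rewrite -mulrDr !ler_wpM2l //; have /andP[] := r t.
Qed.

Lemma ruler_nil q i : ruler q i ([::] : seq (elt R)).
Proof. by move=> t; rewrite /before !meas_nil /next_weight /= addr0 lexx. Qed.

Lemma scale_ge0 c z : 0 <= c -> all (fun e => 0 <= e.2) z ->
  all (fun e => 0 <= e.2) (scale c z).
Proof.
by move=> c0 z0; rewrite all_map; apply: sub_all z0 => e /= e0; apply: mulr_ge0.
Qed.

Lemma points_scale c z : points (scale c z) = points z.
Proof. by rewrite /points -map_comp. Qed.

Lemma level_points_scale c q z : level_points q (scale c z) = level_points q z.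
Proof. by rewrite /level_points filter_map -map_comp. Qed.

Lemma points_cat z1 z2 : points (z1 ++ z2) = points z1 ++ points z2.
Proof. exact: map_cat. Qed.

Lemma level_points_cat q z1 z2 :
  level_points q (z1 ++ z2) = level_points q z1 ++ level_points q z2.
Proof. by rewrite /level_points filter_cat map_cat. Qed.

Lemma level_points_rcons q z e : level_points q (rcons z e) =
  if e.1.2 == q then rcons (level_points q z) e.1.1 else level_points q z.
Proof. by rewrite /level_points filter_rcons; case: ifP; rewrite ?map_rcons. Qed.

End Ruler.

(** An object from level [k] is played with rank [wexp (rho k)] in rounds that each contain an
    object from level [k.+1]; ordinal multiplication writes the size of a round on the left, so
    inner exponents come first. *)
Fixpoint mix_exp (rho : nat -> bord) (ks : seq nat) : bord :=
  if ks is k :: ks' then oadd (mix_exp rho ks') (rho k) else BZ.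

(* The cost [wexp (cost rho k q)] at level [q] of an object with levels from [k]. *)
Definition cost rho k q := mix_exp rho (iota k (q.+1 - k)).

Lemma cost_step rho k q : (k <= q)%N -> cost rho k q = oadd (cost rho k.+1 q) (rho k).
Proof. by move=> kq; rewrite /cost subSS subSn. Qed.

Lemma cost_out rho k q : (q < k)%N -> cost rho k q = BZ.
Proof. by move=> qk; rewrite /cost (eqP (_ : q.+1 - k == 0)%N) // subn_eq0. Qed.

(** * Assembling the levels of one vector *)

Section Objects.
Variables (R : realType) (M : nat -> Prop) (Fm : nat -> seq nat -> Prop)
  (rho : nat -> bord) (J : eqType) (BL : nat -> seq J) (Pf : J -> seq nat -> Prop)
  (delta : nat -> R) (i : nat).
Hypothesis M_inf : forall N, exists n, (N < n)%N /\ M n.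
Hypothesis Fm_lfam : forall q, lfam (Fm q).
Hypothesis Pf_sfam : forall j, sfam (Pf j).
Hypothesis Pf_poor : forall q j, j \in BL q -> ~ nder (Pf j) (wexp (rho q)) [::].
Hypothesis delta_gt0 : forall q, 0 < delta q.

(** A ruler vector restricted to the levels from [k] on, before division by the weights [theta].
    [BL q] indexes the families to which level [q] must be nearly invisible. *)
Definition object k (z : seq (elt R)) :=
  [/\ sorted ltn (points z),
      forall e, e \in z -> [/\ M e.1.1, (k <= e.1.2 <= i)%N & 0 <= e.2],
      forall q, (k <= q <= i)%N -> level_mass q z = 1,
      forall q, (k <= q <= i)%N -> forall j, j \in BL q -> forall B, Pf j B ->
        meas z [pred x | (x.2 == q) && (x.1 \in B)] <= delta q &
      forall q, (k <= q <= i)%N -> ruler q i z].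

(** [LS q] will list the sets of earlier indices that the new vector may extend to a Schreier set,
    [U q s] the union of their level-[q] supports, and [r q s] the rank to be saved for later
    vectors. *)
Variables (LS : nat -> seq J) (U : nat -> J -> seq nat) (r : nat -> J -> bord).

(* [reserve b p]: after appending [p], the rank still available at level [q] in
   each of the sets [U q s] is [b q] above [r q s]. *)
Definition reserve (b : nat -> bord) (p : seq (elt R)) := forall q, (q <= i)%N ->
  forall s, s \in LS q -> nder (Fm q) (oadd (r q s) (b q)) (U q s ++ level_points q p).

Lemma reserve_ext b b' p : (forall q, (q <= i)%N -> b q = b' q) ->
  reserve b p -> reserve b' p.
Proof. by move=> E H q qi s sL; rewrite -E //; apply: H. Qed.

Definition bset (b : nat -> bord) k b0 q := if q == k then b0 else b q.

(** A point far enough out suits all sets of the finite list [LS k] at once, by [nder_ev]; it costs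
    one unit at level [k] and nothing elsewhere. *)
Lemma reserve_point b k b0 p : (k <= i)%N -> b k = BS b0 -> reserve b p ->
  exists N, forall n, (N < n)%N -> reserve (bset b k b0) (rcons p ((n, k), 1)).
Proof.
move=> ki bk Hb.
have [N HN] : exists N, forall s, s \in LS k -> forall n, (N < n)%N ->
    nder (Fm k) (oadd (r k s) b0) (rcons (U k s ++ level_points k p) n).
  apply: (@nat_common _ (LS k) (fun s N => forall n, (N < n)%N ->
    nder (Fm k) (oadd (r k s) b0) (rcons (U k s ++ level_points k p) n))).
    by move=> s a c _ ac Ha n cn; apply: Ha; apply: leq_ltn_trans ac cn.
  by move=> s sL; have := Hb k ki s sL; rewrite bk => /(nder_ev (Fm_lfam k)).
exists N => n Nn q qi s sL; rewrite /bset level_points_rcons /= eq_sym.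
by case: eqP => [kq|_]; [subst q; rewrite -rcons_cat; apply: HN|apply: Hb].
Qed.

(** The mark of weight 1 comes after an object of mass 1 at every finer level: the filled gap of the
    ruler. *)
Definition block k (x : seq (elt R)) := exists z n,
  [/\ x = rcons z ((n, k), 1), object k.+1 z & M n].

Definition beyond N (x : seq (elt R)) := (x != [::]) && path ltn N (points x).

(** The rank needed for [c] more blocks with [b q] left over. At [q = k] the cost per block is
    [wexp BZ], a single point. *)
Definition budget (b : nat -> bord) k c q :=
  if (q < k)%N then b q else oadd (b q) (omul (wexp (cost rho k.+1 q)) c).

Definition full_budget (b : nat -> bord) k q :=
  if (q < k)%N then b q else oadd (b q) (wexp (cost rho k q)).

Definition object_ex k := forall b p N, reserve (full_budget b k) p ->
  exists z, [/\ object k z, path ltn N (points z) & reserve b (p ++ z)].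

(** Turns available rank into moves, so that averaging can be applied to blocks instead of
    points. *)
Lemma block_game k b c p s : (k <= i)%N -> object_ex k.+1 ->
  reserve (budget b k c) (p ++ flatten s) -> (forall x, x \in s -> block k x) ->
  der beyond (fun s => reserve b (p ++ flatten s) /\ forall x, x \in s -> block k x) c s.
Proof.
move=> ki Hk; elim: c s => [|c IH|f IH] s Hs HB.
- split=> //; apply: reserve_ext Hs => q _; rewrite /budget; by case: ifP.
- move=> N.
  (* What an object from level [k.+1] leaves of the budget: at level [k] one unit is held back for
     the closing point. *)
  pose b' q := if (q < k)%N then b q else
    if q == k then oadd (b q) (BS (omul (wexp BZ) c))
    else oadd (b q) (omul (wexp (cost rho k.+1 q)) c).
  have Hb' : reserve (full_budget b' k.+1) (p ++ flatten s).
    apply: reserve_ext Hs => q _; rewrite /budget /full_budget /b' ltnS.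
    by case: ltngtP => [||->] //=; [rewrite oaddA|rewrite cost_out].
  have [z [Hz Nz Rz]] := Hk b' (p ++ flatten s) N Hb'.
  have [N0 HN0] : exists N0, forall n, (N0 < n)%N ->
      reserve (bset b' k (oadd (b k) (omul (wexp BZ) c))) (rcons ((p ++ flatten s) ++ z) ((n, k), 1)).
    by apply: reserve_point => //; rewrite /b' ltnn eqxx.
  have [n [Nn Mn]] := M_inf (maxn N0 (last N (points z))).
  move: Nn; rewrite gtn_max => /andP[N0n zn].
  exists (rcons z ((n, k), 1)); split.
    rewrite /beyond -size_eq0 size_rcons /= /points map_rcons rcons_path.
    by rewrite -/(points z) Nz.
  apply: IH.
    rewrite flatten_rcons catA -rcons_cat; apply: reserve_ext (HN0 n N0n) => q _.
    rewrite /bset /budget /b'; case: eqP => [->|/eqP qk]; first by rewrite ltnn cost_out.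
    by case: ifP.
  move=> x; rewrite mem_rcons inE => /orP[/eqP ->|/HB //].
  by exists z, n.
- move=> n; apply: IH => // q qi s' s'L; have := Hs q qi s' s'L.
  by rewrite /budget; case: ifP => // _; apply.
Qed.

Definition block_end (x : seq (elt R)) := last 0%N (points x).

Lemma beyond_end N x : beyond N x -> (N < block_end x)%N.
Proof.
rewrite /beyond /block_end; case: x => [//|e x] /= /andP[Ne Hp].
by apply: leq_trans Ne _; apply: path_le_last Hp (mem_head _ _).
Qed.

Lemma beyond_le N N' x : (N <= N')%N -> beyond N' x -> beyond N x.
Proof.
rewrite /beyond; case: x => [//|e x] /= NN' /andP[Ne ->]; rewrite andbT.
exact: leq_ltn_trans NN' Ne.
Qed.

Lemma chain_points N s : chain beyond block_end N s -> path ltn N (points (flatten s)).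
Proof.
elim: s N => [//|x s IH] N /= /andP[/andP[x0 Nx] /IH Hs].
rewrite points_cat cat_path Nx /=; case: x x0 {Nx} Hs => //.
Qed.

Definition mix (run : seq (R * seq (elt R))) : seq (elt R) :=
  flatten [seq scale e.1 e.2 | e <- run].

Lemma mix_points run : points (mix run) = points (flatten (map snd run)).
Proof.
by elim: run => [//|e run IH]; rewrite /mix /= !points_cat points_scale -/(mix run) IH.
Qed.

Lemma mix_level_points q run :
  level_points q (mix run) = level_points q (flatten (map snd run)).
Proof.
elim: run => [//|e run IH].
by rewrite /mix /= !level_points_cat level_points_scale -/(mix run) IH.
Qed.

Lemma mix_meas run a : meas (mix run) a = \sum_(e <- run) e.1 * meas e.2 a.
Proof. by rewrite /mix meas_flatten; apply: eq_bigr => e _; rewrite meas_scale. Qed.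

Lemma mem_mix run e : e \in mix run ->
  exists c x w, [/\ (c, x) \in run, (e.1, w) \in x & e.2 = c * w].
Proof.
move=> /flattenP[y /mapP[[c x] cx ->] /mapP[[e1 w] ew ->]].
by exists c, x, w.
Qed.

Lemma object_pos k z : object k z -> all (fun e => 0 <= e.2) z.
Proof. by move=> [_ H _ _ _]; apply/allP => e /H[]. Qed.

Lemma block_pos k x : block k x -> all (fun e => 0 <= e.2) x.
Proof. by move=> [z [n [-> /object_pos Hz _]]]; rewrite all_rcons ler01. Qed.

Lemma block_mass k x q : block k x -> (k <= q <= i)%N -> level_mass q x = 1.
Proof.
move=> [z [n [-> Hz _]]] /andP[kq qi]; rewrite /level_mass meas_rcons /=.
case: Hz => [_ Hlev Hm _ _].
case: eqP => [kq'|/eqP kq'].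
  rewrite meas0 ?add0r // => e /Hlev[_ /andP[ke _] _] /=.
  by rewrite -kq' neq_ltn ke orbT.
by rewrite addr0; apply: Hm; rewrite qi andbT ltn_neqAle kq'.
Qed.

Lemma block_ruler k x q N : block k x -> beyond N x -> (k <= q <= i)%N -> ruler q i x.
Proof.
move=> [z [n [-> Hz _]]] /andP[_ Np] /andP[kq qi] t.
have Hpos := object_pos Hz; case: Hz => [_ Hlev Hm _ Hr].
have zn e : e \in z -> (e.1.1 < n)%N.
  move=> ez; move: (path_sorted Np); rewrite /points map_rcons.
  rewrite -cats1 (sorted_pairwise ltn_trans) pairwise_cat => /andP[/allrelP H _].
  by apply: H; [apply: map_f|rewrite mem_head].
have bk : before k z t = 0.
  by apply: meas0 => e /Hlev[_ /andP[ke _] _] /=; rewrite gtn_eqF.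
have Hge : 0 <= next_weight q (rcons z ((n, k), 1)) t.
  by apply: next_weight_ge0; rewrite all_rcons ler01.
(* For [q = k < i] the whole object precedes the only level-[k] point: level [i] gets ahead by at
   most 1, the weight of that point, and after it both masses are 1. *)
move: kq; rewrite leq_eqVlt => /orP[/eqP kq|kq].
  subst q; have [ik|ik] := eqVneq k i; first by rewrite ik lexx lerDl -ik.
  have ki : (k < i)%N by rewrite ltn_neqAle ik.
  rewrite /before !meas_rcons /= eqxx -!/(before _ _ _) bk add0r /= (negPf ik) addr0.
  have Hi : level_mass i z = 1 by apply: Hm; rewrite ki leqnn.
  case: ltnP => nt; last first.
    rewrite add0r (meas_ge0 _ Hpos) /= /next_weight filter_rcons /= eqxx nt /=.
    have -> : [seq e <- z | (e.1.2 == k) && (t <= e.1.1)%N] = [::].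
      apply/eqP; rewrite -(negbK (_ == _)) -has_filter; apply/hasPn => e /Hlev[_ /andP[ke _] _].
      by rewrite gtn_eqF.
    by rewrite /= -Hi; apply: before_le_mass.
  have -> : before i z t = 1.
    by rewrite -Hi; apply: before_all => e /zn en; apply: ltn_trans en nt.
  by rewrite lexx lerDl.
have E l : (k < l)%N -> before l (rcons z ((n, k), 1)) t = before l z t.
  by move=> kl; rewrite /before meas_rcons /= ltn_eqF //= addr0.
rewrite !E //; last exact: leq_trans kq qi.
have -> : next_weight q (rcons z ((n, k), 1)) t = next_weight q z t.
  by rewrite /next_weight filter_rcons /= ltn_eqF.
by apply: Hr; rewrite kq qi.
Qed.

Lemma mix_ruler k q N run : all (fun e => 0 <= e.1) run ->
  chain beyond block_end N (map snd run) -> (forall x, x \in map snd run -> block k x) ->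
  (k <= q <= i)%N -> ruler q i (mix run).
Proof.
move=> + + + kqi; elim: run N => [|[c x] run IH] N /=; first by move=> *; apply: ruler_nil.
move=> /andP[c0 Hrun] Hch Hb.
have ki : (k <= i <= i)%N by move: kqi => /andP[kq qi]; rewrite leqnn (leq_trans kq).
have Hx := Hb x (mem_head _ _).
have Hsub y : y \in map snd run -> block k y.
  by move=> yr; apply: Hb; rewrite inE yr orbT.
have srt : sorted ltn (points (mix ((c, x) :: run))).
  by rewrite mix_points; apply: path_sorted (chain_points (N := N) _).
move: Hch => /andP[Nx Hch].
rewrite /mix /=; apply: ruler_cat => //.
- exact: scale_ge0 (block_pos Hx).
- apply/allP => e /mem_mix[c' [y [w [cy yw ->]]]]; apply: mulr_ge0.
    by move/allP: Hrun => /(_ _ cy).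
  have By : block k y by apply: Hsub; apply/mapP; exists (c', y).
  by have /allP /(_ _ yw) := block_pos By.
- by rewrite /level_mass !meas_scale -!/(level_mass _ _) !(block_mass Hx).
- exact: ruler_scale (block_ruler Hx Nx kqi).
- exact: IH Hch Hsub.
Qed.

(** Averaging blocks tested at their ends makes level [k] nearly invisible to its families; the
    finer levels keep their bounds under convex combinations. *)
Lemma object_step k : (k <= i)%N -> object_ex k.+1 -> object_ex k.
Proof.
move=> ki Hk b p N Hp.
pose Q s := reserve b (p ++ flatten s) /\ forall x, x \in s -> block k x.
have HQ : der beyond Q (wexp (rho k)) [::].
  apply: block_game => //=; rewrite cats0; apply: reserve_ext Hp => q qi.
  rewrite /full_budget /budget; case: ltnP => // kq.
  by rewrite (cost_step _ kq) wexpD.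
have [run [/= [Hres Hblk] Hch pos sm ms]] :=
  @average R _ beyond block_end beyond_end beyond_le (rho k) J (BL k) Pf Q [::] N (delta k)
    (delta_gt0 k) (fun j _ => Pf_sfam j) (fun j => @Pf_poor k j) HQ.
have Hrun c x : (c, x) \in run -> 0 <= c /\ block k x.
  move=> cx; split; first by move/allP: pos => /(_ _ cx).
  by apply: Hblk; apply/mapP; exists (c, x).
exists (mix run); split; last first.
- by move=> q qi s sL; rewrite level_points_cat mix_level_points -level_points_cat; apply: Hres.
- by rewrite mix_points; apply: chain_points.
split.
- by rewrite mix_points; apply: path_sorted (chain_points Hch).
- move=> e /mem_mix[c [x [w [/Hrun[c0 Bx] xw ->]]]].
  have w0 : 0 <= w by have /allP /(_ _ xw) := block_pos Bx.
  rewrite mulr_ge0 //; move: Bx xw => [z [n [-> [_ Hlev _ _ _] Mn]]].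
  rewrite mem_rcons inE => /orP[/eqP[-> _]|/Hlev[? /andP[ke ei] _]] /=; split=> //.
    by rewrite leqnn ki.
  by rewrite ei andbT ltnW.
- move=> q kqi; rewrite /level_mass mix_meas -sm big_seq [RHS]big_seq.
  apply: eq_bigr => [[c x]] /Hrun[_ Bx] /=.
  by rewrite -/(level_mass q x) (block_mass Bx) // mulr1.
- move=> q /andP[kq qi] j jB B HB; rewrite mix_meas.
  move: kq; rewrite leq_eqVlt => /orP[/eqP kq|kq].
    subst q; apply: le_trans (ms j jB B HB).
    rewrite /mass [leRHS]big_mkcond /= big_seq [leRHS]big_seq.
    apply: ler_sum => [[c x]] /Hrun[c0 [z [n [-> [_ Hlev _ _ _] _]]]] /=.
    rewrite meas_rcons /= eqxx meas0 /=; last first.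
      by move=> e /Hlev[_ /andP[ke _] _] /=; rewrite gtn_eqF.
    rewrite add0r /block_end /points map_rcons last_rcons /=.
    by case: ifP => _; rewrite ?mulr1 ?mulr0.
  apply: (@le_trans _ _ (\sum_(e <- run) e.1 * delta q)); last by rewrite -mulr_suml sm mul1r.
  rewrite big_seq [leRHS]big_seq; apply: ler_sum => [[c x]] /Hrun[c0 [z [n [-> Hz _]]]] /=.
  rewrite ler_wpM2l // meas_rcons /= ltn_eqF //= addr0.
  by case: Hz => [_ _ _ Hd _]; apply: (Hd q _ j jB B HB); rewrite kq qi.
- by move=> q kqi; apply: (mix_ruler pos Hch Hblk kqi).
Qed.

Lemma object_exists k : (k <= i.+1)%N -> object_ex k.
Proof.
move=> ki; rewrite -(subKn ki); elim: (i.+1 - k)%N => [|d IH].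
  rewrite subn0 => b p N Hp; exists [::]; split=> //.
    by split=> // q /andP[iq qi]; move: (leq_ltn_trans qi iq); rewrite ltnn.
  by rewrite cats0; apply: reserve_ext Hp => q qi; rewrite /full_budget ltnS qi.
have [di|di] := leqP i.+1 d; last first.
  apply: object_step; first by rewrite subSS leq_subr.
  by rewrite -subSn // subSS.
by have -> : (i.+1 - d.+1 = i.+1 - d)%N by lia.
Qed.

End Objects.

(** * The sequence *)

Lemma rank_ex T (ab : nat -> T -> bool) (H : seq T -> Prop) s b :
  H s -> ~ der ab H b s -> exists r, der ab H r s /\ ~ der ab H (BS r) s.
Proof.
move=> Hs; elim: b => [//|b IH|f IH] Hb; last first.
  by move/existsNP: Hb => [n /IH].
by have [Hd|/IH //] := pselect (der ab H b s); exists b.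
Qed.

Lemma sorted_rcons_or n s : sorted ltn s -> all (fun j => j < n.+1)%N s ->
  all (fun j => j < n)%N s \/ exists s', s = rcons s' n.
Proof.
case/lastP: s => [|s m]; first by left.
rewrite all_rcons => srt /andP[mn Hs].
move: (mn); rewrite ltnS leq_eqVlt => /orP[/eqP ->|m_n]; first by right; exists s.
left; rewrite all_rcons m_n; apply/allP => j js.
move: srt; rewrite -cats1 (sorted_pairwise ltn_trans) pairwise_cat => /andP[/allrelP H _].
by apply: ltn_trans m_n; apply: H => //; rewrite mem_head.
Qed.

Section Sequence.
Variables (R : realType) (M : nat -> Prop) (Fm : nat -> seq nat -> Prop)
  (rho : nat -> bord) (BL : nat -> seq (seq nat)) (Pf : seq nat -> seq nat -> Prop)
  (delta : nat -> R) (f : nat -> bord).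
Hypothesis M_inf : forall N, exists n, (N < n)%N /\ M n.
Hypothesis Fm_lfam : forall q, lfam (Fm q).
Hypothesis Pf_sfam : forall j, sfam (Pf j).
Hypothesis Pf_poor : forall q j, j \in BL q -> ~ nder (Pf j) (wexp (rho q)) [::].
Hypothesis delta_gt0 : forall q, 0 < delta q.
Hypothesis Fm_rich : forall q,
  nder (Fm q) (omul (wexp (cost rho 0 q)) (wexp (f q))) [::].

(** The part of the Schreier family of [BL f] that comes from its term [f q]; [q < min s] also
    guarantees that each vector indexed by [s] has a level [q]. *)
Definition SF q (s : seq nat) := lf (schreier (f q)) s /\ path ltn q s.

Lemma SF_lfam q : lfam (SF q).
Proof.
have HH := schreier_lfam (f q); split=> [s [[]] //|s t [Hs sq] st Ht].
by split; [apply: HH.2 Hs st Ht|apply: path_dom sq st Ht].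
Qed.

Lemma SF_index q s : nder (SF q) (wexp (f q)) s -> s = [::].
Proof. by move=> H; apply: (@schreier_index (f q) s); apply: der_sub H => s' []. Qed.

Lemma SF_rank_ex : exists rk : nat -> seq nat -> bord, forall q s, SF q s ->
  nder (SF q) (rk q s) s /\ ~ nder (SF q) (BS (rk q s)) s.
Proof.
have H (p : nat * seq nat) : exists r, SF p.1 p.2 ->
    nder (SF p.1) r p.2 /\ ~ nder (SF p.1) (BS r) p.2.
  have [Hs|nHs] := pselect (SF p.1 p.2); last by exists BZ.
  have Hn : ~ nder (SF p.1) (BS (wexp (f p.1))) p.2.
    by move=> /(_ 0%N)[n [_ /SF_index]]; case: p.2.
  by have [r Hr] := rank_ex Hs Hn; exists r.
have [rk Hrk] := choice H; exists (fun q s => rk (q, s)) => q s; exact: (Hrk (q, s)).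
Qed.

Lemma SF_rank0 (rk : nat -> seq nat -> bord) q :
  nder (SF q) (rk q [::]) [::] -> ole (rk q [::]) (wexp (f q)).
Proof.
move=> H; apply: contrapT => /not_ole Hlt.
apply: (@nder_nilS (SF q) (wexp (f q)) (@SF_index q)).
exact: nder_mono (SF_lfam q) Hlt H.
Qed.

Definition supports q (h : seq (seq (elt R))) (s : seq nat) :=
  flatten [seq level_points q (nth [::] h j) | j <- s].

(** The reserve mirrors the Schreier rank: one more vector costs [wexp (cost rho 0 q)] and lowers
    [rk q s] by at least one, so the product always suffices. *)
Definition history (rk : nat -> seq nat -> bord) (h : seq (seq (elt R))) :=
  [/\ path ltn 0%N (points (flatten h)),
      forall j, (j < size h)%N -> object M BL Pf delta j 0 (nth [::] h j) &
      forall q s, SF q s -> all (fun j => j < size h)%N s ->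
        nder (Fm q) (omul (wexp (cost rho 0 q)) (rk q s)) (supports q h s)].

Lemma supports_rcons q h z s : all (fun j => j < size h)%N s ->
  supports q (rcons h z) s = supports q h s.
Proof.
move=> /allP H; congr flatten; apply/eq_in_map => j /H js.
by rewrite nth_rcons js.
Qed.

Lemma history_step rk h :
  (forall q s, SF q s -> nder (SF q) (rk q s) s /\ ~ nder (SF q) (BS (rk q s)) s) ->
  history rk h -> exists z, history rk (rcons h z).
Proof.
move=> Hrk [Hp Hobj Hrank]; pose n := size h.
(* Only the sets that the new index [n] prolongs within the Schreier family have to be served. *)
pose LS q := [seq s <- [seq mask (val m) (iota 0 n) | m : n.-tuple bool] |
              `[< SF q (rcons s n) >]].
pose X q := wexp (cost rho 0 q).
have LSP q s : SF q (rcons s n) -> s \in LS q.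
  move=> Hs; rewrite mem_filter; apply/andP; split; first exact/asboolP.
  have srt := path_sorted ((SF_lfam q).1 _ Hs).
  have ssub : subseq s (iota 0 n).
    apply: subset_subseq; [|exact: iota_ltn_sorted|].
      exact: (subseq_sorted ltn_trans (subseq_rcons _ _) srt).
    move=> j js; rewrite mem_iota /= add0n.
    move: srt; rewrite -cats1 (sorted_pairwise ltn_trans) pairwise_cat => /andP[/allrelP H _].
    by apply: H => //; rewrite mem_head.
  move: ssub => /subseqP[mm szm ->]; rewrite size_iota in szm.
  have szm' : size mm == n by apply/eqP.
  by apply/mapP; exists (Tuple szm'); rewrite ?mem_enum.
have LSall q s : s \in LS q -> all (fun j => j < n)%N s.
  rewrite mem_filter => /andP[_ /mapP[m _ ->]]; apply/allP => j /mem_mask.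
  by rewrite mem_iota.
have Hres : reserve Fm n LS (fun q s => supports q h s)
    (fun q s => omul (X q) (rk q (rcons s n))) (full_budget rho (fun _ => BZ) 0) ([::] : seq (elt R)).
  move=> q qn s sL; rewrite /full_budget /= oadd0 cats0 -/(X q).
  have Hs : SF q (rcons s n) by move: sL; rewrite mem_filter => /andP[/asboolP].
  have Hs' := lfam_rcons (SF_lfam q) Hs.
  have [H1 _] := Hrk _ _ Hs; have [H2 H3] := Hrk _ _ Hs'.
  (* By spreading, one extension in the family puts [s] one derivative higher. So the rank drops
     strictly from [s] to [rcons s n], which frees one copy of [X q]. *)
  have HBS : nder (SF q) (BS (rk q (rcons s n))) s.
    apply: contrapT => Hn; exact: (nder_evN (SF_lfam q) Hn H1).
  have Hle : ole (BS (rk q (rcons s n))) (rk q s).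
    apply: contrapT => /not_ole Hlt; apply: H3; exact: nder_mono (SF_lfam q) Hlt HBS.
  apply: nder_mono (Fm_lfam q) (omul_monor (X q) Hle) _.
  exact: Hrank Hs' (LSall _ _ sL).
have [z [Hz zp Hzr]] := object_exists M_inf Fm_lfam Pf_sfam Pf_poor delta_gt0
   (i := n) (leq0n _) (last 0%N (points (flatten h))) Hres.
exists z; split; rewrite ?size_rcons.
- by rewrite flatten_rcons points_cat cat_path Hp.
- move=> j; rewrite ltnS leq_eqVlt nth_rcons => /orP[/eqP ->|jn]; last by rewrite jn; apply: Hobj.
  by rewrite ltnn eqxx.
- move=> q s Hs Hall; have srt := path_sorted ((SF_lfam q).1 _ Hs).
  have [Hall'|[s' Es]] := sorted_rcons_or srt Hall.
    by rewrite supports_rcons //; apply: Hrank.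
  subst s; have sL := LSP _ _ Hs.
  have qn : (q <= n)%N.
    have := Hs.2; rewrite (path_sortedE ltn_trans) => /andP[/allP H _].
    by apply: ltnW; apply: H; rewrite mem_rcons mem_head.
  rewrite /supports map_rcons flatten_rcons -/(supports q (rcons h z) s').
  rewrite supports_rcons ?LSall // ?(LSall _ _ sL) // nth_rcons ltnn eqxx.
  exact: (Hzr q qn s' sL).
Qed.

Lemma sequence_exists : exists x : nat -> seq (elt R),
  [/\ forall j, object M BL Pf delta j 0 (x j),
      forall j e, e \in x j -> (0 < e.1.1)%N,
      forall j k e e', (j < k)%N -> e \in x j -> e' \in x k -> (e.1.1 < e'.1.1)%N &
      forall q s, SF q s -> Fm q (flatten [seq level_points q (x j) | j <- s])].
Proof.
have [rk Hrk] := SF_rank_ex.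
have /choice[F HF] : forall h, exists z, history rk h -> history rk (rcons h z).
  move=> h; have [Hh|nHh] := pselect (history rk h); last by exists [::].
  by have [z Hz] := history_step Hrk Hh; exists z.
pose h := fix h n := if n is n'.+1 then rcons (h n') (F (h n')) else [::].
have szh n : size (h n) = n by elim: n => //= n IH; rewrite size_rcons IH.
have Hh n : history rk (h n).
  elim: n => [|n IH]; last exact: HF.
  (* At the start only the empty set occurs; its Schreier rank is at most [wexp (f q)], which
     [Fm_rich] covers. *)
  split=> // q [|j s] //= Hs _; rewrite /supports /=.
  apply: nder_mono (Fm_lfam q) (omul_monor _ _) (Fm_rich q).
  by apply: SF_rank0; have [] := Hrk _ _ Hs.
have hn j n : (j < n)%N -> nth [::] (h n) j = F (h j).
  elim: n => [//|n IH]; rewrite ltnS leq_eqVlt /= nth_rcons szh => /orP[/eqP ->|jn].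
    by rewrite ltnn eqxx.
  by rewrite jn IH.
exists (fun j => F (h j)); split.
- by move=> j; rewrite -(hn j j.+1) //; have [_ H _] := Hh j.+1; apply: H; rewrite szh.
- move=> j e ej; have [+ _ _] := Hh j.+1; rewrite /= flatten_rcons points_cat.
  rewrite (path_sortedE ltn_trans) => /andP[/allP H _]; apply: H.
  by rewrite mem_cat; apply/orP; right; apply: map_f.
- move=> j k e e' jk ej ek; have [+ _ _] := Hh k.+1.
  rewrite /= flatten_rcons points_cat => /path_sorted.
  rewrite (sorted_pairwise ltn_trans) pairwise_cat => /andP[/allrelP H _].
  apply: H; last exact: map_f.
  apply: map_f; apply/flattenP; exists (F (h j)) => //.
  by rewrite -(hn j k jk); apply: mem_nth; rewrite szh.
- move=> q s Hs; pose n := (\max_(j <- s) j).+1.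
  have Hall : all (fun j => j < n)%N s.
    by apply/allP => j js; rewrite ltnS; apply: (@leq_bigmax_seq _ s xpredT id).
  have [_ _ /(_ q s Hs)] := Hh n; rewrite szh => /(_ Hall) /(nder0 (Fm_lfam q)).
  rewrite /supports; congr (Fm q (flatten _)); apply/eq_in_map => j js.
  by rewrite hn // (allP Hall).
Qed.

End Sequence.

(** * Choice of the levels *)

Lemma mix_exp_rcons rho ks k : mix_exp rho (rcons ks k) = oadd (rho k) (mix_exp rho ks).
Proof. by elim: ks => [|n ks /= ->]; [exact: oadd0|rewrite oaddA]. Qed.

Lemma costS rho k : cost rho 0 k.+1 = oadd (rho k.+1) (cost rho 0 k).
Proof. by rewrite /cost !subn0 -addn1 iotaD cats1 mix_exp_rcons. Qed.

Lemma cost0 rho : cost rho 0 0 = rho 0%N.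
Proof. exact: oadd0. Qed.

Lemma prod_alpha_cat alpha s1 s2 :
  prod_alpha alpha (s1 ++ s2) = omul (prod_alpha alpha s2) (prod_alpha alpha s1).
Proof. by elim: s1 => [|n s1 /= ->]; rewrite ?omul1 ?omulA. Qed.

Section Weights.
Variables (R : realType) (theta : nat -> R).
Hypothesis theta01 : forall n, 0 < theta n < 1.
Hypothesis theta_dec : forall n, theta n.+1 <= theta n.
Hypothesis theta0 : theta @ \oo --> 0.

Definition weight (ns : seq nat) : R := \prod_(n <- ns) theta n.

Lemma weight_nil : weight [::] = 1. Proof. exact: big_nil. Qed.

Lemma weight_cons n ns : weight (n :: ns) = theta n * weight ns.
Proof. exact: big_cons. Qed.

Lemma weight_cat s1 s2 : weight (s1 ++ s2) = weight s1 * weight s2.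
Proof. exact: big_cat. Qed.

Lemma weight_gt0 ns : 0 < weight ns.
Proof. by apply: prodr_gt0 => n _; have /andP[] := theta01 n. Qed.

Lemma theta_small tau : 0 < tau -> exists n0, forall n, (n0 <= n)%N -> theta n < tau.
Proof.
move=> t0; have /cvgrPdist_lt /(_ tau t0) [n0 _ H] := theta0; exists n0 => n nn.
have := H n nn; rewrite sub0r normrN ger0_norm //.
by have /andP[/ltW] := theta01 n.
Qed.

Lemma theta_le0 n : theta n <= theta 0%N.
Proof. by elim: n => // n IH; apply: le_trans (theta_dec n) IH. Qed.

(** A lower bound on the weight bounds the length, as all [theta n] are at most [theta 0 < 1], and
    the letters, as [theta] tends to 0. *)
Lemma finite_paths tau : 0 < tau ->
  exists l : seq (seq nat), forall ns, tau <= weight ns -> ns \in l.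
Proof.
move=> t0; have [n0 Hn0] := theta_small t0.
have /andP[th0 th1] := theta01 0.
have [L HL] : exists L, theta 0%N ^+ L < tau.
  have := @cvg_expr R (theta 0%N); rewrite ger0_norm ?ltW // => /(_ th1).
  move=> /cvgrPdist_lt /(_ tau t0) [L _ H]; exists L.
  by have := H L (leqnn L); rewrite /= sub0r normrN ger0_norm // exprn_ge0 ?ltW.
pose words := fix words L := if L is L'.+1 then
  [::] :: [seq n :: w | n <- iota 0 n0, w <- words L'] else [:: [::]].
have weight_le ns : weight ns <= theta 0%N ^+ size ns.
  elim: ns => [|n ns IH]; first by rewrite weight_nil.
  rewrite weight_cons exprS; apply: ler_pM => //; last exact: theta_le0.
    by have /andP[/ltW] := theta01 n.
  exact: ltW (weight_gt0 _).
have weight1 ns : weight ns <= 1.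
  by apply: le_trans (weight_le ns) _; apply: exprn_ile1; apply: ltW.
have Hw n ns : tau <= weight ns -> (size ns <= n)%N -> ns \in words n.
  elim: n ns => [|n IH] [|m ns] //= Hns szs.
  rewrite inE /=; apply/allpairsP; exists (m, ns); split=> //=.
    rewrite mem_iota /= add0n ltnNge; apply/negP => /Hn0; rewrite ltNge => /negP; apply.
    apply: le_trans Hns _; rewrite weight_cons ler_piMr //.
    by have /andP[/ltW] := theta01 m.
  apply: IH => //; apply: le_trans Hns _; rewrite weight_cons ler_piMl //.
    exact: ltW (weight_gt0 _).
  by have /andP[_ /ltW] := theta01 m.
exists (words L) => ns Hns; apply: Hw => //; rewrite leqNgt; apply/negP => Lns.
have : tau <= theta 0%N ^+ L.
  apply: le_trans Hns (le_trans (weight_le ns) _).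
  by apply: ler_wiXn2l; rewrite ?ltW // ltnW.
by rewrite leNgt HL.
Qed.

Variables (F : nat -> set (set nat)) (alpha : nat -> bord) (xi : bord).
Hypothesis F_reg : forall n, regular (F n).
Hypothesis F_index : forall n, CB_index (F n) (alpha n).
Hypothesis alpha1 : forall n, olt (ofin 1) (alpha n).
Hypothesis alpha_neq : forall n, ~ oeq (BL alpha) (alpha n).
Hypothesis alpha_sup : oeq (BL alpha) (wexp (wexp xi)).
Hypothesis xi_gt0 : olt BZ xi.

Let Omega := wexp xi.

Lemma alpha_pos n : ole (BS BZ) (alpha n).
Proof. exact: oltW (alpha1 n). Qed.

Lemma ofin_lt_Omega n : olt (ofin n) Omega.
Proof.
apply: (@olt_le_trans _ oomega); first by exists n.+1; apply: ole_refl.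
by apply: ole_trans (wexp_mono xi_gt0) => k;
  apply: (@ole_BL _ (fun n => omul (BS BZ) (ofin n)) k); rewrite omul1l.
Qed.

Lemma Omega_add a b : olt a Omega -> olt b Omega -> olt (oadd a b) Omega.
Proof. exact: wexp_add_closed. Qed.

Lemma Omega_S a : olt a Omega -> olt (BS a) Omega.
Proof. by move=> Ha; apply: (@Omega_add a (ofin 1)) => //; apply: ofin_lt_Omega. Qed.

Lemma alpha_lt n : olt (alpha n) (wexp Omega).
Proof.
apply: olt_le_trans alpha_sup.1; apply: not_ole => H; apply: (@alpha_neq n).
by split=> //; apply: (@ole_BL _ _ n).
Qed.

Lemma alpha_exp n : exists L, olt L Omega /\ olt (alpha n) (wexp L).
Proof.
have [L HL] := is_ell_ex (alpha_pos n).
have [H1 H2] := is_ell_bounds HL; exists (BS L); split=> //.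
by apply: Omega_S; apply: wexp_lt_inv; apply: ole_lt_trans H1 (alpha_lt n).
Qed.

Lemma prod_alpha_exp ns : exists e, olt e Omega /\ ole (prod_alpha alpha ns) (wexp e).
Proof.
elim: ns => [|n ns [e [He1 He2]]]; first by exists BZ; split=> //; apply: wexp_pos.
have [L [HL1 HL2]] := alpha_exp n; exists (oadd e L); split; first exact: Omega_add.
by rewrite wexpD; apply: omul_mono => //; apply: oltW.
Qed.

Lemma prod_alpha_exps (l : seq (seq nat)) :
  exists e, olt e Omega /\ forall ns, ns \in l -> ole (prod_alpha alpha ns) (wexp e).
Proof.
elim: l => [|ns l [e [He1 He2]]]; first by exists BZ; split=> //; apply: wexp_pos.
have [e' [He'1 He'2]] := prod_alpha_exp ns.
exists (oadd e e'); split; first exact: Omega_add.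
move=> ns'; rewrite inE => /orP[/eqP ->|/He2 H].
  by apply: ole_trans He'2 _; apply: wexp_mono; apply: ole_addl.
by apply: ole_trans H _; apply: wexp_mono; apply: ole_addr.
Qed.

Lemma alpha_exps n0 : exists B, olt B Omega /\ forall n, (n < n0)%N -> olt (alpha n) (wexp B).
Proof.
elim: n0 => [|n0 [B [HB1 HB2]]]; first by exists BZ; split=> //; apply: wexp_pos.
have [e [He1 He2]] := alpha_exp n0.
exists (oadd B e); split; first exact: Omega_add.
move=> n; rewrite ltnS leq_eqVlt => /orP[/eqP ->|/HB2 H].
  by apply: olt_le_trans He2 _; apply: wexp_mono; apply: ole_addl.
by apply: olt_le_trans H _; apply: wexp_mono; apply: ole_addr.
Qed.

Lemma Fam_poor ns rho : olt (prod_alpha alpha ns) (wexp rho) ->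
  ~ nder (Fam F ns) (wexp rho) [::].
Proof.
move=> H Hn; apply: (@nder_nilS (Fam F ns) (prod_alpha alpha ns)).
  by move=> s; apply: Fam_index => //; apply: alpha_pos.
exact: nder_mono (Fam_lfam ns F_reg) H Hn.
Qed.

Lemma F_rich n a : ole a (alpha n) -> nder (lf (F n)) a [::].
Proof.
move=> H; apply: nder_mono (regular_lfam (F_reg n)) H _.
apply/CBder_nder => //; rewrite (F_index n) /=.
by apply/seteqP; split.
Qed.

Variable eps : R.
Hypothesis eps0 : 0 < eps.
Hypothesis dag : forall beta, olt beta (wexp xi) ->
      exists m g L, is_gamma theta alpha eps m g /\ is_ell (alpha m) L /\
        olt (oadd (oadd g (ofin 2)) beta) L.

(* Adding to [beta] the exponents of all [alpha n] with [theta n >= tau] forces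
   the index [m] given by [dag] to satisfy [theta m < tau]. *)
Lemma dag_step eta sigma tau : olt eta Omega -> olt sigma Omega -> 0 < tau ->
  exists m rho, [/\ theta m < tau, olt rho Omega,
    ole (wexp (oadd rho sigma)) (alpha m) &
    forall ns1 ns2, ole (prod_alpha alpha ns1) (wexp eta) ->
      theta m < eps * weight ns2 -> ~ nder (Fam F (ns1 ++ ns2)) (wexp rho) [::]].
Proof.
move=> He Hs t0; have [n0 Hn0] := theta_small t0; have [B [HB1 HB2]] := alpha_exps n0.
pose beta := oadd (oadd (BS eta) sigma) B.
have [m [g [L [[Hg _] [HL gL]]]]] := dag (Omega_add (Omega_add (Omega_S He) Hs) HB1).
have [L1 L2] := is_ell_bounds HL.
have HL' : olt L Omega by apply: wexp_lt_inv; apply: ole_lt_trans L1 (alpha_lt m).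
have gO : olt g Omega.
  apply: ole_lt_trans HL'; apply: ole_trans (oltW gL).
  by apply: ole_trans (ole_addr _ _); apply: ole_addr.
(* The products along [ns1 ++ ns2] are at most omega^(g + 1 + eta): [g] bounds the exponent for
   [ns2] and [eta] that of the prefix. [rho] lies above this, and [beta] was chosen so that
   [rho + sigma] still fits below [L]. *)
pose rho := oadd (oadd g (ofin 2)) (BS eta).
have Hle : ole (oadd rho sigma) L.
  apply: ole_trans (oltW gL); rewrite /rho -!oaddA; exact: ole_addr.
exists m, rho; split.
- apply: Hn0; rewrite leqNgt; apply/negP => /HB2 H.
  have BL : ole B L by apply: ole_trans (oltW gL); rewrite -!oaddA; apply: ole_addl.
  apply: (@olt_irr (alpha m)); apply: olt_le_trans H _; apply: ole_trans L1; exact: wexp_mono.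
- by apply: Omega_add; [apply: Omega_add => //; apply: ofin_lt_Omega|apply: Omega_S].
- by apply: ole_trans L1; apply: wexp_mono.
- move=> ns1 ns2 H1 H2; apply: Fam_poor; rewrite prod_alpha_cat.
  have H3 : ole (prod_alpha alpha ns2) (wexp (BS g)).
    have [ns2e|ns2e] := eqVneq ns2 [::]; first by rewrite ns2e; apply: wexp_pos.
    have P0 : olt BZ (prod_alpha alpha ns2) by apply: prod_alpha_pos; apply: alpha_pos.
    have [l Hl] := is_ell_ex P0; have [_ /oltW Hl2] := is_ell_bounds Hl.
    apply: ole_trans Hl2 _; apply: wexp_mono; rewrite ole_S; apply: Hg.
    by exists ns2; split=> //; apply/eqP.
  apply: ole_lt_trans (omul_mono H3 H1) _; rewrite -wexpD; apply: wexp_lt.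
  rewrite /olt /rho [oadd _ (BS eta)]/= ole_S; apply: oadd_monol.
  exact: (@oadd_monor g (ofin 1) (ofin 2) (@ofin_mono 1 2 isT)).
Qed.

(** A leaf of smaller weight contributes, after division by [theta (m k)], less than 2^-(k+1), which
    is summable over the levels. *)
Definition lam (m : nat -> nat) k : R := (2 ^- k.+1) * theta (m k).

(** Covers the prefixes lying in an earlier window: for the levels to be chosen [lam m] decreases,
    so comparison with the previous level suffices. *)
Definition prefix_ok (m : nat -> nat) k (ns : seq nat) :=
  ns = [::] \/ exists2 k', k = k'.+1 & lam m k' <= weight ns.

Lemma levels_exist (f : nat -> bord) : (forall q, olt (f q) Omega) ->
  exists (m : nat -> nat) (rho : nat -> bord),
  [/\ theta (m 0%N) < eps,
      forall k, [/\ theta (m k.+1) < eps * lam m k, theta (m k.+1) < 2 ^- k.+1 &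
        theta (m k.+1) < theta (m k)],
      forall k ns1 ns2, prefix_ok m k ns1 -> theta (m k) < eps * weight ns2 ->
        ~ nder (Fam F (ns1 ++ ns2)) (wexp (rho k)) [::] &
      forall q, nder (lf (F (m q))) (omul (wexp (cost rho 0 q)) (wexp (f q))) [::]].
Proof.
move=> Hf.
(* A state is [(m_k, rho_k, y_k)] with [y_k = rho_k + ... + rho_0], later recognized as
   [cost rho 0 k]; the recursion is guarded by [y_k < Omega]. *)
pose good k (s s' : nat * bord * bord) := olt s.2 Omega ->
  [/\ olt s'.2 Omega, s'.2 = oadd s'.1.2 s.2,
      [/\ theta s'.1.1 < eps * (2 ^- k.+1 * theta s.1.1), theta s'.1.1 < 2 ^- k.+1 &
        theta s'.1.1 < theta s.1.1],
      ole (wexp (oadd s'.2 (f k.+1))) (alpha s'.1.1) &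
      forall ns1 ns2, (ns1 = [::] \/ 2 ^- k.+1 * theta s.1.1 <= weight ns1) ->
        theta s'.1.1 < eps * weight ns2 -> ~ nder (Fam F (ns1 ++ ns2)) (wexp s'.1.2) [::]].
have p2 k : 0 < 2 ^- k.+1 :> R by rewrite invr_gt0 exprn_gt0.
have Hstep (p : nat * (nat * bord * bord)) : exists s', good p.1 p.2 s'.
  case: p => k [[m0 r0] y0]; rewrite /good /=.
  have [y0O|y0O] := pselect (olt y0 Omega); last by exists (0%N, BZ, BZ).
  have lam0 : 0 < 2 ^- k.+1 * theta m0 by rewrite mulr_gt0 //; have /andP[] := theta01 m0.
  have [l Hl] := finite_paths lam0; have [eta [Heta Hleta]] := prod_alpha_exps ([::] :: l).
  have tau0 : 0 < Num.min (eps * (2 ^- k.+1 * theta m0)) (Num.min (2 ^- k.+1) (theta m0)).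
    by rewrite !lt_min p2 mulr_gt0 //=; have /andP[] := theta01 m0.
  have [m [rho [H1 H2 H3 H4]]] := dag_step Heta (Omega_add y0O (Hf k.+1)) tau0.
  exists (m, rho, oadd rho y0) => _ /=; split=> //; first exact: Omega_add.
  - by move: H1; rewrite !lt_min => /and3P[].
  - by rewrite oaddA.
  - move=> ns1 ns2 Hns1; apply: H4; apply: Hleta; rewrite inE.
    by case: Hns1 => [->|/Hl ->]; rewrite ?eqxx ?orbT.
have [G HG] := choice Hstep.
have BZO : olt BZ Omega := ofin_lt_Omega 0.
have [m0 [rho0 [A1 A2 A3 A4]]] := dag_step BZO (Hf 0%N) eps0.
pose S := fix S k := if k is k'.+1 then G (k', S k') else (m0, rho0, rho0).
have SO k : olt (S k).2 Omega.
  by elim: k => [//|k IH]; have [] := HG (k, S k) IH.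
exists (fun k => (S k).1.1), (fun k => (S k).1.2); split=> //.
- by move=> k; have [_ _ + _ _] := HG (k, S k) (SO k).
- move=> [|k] ns1 ns2 Hp.
    case: Hp => [->|[]] //; apply: A4; exact: wexp_pos.
  have [_ _ _ _ H] := HG (k, S k) (SO k); apply: H.
  by case: Hp => [->|[k' [<-] H]]; [left|right].
- have Hc q : cost (fun k => (S k).1.2) 0 q = (S q).2.
    elim: q => [|q IH]; first by rewrite cost0.
    by rewrite costS IH; have [_ -> _ _ _] := HG (q, S q) (SO q).
  move=> q; apply: F_rich; rewrite Hc -wexpD.
  case: q => [|q]; first exact: A3.
  by have [_ _ _ + _] := HG (q, S q) (SO q).
Qed.

End Weights.

(** * Norming trees *)

Inductive tree := Leaf of nat | Node of nat & seq tree.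

Definition all_trees (P : tree -> Prop) (ts : seq tree) : Prop :=
  foldr (fun t Q => P t /\ Q) True ts.

Lemma tree_ind2 (P : tree -> Prop) : (forall p, P (Leaf p)) ->
  (forall n ts, all_trees P ts -> P (Node n ts)) -> forall t, P t.
Proof.
move=> HL HN; fix IH 1 => -[p|n ts]; first exact: HL.
apply: HN; elim: ts => [//|t ts IHts]; split; [exact: IH|exact: IHts].
Qed.

Fixpoint leaves (t : tree) : seq nat :=
  match t with Leaf p => [:: p] | Node _ ts => flatten (map leaves ts) end.

Fixpoint valid (F : nat -> set (set nat)) (t : tree) : Prop :=
  match t with
  | Leaf p => (0 < p)%N
  | Node n ts => [/\ all_trees (valid F) ts, all (fun E => E != [::]) (map leaves ts),
      path ltn 0%N (flatten (map leaves ts)) &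
      lf (F n) (map (head 0%N) (map leaves ts))]
  end.

Section Norm.
Variables (R : realType) (theta : nat -> R) (F : nat -> set (set nat)).
Variable N : (nat -> R) -> R.
Implicit Types (x y : nat -> R) (t : tree).

Fixpoint ev (t : tree) (x : nat -> R) : R :=
  match t with
  | Leaf p => `|x p|
  | Node n ts => theta n * foldr (fun t r => ev t x + r) 0 ts
  end.

Lemma evE n ts x : ev (Node n ts) x = theta n * \sum_(t <- ts) ev t x.
Proof. by rewrite /=; congr (_ * _); elim: ts => [|t ts /= ->]; rewrite ?big_nil ?big_cons. Qed.

Lemma ev_ext t x y : (forall p, p \in leaves t -> x p = y p) -> ev t x = ev t y.
Proof.
elim/tree_ind2: t => [p|n ts IH] H; first by rewrite /= H // mem_head.
rewrite !evE;
congr (_ * _); elim: ts IH H => [|t ts IHts]; first by rewrite !big_nil.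
move=> [Ht Hts] H; rewrite !big_cons; congr (_ + _).
  by apply: Ht => p pt; apply: H; rewrite /= mem_cat pt.
by apply: IHts => // p pt; apply: H; rewrite /= mem_cat; apply/orP; right.
Qed.

Lemma ev_scale t c x : ev t (fun i => c * x i) = `|c| * ev t x.
Proof.
elim/tree_ind2: t => [p|n ts IH]; first exact: normrM.
rewrite !evE mulrCA; congr (_ * _); elim: ts IH => [|t ts IHts]; first by rewrite !big_nil mulr0.
by move=> [Ht Hts]; rewrite !big_cons mulrDr Ht IHts.
Qed.

Hypothesis theta01 : forall n, 0 < theta n < 1.
Hypothesis theta_dec : forall n, theta n.+1 <= theta n.
Hypothesis F_reg : forall n, regular (F n).
Hypothesis N_norm : tsirelson_norm theta F N.
Hypothesis F_big : exists n, forall k, exists s, lf (F n) s /\ size s = k.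

Lemma theta_ge0 n : 0 <= theta n. Proof. by have /andP[/ltW] := theta01 n. Qed.

Lemma c00_restrict E x : c00 x -> c00 (restrict E x).
Proof.
move=> [x0 [k Hk]]; split; first by rewrite /restrict x0; case: ifP.
by exists k => i /Hk xi; rewrite /restrict xi; case: ifP.
Qed.

Lemma N_abs x i : c00 x -> `|x i| <= N x.
Proof. by move=> /N_norm[H _]; apply: H; left; exists i. Qed.

Lemma N_ge0 x : c00 x -> 0 <= N x.
Proof. by move=> Hx; apply: le_trans (N_abs 0%N Hx). Qed.

Lemma N_sum x n Es : c00 x -> admissible (F n) Es ->
  theta n * \sum_(E <- Es) N (restrict E x) <= N x.
Proof. by move=> /N_norm[H _] adm; apply: H; right; exists n, Es. Qed.

Lemma ev_le_N t x : c00 x -> valid F t -> ev t x <= N x.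
Proof.
elim/tree_ind2: t x => [p|n ts IH] x Hx; first by move=> _; apply: N_abs.
rewrite evE; move=> [Hv H0 Hp HF]; apply: le_trans (N_sum (n := n) (Es := map leaves ts) Hx _).
  rewrite ler_wpM2l ?theta_ge0 // big_map.
  elim: ts IH Hv {H0 Hp HF} => [|t ts IHts]; first by rewrite !big_nil.
  move=> [Ht Hts] [vt vts]; rewrite !big_cons lerD ?IHts //.
  rewrite (_ : ev t x = ev t (restrict (leaves t) x)).
    by apply: Ht => //; apply: c00_restrict.
  by apply: ev_ext => p pt; rewrite /restrict pt.
by split; [apply/blocksE|apply: HF.2].
Qed.

Lemma c00_0 : c00 ((fun _ => 0) : nat -> R).
Proof. by split=> //; exists 0%N. Qed.

Lemma restrict0 E : restrict E (fun _ => 0) = (fun _ => 0) :> (nat -> R).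
Proof. by apply: funext => i; rewrite /restrict; case: ifP. Qed.

(** The norm equation at 0 gives [theta n * k * N 0 <= N 0] for an admissible sequence of [k] sets;
    [F_big] allows [k] above [1 / theta n]. *)
Lemma N0 : N (fun _ => 0) = 0.
Proof.
apply/eqP; rewrite eq_le (N_ge0 c00_0) andbT leNgt; apply/negP => N0.
have [n Hn] := F_big; have /andP[t0 t1] := theta01 n.
pose k := (Num.truncn (theta n)^-1).+1.
have Hk : (theta n)^-1 < k%:R by apply: truncnS_gt.
have [s [Hs sz]] := Hn k.
have := @N_sum (fun _ => 0) n [seq [:: p] | p <- s] c00_0.
rewrite big_map (eq_bigr (fun _ => N (fun _ => 0))); last by move=> p _; rewrite restrict0.
rewrite big_const_seq count_predT sz iter_addr_0 -mulr_natr mulrCA => H.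
have : N (fun _ => 0) * (theta n * k%:R) <= N (fun _ => 0).
  apply: H; split.
    apply/blocksE; split; first by apply/allP => E /mapP[p _ ->].
    by have -> : flatten [seq [:: p] | p <- s] = s; [elim: (s) => //= p s' ->|apply: Hs.1].
  by rewrite -map_comp map_id; apply: Hs.2.
rewrite ger_pMr // leNgt => /negP; apply.
by rewrite -(ltr_pM2l t0) mulfV ?gt_eqF // in Hk.
Qed.

Definition approx (x : nat -> R) (e : R) (t : tree) :=
  [/\ valid F t, leaves t != [::], forall p, p \in leaves t -> x p != 0 &
      N x <= ev t x + e].

Lemma valid_path t : valid F t -> path ltn 0%N (leaves t).
Proof. by case: t => [p /= ->|n ts []]. Qed.

(** Blocks where [x] vanishes are dropped at no loss by [N0]; the minima of the remaining leaf sets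
    are a spreading of a thinning of the old ones, so they stay admissible. *)
Lemma approx_children x e Es : all (fun E => E != [::]) Es ->
  path ltn 0%N (flatten Es) ->
  (forall E, E \in Es -> (exists2 i, i \in E & x i != 0) ->
    exists t, approx (restrict E x) e t) -> 0 <= e ->
  exists ts, [/\ all_trees (valid F) ts, all (fun E => E != [::]) (map leaves ts),
    subseq (flatten (map leaves ts)) (flatten Es),
    dom (map (head 0%N) Es) (map (head 0%N) (map leaves ts)) &
    (forall p, p \in flatten (map leaves ts) -> x p != 0) /\
    \sum_(E <- Es) N (restrict E x) <= \sum_(t <- ts) ev t x + (size Es)%:R * e].
Proof.
move=> + + + e0; elim: Es => [|E Es IH] /=.
  by move=> _ _ _; exists [::]; split=> //; split=> //; rewrite !big_nil mul0r addr0.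
move=> /andP[E0 HEs] Hp Happ.
have Hp' := path_subseq (suffix_subseq E (flatten Es)) Hp.
have HpE := path_subseq (prefix_subseq E (flatten Es)) Hp.
have Happ' E' : E' \in Es -> (exists2 i, i \in E' & x i != 0) ->
    exists t, approx (restrict E' x) e t.
  by move=> E'Es; apply: Happ; rewrite inE E'Es orbT.
have [ts [H1 H2 H3 H4 [H5 H6]]] := IH HEs Hp' Happ'.
have [Ex|nEx] := pselect (exists2 i, i \in E & x i != 0); last first.
  exists ts; split=> //; first exact: subseq_trans H3 (suffix_subseq _ _).
    by rewrite /= H4.
  split=> //; rewrite big_cons.
  have -> : restrict E x = fun _ => 0.
    apply: funext => i; rewrite /restrict; case: ifP => // iE; apply/eqP/negPn/negP => xi.
    by apply: nEx; exists i.
  rewrite N0 add0r; apply: le_trans H6 _; rewrite lerD2l ler_wpM2r //.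
  by rewrite ler_nat.
have [t [V1 V2 V3 V4]] := Happ E (mem_head _ _) Ex.
have tE p : p \in leaves t -> p \in E.
  by move=> /V3; rewrite /restrict; case: ifP => //; rewrite eqxx.
have tsub : subseq (leaves t) E.
  apply: subset_subseq tE; first exact: path_sorted (valid_path V1).
  exact: path_sorted HpE.
exists (t :: ts); split=> /=; rewrite ?V2 //.
- exact: cat_subseq.
- case: (leaves t) tsub V2 => // p l tsub _ /=.
  by rewrite H4 (dom_head (path_sorted HpE) (dom_subseq tsub)) orbT.
- split.
    move=> p; rewrite mem_cat => /orP[pt|/H5 //].
    by have := V3 p pt; rewrite /restrict tE.
  rewrite !big_cons -[(size Es).+1%:R]natr1 mulrDl mul1r.
  have Eev : ev t (restrict E x) = ev t x by apply: ev_ext => p /tE pE; rewrite /restrict pE.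
  rewrite Eev in V4; lra.
Qed.

(** Induction on the size of the support: a nearly optimal admissible sequence, none of whose blocks
    contains the whole support, reduces to smaller supports. *)
Lemma exists_approx (s : seq nat) x e : (forall i, x i != 0 -> i \in s) -> c00 x ->
  (exists i, x i != 0) -> 0 < e -> exists t, approx x e t.
Proof.
move: {2}(size s) (leqnn (size s)) => m; elim: m s x e => [|m IH] s x e szs Hs Hx [i0 Hi0] e0.
  by have := Hs i0 Hi0; move: szs; rewrite leqn0 size_eq0 => /eqP ->.
have Nx0 : 0 < N x by apply: lt_le_trans (N_abs i0 Hx); rewrite normr_gt0.
have /andP[th0 th1] := theta01 0.
(* The second bound excludes a block containing the whole support, which would only yield
   [theta n * N x]. *)
pose e1 := Num.min e ((1 - theta 0%N) * N x).
have e10 : 0 < e1 by rewrite lt_min e0 mulr_gt0 // subr_gt0.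
have e1e : e1 <= e by rewrite ge_min lexx.
have e1N : e1 <= (1 - theta 0%N) * N x by rewrite ge_min lexx orbT.
have thN : 0 <= theta 0%N * N x by rewrite mulr_ge0 // ltW.
have [r [Hr Nr]] : exists r, ((exists i, r = `|x i|) \/ exists n Es, admissible (F n) Es /\
      r = theta n * \sum_(E <- Es) N (restrict E x)) /\ N x - e1 / 2 < r.
  apply: contrapT => /forallNP Hn; have [_ /(_ (N x - e1 / 2))] := N_norm Hx.
  have H : N x <= N x - e1 / 2 -> False by lra.
  move=> H'; apply: H; apply: H' => r Hr; rewrite leNgt; apply/negP => Hlt.
  by apply: (Hn r).
case: Hr => [[i Er]|[n [Es [adm Er]]]].
  have xi : x i != 0.
    apply/eqP => xi; move: Er; rewrite xi normr0 => Er; lra.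
  exists (Leaf i); split=> //.
  - by rewrite /= lt0n; apply: contraNneq xi => ->; have [->] := Hx.
  - by move=> p; rewrite inE => /eqP ->.
  - rewrite /=; lra.
have /blocksE[E0 Hp] := adm.1.
have [[E EEs HE]|nfull] := pselect (exists2 E, E \in Es & forall i, x i != 0 -> i \in E).
  exfalso; move: EEs E0 Hp Er => /splitPr[Es1 Es2] E0 Hp Er.
  have uq : uniq (flatten (Es1 ++ E :: Es2)).
    exact: sorted_uniq ltn_trans ltnn _ (path_sorted Hp).
  have dj E' p : (E' \in Es1) || (E' \in Es2) -> p \in E' -> p \notin E.
    rewrite flatten_cat /= uniq_catC -catA cat_uniq in uq.
    move: uq => /and3P[_ /hasPn /= H _] HE' pE'; apply/negP => pE.
    have : p \in flatten Es2 ++ flatten Es1.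
      rewrite mem_cat; apply/orP; case/orP: HE' => HE'; [right|left];
        by apply/flattenP; exists E'.
    by move/H; rewrite pE.
  have z E' : (E' \in Es1) || (E' \in Es2) -> N (restrict E' x) = 0.
    move=> HE'; rewrite (_ : restrict E' x = fun _ => 0) ?N0 //; apply: funext => p.
    rewrite /restrict; case: ifP => // /(dj _ _ HE') pE; apply/eqP; apply: contraNT pE.
    exact: HE.
  have EE : restrict E x = x.
    apply: funext => p; rewrite /restrict; case: ifP => // /negbT pE.
    by apply/esym/eqP; apply: contraNT pE; apply: HE.
  move: Er; rewrite big_cat big_cons /= EE big_seq big1 ?add0r; last by move=> E' h; apply: z; rewrite h.
  rewrite big_seq big1 ?addr0; last by move=> E' h; apply: z; rewrite h orbT.
  have := ler_wpM2r (ltW Nx0) (theta_le0 theta_dec n); lra.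
pose e2 := e1 / (2 * (size Es).+1%:R).
have e20 : 0 < e2 by rewrite divr_gt0 // mulr_gt0.
have e2s : (size Es)%:R * e2 <= e1 / 2.
  by rewrite /e2 mulrA ler_pdivrMr ?mulr_gt0 // -[(size Es).+1%:R]natr1; lra.
have [E|ts [H1 H2 H3 H4 [H5 H6]]] := approx_children E0 Hp _ (ltW e20) (x := x).
  move=> EEs Ex; have [i1 xi1 i1E] : exists2 i, x i != 0 & i \notin E.
    apply: contrapT => Hn; apply: nfull; exists E => // i xi.
    by apply: contrapT => iE; apply: Hn; exists i => //; apply/negP.
  apply: (IH [seq i <- s | i \in E]) => //.
  - have : (size [seq i <- s | i \in E] < size s)%N.
      rewrite size_filter -(count_predC (mem E) s) -addn1 leq_add2l -has_count.
      by apply/hasP; exists i1; rewrite ?Hs.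
    by move=> h; rewrite -ltnS; apply: leq_trans h szs.
  - move=> i; rewrite /restrict mem_filter; case: ifP; last by rewrite eqxx.
    by move=> _ /Hs.
  - exact: c00_restrict.
  - by case: Ex => i iE xi; exists i; rewrite /restrict iE.
have thn : theta n * (\sum_(E <- Es) N (restrict E x)) <= ev (Node n ts) x + e1 / 2.
  rewrite evE; apply: le_trans (ler_wpM2l (theta_ge0 n) H6) _; rewrite mulrDr lerD2l.
  apply: le_trans e2s; apply: ler_piMl; first by rewrite mulr_ge0 // ltW.
  by have /andP[_ /ltW] := theta01 n.
have Hp' := path_subseq H3 Hp.
exists (Node n ts); split=> //.
- split=> //; apply: (regular_lfam (F_reg n)).2 H4 _; last exact: path_heads.
  by split; [apply: path_heads|exact: adm.2].
- move: H2 thn; case: (ts) => [_|t ts' /= /andP[]]; last by case: (leaves t).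
  by rewrite evE big_nil mulr0; lra.
- lra.
Qed.

Lemma c00_support x : c00 x -> exists s : seq nat, forall i, x i != 0 -> i \in s.
Proof.
move=> [_ [k Hk]]; exists (iota 0 k) => i xi; rewrite mem_iota /= add0n ltnNge.
by apply/negP => /Hk xi0; rewrite xi0 eqxx in xi.
Qed.

(** With [ev_le_N], this makes [N x] the supremum of the evaluations of valid trees. *)
Lemma N_le x C : c00 x -> (forall t, valid F t -> ev t x <= C) -> N x <= C.
Proof.
move=> Hx HC; have C0 : 0 <= C by apply: le_trans (HC (Leaf 1) isT); apply: normr_ge0.
have [Ex|nEx] := pselect (exists i, x i != 0); last first.
  have -> : x = fun _ => 0; last by rewrite N0.
  by apply: funext => i; apply/eqP/negPn/negP => xi; apply: nEx; exists i.
apply/ler_addgt0Pr => e e0; have [s Hs] := c00_support Hx.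
have [t [V _ _ Ht]] := exists_approx Hs Hx Ex e0.
by apply: le_trans Ht _; rewrite lerD2r; apply: HC.
Qed.

Lemma c00_scale c x : c00 x -> c00 (fun i => c * x i).
Proof.
move=> [x0 [k Hk]]; split; first by rewrite x0 mulr0.
by exists k => i /Hk ->; rewrite mulr0.
Qed.

(** Homogeneity is inherited from the trees: one inequality for [c], the other from its inverse. *)
Lemma N_scale c x : c00 x -> N (fun i => c * x i) = `|c| * N x.
Proof.
move=> Hx.
have H d y : c00 y -> N (fun i => d * y i) <= `|d| * N y.
  move=> Hy; apply: N_le (c00_scale d Hy) _ => t V.
  by rewrite ev_scale ler_wpM2l // ev_le_N.
apply/eqP; rewrite eq_le H //=; have [->|c0] := eqVneq c 0.
  by rewrite normr0 mul0r N_ge0 //; apply: c00_scale.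
have := H c^-1 _ (c00_scale c Hx).
rewrite (_ : (fun i => _) = x); last by apply: funext => i; rewrite mulKf.
by rewrite normfV ler_pdivlMl // normr_gt0.
Qed.

Lemma trunc_c00 x k : (forall i, (k <= i)%N -> x i = 0) ->
  forall l, (k <= l)%N -> trunc l x = x.
Proof.
move=> Hk l kl; apply: funext => i; rewrite /trunc; case: ltnP => // li.
by rewrite Hk //; apply: leq_trans kl li.
Qed.

Lemma normX_c00 x : c00 x -> normX N x = N x.
Proof.
move=> [_ [k Hk]]; apply/cvg_lim => //.
apply: cvg_near_cst; exists k => // l /= kl.
by rewrite (trunc_c00 Hk).
Qed.

Lemma inX_c00 x : c00 x -> inX N x.
Proof.
move=> [x0 [k Hk]]; split=> // e e0; exists k => l l' kl kl'.
rewrite !(trunc_c00 Hk) // (_ : (fun i => _) = fun _ => 0) ?N0 //.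
by apply: funext => i; rewrite subrr.
Qed.

End Norm.

(** * Points selected along the paths of a tree *)

Section Collect.
Variable pick : seq nat -> tree -> seq nat.

(** Two selections will be used: the leaves themselves, and one point of a given level for each node
    at which a path enters its window. *)
Fixpoint coll (pre : seq nat) (t : tree) : seq (seq nat * nat) :=
  map (pair pre) (pick pre t) ++
  match t with Leaf _ => [::] | Node n ts => flatten (map (coll (rcons pre n)) ts) end.

Fixpoint at_path (ns pre : seq nat) (t : tree) : seq nat :=
  match ns with
  | [::] => pick pre t
  | n' :: ns' => match t with
    | Leaf _ => [::]
    | Node n ts => if n == n' then flatten (map (at_path ns' (rcons pre n)) ts) else [::]
    end
  end.

Lemma coll_prefix pre t l : l \in coll pre t -> prefix pre l.1.
Proof.
elim/tree_ind2: t pre => [p|n ts IH] pre /=.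
  by rewrite cats0 => /mapP[q _ ->] /=; apply: prefix_refl.
rewrite mem_cat => /orP[/mapP[q _ ->]|]; first exact: prefix_refl.
have Hrc : prefix pre (rcons pre n) by rewrite prefix_rcons.
elim: ts IH => [//|t ts IHts] /= [Ht Hts]; rewrite mem_cat => /orP[/Ht H|]; last exact: IHts.
exact: prefix_trans Hrc H.
Qed.

Lemma coll_at ns pre t :
  [seq l.2 | l <- coll pre t & l.1 == pre ++ ns] = at_path ns pre t.
Proof.
elim: ns pre t => [|n' ns IH] pre t.
  rewrite cats0 /=.
  have H0 : [seq l.2 | l <- map (pair pre) (pick pre t) & l.1 == pre] = pick pre t.
    by elim: (pick pre t) => //= p s IHs; rewrite eqxx /= IHs.
  case: t H0 => [p|n ts] H0 /=; first by rewrite cats0 H0.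
  rewrite filter_cat map_cat H0 (_ : [seq l <- flatten _ | _] = [::]) ?cats0 //.
  elim: ts {H0} => [//|t ts IHts] /=; rewrite filter_cat IHts cats0.
  apply/eqP; rewrite -(negbK (_ == _)) -has_filter; apply/hasPn => l /coll_prefix /size_prefix.
  by rewrite size_rcons; apply: contraTneq => ->; rewrite ltnn.
have H0 : [seq l.2 | l <- map (pair pre) (pick pre t) & l.1 == pre ++ n' :: ns] = [::].
  elim: (pick pre t) => //= p s IHs; case: eqP => // /(congr1 size).
  by rewrite size_cat /=; lia.
case: t H0 => [p|n ts] H0 /=; first by rewrite cats0 H0.
rewrite filter_cat map_cat H0 /=; case: eqP => [<-|nn'].
  elim: ts {H0} => [//|t ts IHts] /=; rewrite filter_cat map_cat IHts; congr (_ ++ _).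
  by rewrite -IH cat_rcons.
elim: ts {H0} => [//|t ts IHts] /=; rewrite filter_cat map_cat IHts cats0.
rewrite (_ : [seq l <- _ | _] = [::]) //.
apply/eqP; rewrite -(negbK (_ == _)) -has_filter; apply/hasPn => l /coll_prefix /prefixP[s ->].
by apply/eqP; rewrite cat_rcons => /eqP; rewrite eqseq_cat // eqxx /= eqseq_cons => /andP[/eqP].
Qed.

(** Selected points need not be leaves; lying between the first and the last leaf keeps them ordered
    and admissible. *)
Definition in_range t p := [&& leaves t != [::], (head 0 (leaves t) <= p)%N &
  (p <= last 0 (leaves t))%N].

Hypothesis pick_size : forall pre t, (size (pick pre t) <= 1)%N.
Hypothesis pick_range : forall pre t p, p \in pick pre t -> in_range t p.

Lemma head_mem (s : seq nat) : s != [::] -> head 0%N s \in s.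
Proof. by case: s => [//|x s] _; apply: mem_head. Qed.

Lemma path_ge_head x s : path ltn x s -> s != [::] -> (x < head 0 s)%N.
Proof. by case: s => [//|y s] /= /andP[]. Qed.

Lemma path_ltn_le x y s : (x <= y)%N -> path ltn y s -> path ltn x s.
Proof. by case: s => [//|z s] /= xy /andP[yz ->]; rewrite andbT (leq_ltn_trans xy). Qed.

Lemma last_default (s : seq nat) x : s != [::] -> last x s = last 0%N s.
Proof. by case: s. Qed.

Lemma children_range (A : tree -> seq nat) ts x :
  all_trees (fun t => path ltn 0%N (A t) /\ forall p, p \in A t -> in_range t p) ts ->
  all (fun E => E != [::]) (map leaves ts) -> path ltn x (flatten (map leaves ts)) ->
  path ltn x (flatten (map A ts)) /\
  dom (map (head 0%N) (map leaves ts))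
      (map (head 0%N) [seq E <- map A ts | E != [::]]).
Proof.
elim: ts x => [//|t ts IH] x /= [[At Rt] Hts] /andP[t0 H0].
rewrite cat_path => /andP[Hp Hp']; have [IH1 IH2] := IH _ Hts H0 Hp'.
have [A0|A0] := eqVneq (A t) [::].
  rewrite A0 /= IH2 /=; split=> //; apply: path_ltn_le IH1.
  exact: path_le_last Hp (mem_head _ _).
have hx : (x < head 0 (A t))%N.
  have /and3P[_ h _] := Rt _ (head_mem A0).
  exact: leq_trans (path_ge_head Hp t0) h.
have Ap : path ltn x (A t).
  by case: (A t) At A0 hx => [//|y s] /= /andP[_ ->] _ ->.
have lA : (last x (A t) <= last x (leaves t))%N.
  rewrite (last_default _ A0) (last_default _ t0).
  suff /Rt /and3P[] : last 0%N (A t) \in A t by [].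
  by case: (A t) A0 => [//|y s] _; apply: mem_last.
split; first by rewrite cat_path Ap; apply: path_ltn_le IH1.
rewrite /=; have /and3P[_ h _] := Rt _ (head_mem A0).
by rewrite h IH2 orbT.
Qed.

Variable F : nat -> set (set nat).
Hypothesis F_reg : forall n, regular (F n).
Hypothesis F_nil : forall n, lf (F n) [::].

Lemma valid_pos t p : valid F t -> in_range t p -> (0 < p)%N.
Proof.
move=> /valid_path Hp /and3P[t0 h _]; exact: leq_trans (path_ge_head Hp t0) h.
Qed.

Lemma all_trees_impl (P Q : tree -> Prop) ts : (forall t, P t -> Q t) -> all_trees P ts -> all_trees Q ts.
Proof. by move=> H; elim: ts => [//|t ts IH] /= [/H Ht /IH Hts]. Qed.

Lemma in_range_child n ts t p : path ltn 0%N (flatten (map leaves ts)) ->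
  flatten (map leaves ts) != [::] ->
  (exists A B, ts = A ++ t :: B) -> in_range t p -> in_range (Node n ts) p.
Proof.
move=> Hp H0 [A [B Ets]] /and3P[t0 h1 h2]; rewrite /in_range /= H0 /=.
move: Hp H0; rewrite {}Ets map_cat flatten_cat /=; set a := flatten _; set b := flatten _.
move=> Hp H0; apply/andP; split.
  apply: leq_trans h1; have := head_mem t0.
  have : head 0%N (leaves t) \in a ++ leaves t ++ b by rewrite !mem_cat head_mem ?orbT.
  case: (a ++ leaves t ++ b) Hp => [//|y s] /= /andP[_ Hs]; rewrite inE => /orP[/eqP -> //|].
  by move: Hs; rewrite (path_sortedE ltn_trans) => /andP[/allP H _] /H /ltnW.
apply: leq_trans h2 _; apply: path_le_last Hp _.
rewrite inE !mem_cat (_ : last _ _ \in leaves t) ?orbT //.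
by case: (leaves t) t0 => [//|y s] _; apply: mem_last.
Qed.

(** A point selected in the range of a child is at least its minimum, so going from children to
    points only thins and spreads the minima, which [F n] allows. *)
Lemma at_path_Fam ns pre t : valid F t ->
  Fam F ns (at_path ns pre t) /\ (forall p, p \in at_path ns pre t -> in_range t p).
Proof.
elim: ns pre t => [|n' ns IH] pre t V /=.
  split; last exact: pick_range.
  split=> //; have := @pick_range pre t; have := pick_size pre t.
  case: (pick pre t) => [//|p [|//]] _ /(_ p (mem_head _ _)) Hp /=.
  by rewrite (valid_pos V Hp).
have Fnil : Fam F (n' :: ns) [::] by split=> //; exists [::].
case: t V => [p _|n ts V]; first by split.
case: eqP => [nn'|_]; last by split.
subst n'; have [Vts H0 Hp HF] := V.
pose A := at_path ns (rcons pre n).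
have HA : all_trees (fun t => Fam F ns (A t) /\ forall p, p \in A t -> in_range t p) ts.
  by apply: all_trees_impl Vts => t Vt; apply: IH.
have HA' : all_trees (fun t => path ltn 0%N (A t) /\ forall p, p \in A t -> in_range t p) ts.
  by apply: all_trees_impl HA => t [/((Fam_lfam ns F_reg).1 _)].
have [pA dA] := children_range HA' H0 Hp.
have flE : flatten [seq E <- map A ts | E != [::]] = flatten (map A ts).
  elim: (ts) => [//|t ts' IHt] /=; by case: eqVneq => [->|_] /=; rewrite IHt.
have memA (Q : tree -> Prop) : all_trees Q ts -> forall E, E \in map A ts ->
    exists t B1 B2, [/\ ts = B1 ++ t :: B2, Q t & E = A t].
  elim: (ts) => [//|t ts' IHt] /= [Qt Qts] E; rewrite inE => /orP[/eqP ->|/(IHt Qts)].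
    by exists t, [::], ts'.
  by move=> [t' [B1 [B2 [-> Qt' ->]]]]; exists t', (t :: B1), B2.
split.
  split=> //; exists [seq E <- map A ts | E != [::]]; split=> //.
  - exact: filter_all.
  - apply: (regular_lfam (F_reg n)).2 HF dA _; apply: path_heads; first exact: filter_all.
    by rewrite flE.
  - by move=> E; rewrite mem_filter => /andP[_ /(memA _ HA)[t [_ [_ [_ [HFam _] ->]]]]].
move=> p /flattenP[E /(memA _ HA)[t [B1 [B2 [Ets [_ Ht] ->]]]] pA'].
have rt := Ht _ pA'; have fl0 : flatten (map leaves ts) != [::].
  move: (rt) => /and3P[t0 _ _]; rewrite Ets map_cat flatten_cat /=.
  by rewrite -size_eq0 !size_cat; move: t0; rewrite -size_eq0; lia.
exact: (in_range_child n Hp fl0 (ex_intro _ B1 (ex_intro _ B2 Ets)) rt).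
Qed.

(** The selected points are sorted by path; those on one path form a member of [Fam F ns]. *)
Lemma coll_bound (R : realType) (G : nat -> R) (Q : pred (seq nat)) (BL : seq (seq nat))
    (d : R) t : valid F t -> (forall p, 0 <= G p) ->
  (forall ns, Q ns -> ns \in BL) ->
  (forall ns, ns \in BL -> forall B, Fam F ns B -> \sum_(p <- B) G p <= d) ->
  \sum_(l <- coll [::] t | Q l.1) G l.2 <= (size BL)%:R * d.
Proof.
move=> V G0 QB HB.
apply: (@le_trans _ _ (\sum_(ns <- BL) \sum_(l <- coll [::] t | l.1 == ns) G l.2)).
  rewrite (exchange_big_dep xpredT) //= big_mkcond /=; apply: ler_sum => l _.
  case: ifP => [/QB lB|_]; last by apply: sumr_ge0.
  rewrite (big_rem l.1) //= eqxx lerDl; exact: sumr_ge0.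
have -> : (size BL)%:R * d = \sum_(ns <- BL) d.
  by rewrite big_const_seq count_predT iter_addr_0 mulr_natl.
rewrite big_seq [leRHS]big_seq; apply: ler_sum => ns nsB.
rewrite -big_filter -(big_map snd xpredT G) (coll_at ns [::] t).
by apply: (HB ns nsB); have [] := at_path_Fam ns [::] V.
Qed.

End Collect.

(** * The upper estimate *)

Definition vec (R : realType) (c : nat -> R) (z : seq (elt R)) (p : nat) : R :=
  \sum_(e <- z | e.1.1 == p) e.2 / c e.1.2.

Definition leafpick (pre : seq nat) (t : tree) : seq nat :=
  if t is Leaf p then [:: p] else [::].

Lemma leafpick_size pre t : (size (leafpick pre t) <= 1)%N.
Proof. by case: t. Qed.

Lemma leafpick_range pre t p : p \in leafpick pre t -> in_range t p.
Proof. by case: t => [q|//]; rewrite /in_range /= inE => /eqP ->; rewrite leqnn. Qed.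

Lemma coll_leaves pre t : map snd (coll leafpick pre t) = leaves t.
Proof.
elim/tree_ind2: t pre => [//|n ts IH] pre /=.
elim: ts IH => [//|t ts IHts] /= [Ht Hts]; by rewrite map_cat Ht IHts.
Qed.

Lemma geometric_sum (R : realType) n : \sum_(k < n) 2 ^- k.+1 <= 1 :> R.
Proof.
suff -> : \sum_(k < n) 2 ^- k.+1 = 1 - 2 ^- n :> R.
  by rewrite gerBl invr_ge0 exprn_ge0.
elim: n => [|n IH]; first by rewrite big_ord0 expr0 invr1 subrr.
rewrite big_ord_recr /= IH exprS invfM; have : 0 <= 2 ^- n :> R by rewrite invr_ge0 exprn_ge0.
lra.
Qed.

Section Upper.
Variables (R : realType) (theta : nat -> R) (F : nat -> set (set nat)).
Variables (m : nat -> nat) (eps : R) (BL : nat -> seq (seq nat)) (delta : nat -> R).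
Hypothesis theta01 : forall n, 0 < theta n < 1.
Hypothesis F_reg : forall n, regular (F n).
Hypothesis F_nil : forall n, lf (F n) [::].
Hypothesis eps0 : 0 < eps.
Hypothesis m0 : theta (m 0%N) < eps.
Hypothesis mS : forall k, [/\ theta (m k.+1) < eps * lam theta m k,
  theta (m k.+1) < 2 ^- k.+1 & theta (m k.+1) < theta (m k)].

Definition bad q ns := exists ns1 ns2, [/\ ns = ns1 ++ ns2, prefix_ok theta m q ns1 &
  theta (m q) < eps * weight theta ns2].

Hypothesis BL_bad : forall q ns, bad q ns -> ns \in BL q.
Hypothesis BL_delta : forall q, (size (BL q))%:R * delta q <= 2 ^- q.+1 * theta (m q).

Notation w := (weight theta).
Notation hi q := (theta (m q) / eps).
Notation lo q := (lam theta m q).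

Definition in_window q ns := (lo q <= w ns) && (w ns <= hi q).

Lemma thm_gt0 q : 0 < theta (m q). Proof. by have /andP[] := theta01 (m q). Qed.

Lemma thm_le q q' : (q <= q')%N -> theta (m q') <= theta (m q).
Proof.
elim: q' => [|q' IH]; first by rewrite leqn0 => /eqP ->.
rewrite leq_eqVlt => /orP[/eqP ->//|]; rewrite ltnS => /IH; apply: le_trans.
by have [_ _ /ltW] := mS q'.
Qed.

(** The windows are disjoint and descend with [q], by the first inequality of [mS]. *)
Lemma hi_lt_lo q q' : (q < q')%N -> hi q' < lo q.
Proof.
move=> qq'; rewrite ltr_pdivrMr // mulrC.
by apply: le_lt_trans (thm_le qq') _; have [] := mS q.
Qed.

Lemma lo_le q q' : (q <= q')%N -> lo q' <= lo q.
Proof.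
move=> qq'; apply: ler_pM; rewrite ?thm_le ?invr_ge0 ?exprn_ge0 ?(ltW (thm_gt0 _)) //.
by rewrite lef_pV2 ?posrE ?exprn_gt0 // ler_eXn2l // ?ltnS // ltr1n.
Qed.

Lemma w_gt0 ns : 0 < w ns. Proof. exact: weight_gt0. Qed.

Lemma w_le1 ns : w ns <= 1.
Proof.
elim: ns => [|n ns IH]; first by rewrite weight_nil.
rewrite weight_cons; have /andP[t0 t1] := theta01 n.
by rewrite mulr_ile1 ?(ltW t0) ?(ltW t1) ?(ltW (w_gt0 _)).
Qed.

Lemma w_prefix s1 s2 : prefix s1 s2 -> w s2 <= w s1.
Proof.
move=> /prefixP[s ->]; rewrite weight_cat ler_piMr ?w_le1 //; exact: ltW (w_gt0 _).
Qed.

(* The last window before [q] crossed by a prefix of [ns] has index below [kappa]. *)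
Definition mid kappa q ns := [&& (kappa <= q)%N, in_window q ns &
  [forall k : 'I_q, (kappa <= k)%N ==> all (fun j => ~~ in_window k (take j ns)) (iota 0 (size ns).+1)]].

Lemma mid_window kappa q ns : mid kappa q ns -> in_window q ns.
Proof. by case/and3P. Qed.

Lemma mid_nocross kappa q ns k s : mid kappa q ns -> (kappa <= k)%N -> (k < q)%N ->
  prefix s ns -> ~~ in_window k s.
Proof.
move=> /and3P[_ _ /forallP H] kk kq /prefixP[s' E]; subst ns.
move/implyP: (H (Ordinal kq)) => /(_ kk) /allP /(_ (size s)).
rewrite take_size_cat //; apply.
by rewrite mem_iota /= add0n ltnS size_cat leq_addr.
Qed.

(** For a leaf in window [q], the bound [hi q] on its weight gives [1 / eps] after division by
    [theta (m q)]; an earlier crossing of window [k] improves it to [hi k * hi q], hence to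
    [theta (m k) / eps ^+ 2]. *)
Definition qc kappa : R := if kappa is k.+1 then theta (m k) / (eps ^+ 2) else eps^-1.

Lemma qc_ge0 k : 0 <= qc k.
Proof.
case: k => [|k] /=; first by rewrite invr_ge0 ltW.
by rewrite divr_ge0 ?exprn_ge0 ?(ltW (thm_gt0 _)) // ltW.
Qed.

(* With [kappa - 1] the last crossed window before [q], the part of the path
   after the crossing is not heavy for [q] (else the path would be bad), which
   saves the factor [hi (kappa - 1)]. *)
Lemma leaf_bound q ns : w ns / theta (m q) <=
  2 ^- q.+1 + (if `[< bad q ns >] then (theta (m q))^-1 else 0) +
  \sum_(kappa < q.+1 | mid kappa q ns) qc kappa.
Proof.
have tq := thm_gt0 q; have p2 : 0 <= 2 ^- q.+1 :> R by rewrite invr_ge0 exprn_ge0.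
have S0 : 0 <= \sum_(kappa < q.+1 | mid kappa q ns) qc kappa.
  by apply: sumr_ge0 => k _; apply: qc_ge0.
have [wl|wl] := ltP (w ns) (lo q).
  have : w ns / theta (m q) <= 2 ^- q.+1 by rewrite ler_pdivrMr // ltW.
  have : 0 <= (if `[< bad q ns >] then (theta (m q))^-1 else 0).
    by case: ifP => // _; rewrite invr_ge0 ltW.
  lra.
case: asboolP => [_|nbad].
  have : w ns / theta (m q) <= (theta (m q))^-1 by rewrite ler_pdivrMr // mulVf ?gt_eqF // w_le1.
  lra.
have wh : w ns <= hi q.
  rewrite ler_pdivlMr // mulrC leNgt; apply/negP => H; apply: nbad.
  by exists [::], ns; split=> //; left.
have win : in_window q ns by rewrite /in_window wl.
suff [kappa [kq Hmid Hw]] : exists kappa, [/\ (kappa < q.+1)%N, mid kappa q ns &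
    w ns / theta (m q) <= qc kappa].
  rewrite (bigD1 (Ordinal kq)) //=.
  have : 0 <= \sum_(i < q.+1 | mid i q ns && (i != Ordinal kq)) qc i.
    by apply: sumr_ge0 => k _; apply: qc_ge0.
  lra.
pose cross k := (k < q)%N && has (fun j => in_window k (take j ns)) (iota 0 (size ns).+1).
have [[k0 Hk0]|nc] := pselect (exists k, cross k); last first.
  exists 0%N; split=> //; last by rewrite /= ler_pdivrMr // mulrC.
  apply/and3P; split=> //; apply/forallP => k; apply/implyP => _.
  apply/allP => j jn; apply/negP => Hj.
  by apply: nc; exists k; rewrite /cross ltn_ord; apply/hasP; exists j.
have bnd k : cross k -> (k <= q)%N by move=> /andP[/ltnW].
have [k /andP[kq /hasP[j jn Hj]] kmax] := ex_maxnP (ex_intro _ k0 Hk0) bnd.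
exists k.+1; split.
- by rewrite ltnS.
- apply/and3P; split=> //; apply/forallP => k'; apply/implyP => kk'.
  apply/allP => j' j'n; apply/negP => Hj'.
  have : cross k' by rewrite /cross ltn_ord; apply/hasP; exists j'.
  by move=> /kmax; rewrite leqNgt kk'.
have /andP[H1 H2] := Hj.
have Hpre : prefix_ok theta m q (take j ns).
  right; exists q.-1; first by rewrite prednK //; apply: leq_ltn_trans kq.
  by apply: le_trans H1; apply: lo_le; rewrite -ltnS prednK //; apply: leq_ltn_trans kq.
have H3 : eps * w (drop j ns) <= theta (m q).
  rewrite leNgt; apply/negP => H; apply: nbad; exists (take j ns), (drop j ns).
  by split; rewrite ?cat_take_drop.
rewrite -(cat_take_drop j ns) weight_cat ler_pdivrMr //.
apply: (@le_trans _ _ (hi k * hi q)).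
  apply: ler_pM => //; rewrite ?(ltW (w_gt0 _)) //.
  by rewrite ler_pdivlMr // mulrC.
by rewrite /= expr2 invfM -!mulrA (mulrC (theta (m q))).
Qed.

Lemma qc_sum n : \sum_(kappa < n.+1) qc kappa <= eps^-1 + 2 / eps ^+ 2.
Proof.
rewrite big_ord_recl /= lerD2l.
apply: (@le_trans _ _ (\sum_(k < n) (2 * 2 ^- k.+1) / eps ^+ 2)).
  apply: ler_sum => k _; rewrite ler_pM2r ?invr_gt0 ?exprn_gt0 //.
  have -> : 2 * 2 ^- k.+1 = 2 ^- k :> R by rewrite exprS invfM mulVKf // pnatr_eq0.
  case: (nat_of_ord k) => [|k']; last by have [_ /ltW] := mS k'.
  by rewrite expr0 invr1; have /andP[_ /ltW] := theta01 (m 0%N).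
rewrite -mulr_suml -mulr_sumr ler_pM2r ?invr_gt0 ?exprn_gt0 //.
by have := geometric_sum R n; lra.
Qed.

Variables (z : seq (elt R)) (i : nat).
Hypothesis z_sorted : sorted ltn (points z).
Hypothesis z_level : forall e, e \in z -> (e.1.2 <= i)%N.
Hypothesis z_ge0 : all (fun e => 0 <= e.2) z.
Hypothesis z_mass : forall q, (q <= i)%N -> level_mass q z = 1.
Hypothesis z_ruler : forall q, (q <= i)%N -> ruler q i z.
Hypothesis z_poor : forall q, (q <= i)%N -> forall ns, ns \in BL q -> forall B, Fam F ns B ->
  meas z [pred x | (x.2 == q) && (x.1 \in B)] <= delta q.

Definition G q p : R := meas z [pred x | (x.2 == q) && (x.1 == p)].

Lemma G_ge0 q p : 0 <= G q p. Proof. exact: meas_ge0. Qed.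

Lemma meas_disjoint_le (a b c : pred (nat * nat)) :
  (forall e, e \in z -> a e.1 -> b e.1 -> False) ->
  (forall e, e \in z -> a e.1 -> c e.1) -> (forall e, e \in z -> b e.1 -> c e.1) ->
  meas z a + meas z b <= meas z c.
Proof.
elim: z z_ge0 => [|e s IH] /=; first by rewrite !meas_nil addr0.
move=> /andP[e0 s0] Hab Ha Hb; rewrite !meas_cons.
have IH' : meas s a + meas s b <= meas s c.
  by apply: IH => // e' es; [apply: Hab|apply: Ha|apply: Hb]; rewrite inE es orbT.
have := Hab e (mem_head _ _); have := Ha e (mem_head _ _); have := Hb e (mem_head _ _).
case: (a e.1); case: (b e.1) => hb ha hab.
- by case: hab.
- rewrite ha //; lra.
- rewrite hb //; lra.
- by rewrite !add0r; case: (c e.1); lra.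
Qed.

Lemma meas_split (a b c : pred (nat * nat)) :
  (forall e, e \in z -> a e.1 -> b e.1 -> False) ->
  (forall e, e \in z -> c e.1 = a e.1 || b e.1) ->
  meas z c = meas z a + meas z b.
Proof.
elim: z => [|e s IH]; first by rewrite !meas_nil addr0.
move=> Hab Hc; rewrite !meas_cons IH; first 1 last.
- by move=> e' es; apply: Hab; rewrite inE es orbT.
- by move=> e' es; apply: Hc; rewrite inE es orbT.
have := Hab e (mem_head _ _); rewrite (Hc e (mem_head _ _)).
case: (a e.1); case: (b e.1) => hab /=; first by case: hab.
- ring.
- ring.
- ring.
Qed.

Lemma sum_G q B : uniq B -> \sum_(p <- B) G q p = meas z [pred x | (x.2 == q) && (x.1 \in B)].
Proof.
elim: B => [|p B IH] /=; first by rewrite big_nil meas0 // => e _ /=; rewrite andbF.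
move=> /andP[pB /IH E]; rewrite big_cons E; apply/esym; apply: meas_split => e ez /=.
  by move=> /andP[_ /eqP ->] /andP[_]; apply/negP.
by rewrite inE andb_orr.
Qed.

Lemma sum_level p (h : nat -> R) :
  \sum_(e <- z | e.1.1 == p) h e.1.2 * e.2 = \sum_(q < i.+1) h q * G q p.
Proof.
rewrite /G; elim: z z_level => [|e s IH] Hlev.
  by rewrite big_nil big1 // => q _; rewrite meas_nil mulr0.
have {IH}IH := IH (fun e' es => Hlev e' (mem_behead (s := e :: s) es)).
have He : (e.1.2 < i.+1)%N by rewrite ltnS Hlev ?mem_head.
rewrite big_cons IH.
have -> : \sum_(q < i.+1) h q * meas (e :: s) [pred x | (x.2 == q :> nat) && (x.1 == p)] =
   (\sum_(q < i.+1) h q * (if (e.1.2 == q) && (e.1.1 == p) then e.2 else 0)) +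
   \sum_(q < i.+1) h q * meas s [pred x | (x.2 == q :> nat) && (x.1 == p)].
  by rewrite -big_split /=; apply: eq_bigr => q _; rewrite meas_cons mulrDr.
have -> : \sum_(q < i.+1) h q * (if (e.1.2 == q) && (e.1.1 == p) then e.2 else 0) =
    if e.1.1 == p then h e.1.2 * e.2 else 0.
  rewrite (bigD1 (Ordinal He)) //= eqxx /= big1 ?addr0; last first.
    move=> q /eqP qe; case: eqP => [E|]; last by rewrite /= mulr0.
    by case: qe; apply: val_inj.
  by case: eqP => _ //; rewrite mulr0.
by case: eqP => _ //; rewrite add0r.
Qed.

Lemma vec_G p : vec (fun q => theta (m q)) z p = \sum_(q < i.+1) G q p / theta (m q).
Proof.
rewrite /vec; have := sum_level p (fun q => (theta (m q))^-1).
under eq_bigr do rewrite mulrC; move=> ->; by apply: eq_bigr => q _; rewrite mulrC.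
Qed.

Lemma vec_ge0 p : 0 <= vec (fun q => theta (m q)) z p.
Proof.
by rewrite vec_G; apply: sumr_ge0 => q _; rewrite divr_ge0 ?G_ge0 // ltW ?thm_gt0.
Qed.

Lemma ev_coll pre t x :
  w pre * ev theta t x = \sum_(l <- coll leafpick pre t) w l.1 * `|x l.2|.
Proof.
elim/tree_ind2: t pre => [p|n ts IH] pre; first by rewrite /= big_seq1.
rewrite evE /= mulrA -[w pre * theta n]/(w pre * theta n).
have -> : w pre * theta n = w (rcons pre n).
  by rewrite -cats1 weight_cat weight_cons weight_nil mulr1.
elim: ts IH => [|t ts IHts] /=; first by rewrite !big_nil mulr0.
by move=> [Ht Hts]; rewrite big_cons mulrDr Ht IHts // big_cat.
Qed.

Definition active q pre := hi q < w pre.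

(** At most one point; its weight is the discrepancy that [ruler] permits on the interval from [a]
    to [b]. *)
Definition nxt q a b : seq nat :=
  [seq p <- take 1 [seq e.1.1 | e <- z & (e.1.2 == q) && (a <= e.1.1)%N] | (p <= b)%N].

(** The point is recorded with the path before the step into window [q]. That path is still too
    heavy for [q], hence bad with empty first part, which makes these points cheap. *)
Definition exitpick q pre t : seq nat :=
  if t is Node n ts then
    if [&& active q pre, in_window q (rcons pre n) & leaves t != [::]]
    then nxt q (head 0%N (leaves t)) (last 0%N (leaves t)) else [::]
  else [::].

Lemma exitpick_size q pre t : (size (exitpick q pre t) <= 1)%N.
Proof.
case: t => [//|n ts] /=; case: ifP => // _; rewrite size_filter.
by apply: leq_trans (count_size _ _) _; rewrite size_take_min geq_minl.
Qed.

Lemma exitpick_range q pre t p : p \in exitpick q pre t -> in_range t p.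
Proof.
case: t => [//|n ts] /=; case: ifP => // /and3P[_ _ t0].
rewrite mem_filter => /andP[pb /mem_take /mapP[e]].
by rewrite mem_filter => /andP[/andP[_ ea] _] E; subst p; rewrite /in_range t0 ea.
Qed.

Lemma nxt_bound q a b : (q <= i)%N -> (a <= b.+1)%N ->
  meas z [pred x | (x.2 == q) && (a <= x.1 <= b)%N] <=
  meas z [pred x | (x.2 == i) && (a <= x.1 <= b)%N] + \sum_(p <- nxt q a b) G q p.
Proof.
move=> qi ab.
have spl q' : before q' z b.+1 =
    before q' z a + meas z [pred x | (x.2 == q') && (a <= x.1 <= b)%N].
  apply: meas_split => e _ /=; first by move=> /andP[_ h1] /andP[_ /andP[h2 _]]; lia.
  by case: (e.1.2 == q') => //=; lia.
(* The lower ruler inequality at [b.+1] and the upper one at [a] together compare the two levels on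
   the interval. *)
have /andP[h1 _] := z_ruler qi b.+1; have /andP[_ h2] := z_ruler qi a.
rewrite !spl in h1.
have main : meas z [pred x | (x.2 == q) && (a <= x.1 <= b)%N] <=
  meas z [pred x | (x.2 == i) && (a <= x.1 <= b)%N] + next_weight q z a by lra.
move: main; rewrite /next_weight /nxt.
case E: [seq e <- z | (e.1.2 == q) && (a <= e.1.1)%N] => [|e0 s] /=.
  by rewrite big_nil.
rewrite take0.
have srt : sorted ltn [seq e.1.1 | e <- e0 :: s].
  by rewrite -E; apply: (subseq_sorted ltn_trans (map_subseq _ (filter_subseq _ _)) z_sorted).
have e0z : e0 \in [seq e <- z | (e.1.2 == q) && (a <= e.1.1)%N] by rewrite E mem_head.
move: (e0z); rewrite mem_filter => /andP[/andP[/eqP e0q ae0] e0z'].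
case: leqP => e0b.
  move=> main; rewrite big_seq1; apply: le_trans main _; rewrite lerD2l.
  rewrite /G /meas (big_rem e0) //= e0q !eqxx /= lerDl.
  by rewrite big_seq_cond; apply: sumr_ge0 => e /andP[/mem_rem /(allP z_ge0)].
move=> _; rewrite big_nil addr0 meas0; first exact: meas_ge0.
move=> e ez; apply/negP => /= /andP[eq /andP[ae eb]].
have : e \in e0 :: s by rewrite -E mem_filter eq ae.
rewrite inE => /orP[/eqP E0|es]; first by move: e0b; rewrite -E0; lia.
move: srt; rewrite /= (path_sortedE ltn_trans) => /andP[/allP /(_ e.1.1) H _].
by have /= := H (map_f _ es); lia.
Qed.

(** The finest level is the common yardstick for all levels; ranges of siblings are disjoint, so its
    masses add up to at most 1. *)
Definition range_mass t := meas z [pred x | (x.2 == i) && in_range t x.1].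

Lemma leaves_range t p : valid F t -> p \in leaves t -> in_range t p.
Proof.
move=> /valid_path Hp pt; have t0 : leaves t != [::] by case: (leaves t) pt.
rewrite /in_range t0 (path_le_last Hp) ?inE ?pt ?orbT // andbT.
case: (leaves t) pt Hp => [//|y s] /=; rewrite inE => /orP[/eqP -> //|ps] /andP[_].
by rewrite (path_sortedE ltn_trans) => /andP[/allP /(_ _ ps) /ltnW].
Qed.

Lemma leaves_uniq t : valid F t -> uniq (leaves t).
Proof. by move=> /valid_path /path_sorted; apply: sorted_uniq; [exact: ltn_trans|exact: ltnn]. Qed.

Lemma range_sum n ts : valid F (Node n ts) ->
  \sum_(t <- ts) range_mass t <= range_mass (Node n ts).
Proof.
move=> [_ H0 Hp _].
have [fl0|fl0] := eqVneq (flatten (map leaves ts)) [::].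
  have -> : ts = [::] by case: (ts) fl0 H0 => [//|t ts'] /=; case: (leaves t).
  by rewrite big_nil; apply: meas_ge0.
have gen x ts' : all (fun E => E != [::]) (map leaves ts') ->
    path ltn x (flatten (map leaves ts')) -> \sum_(t <- ts') range_mass t <=
    meas z [pred y | (y.2 == i) && (x < y.1 <= last x (flatten (map leaves ts')))%N].
  elim: ts' x => [|t ts' IH] x; first by rewrite big_nil => _ _; apply: meas_ge0.
  rewrite big_cons [flatten _]/= [all _ _]/= => /andP[t0 Ht]; rewrite cat_path => /andP[p1 p2].
  apply: le_trans (lerD (lexx _) (IH _ Ht p2)) _; rewrite last_cat.
  have ll := path_le_last p2 (mem_head _ _).
  have hx := path_ge_head p1 t0.
  rewrite (last_default x t0) in p2 ll *.
  have lx : (x <= last 0 (leaves t))%N.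
    by rewrite -(last_default x t0); apply: path_le_last p1 (mem_head _ _).
  apply: meas_disjoint_le => e _ /=; rewrite /in_range.
  - by move=> /andP[_ /and3P[_ _ h1]] /andP[_ /andP[h2 _]]; lia.
  - by move=> /andP[-> /and3P[_ h1 h2]] /=; lia.
  - by move=> /andP[-> /andP[h1 h2]] /=; lia.
have h0 := path_ge_head Hp fl0.
have Hp1 : path ltn (head 0%N (flatten (map leaves ts))).-1 (flatten (map leaves ts)).
  by case: (flatten _) Hp fl0 => [//|y s] /= /andP[y0 ->] _; rewrite andbT; lia.
apply: le_trans (gen _ _ H0 Hp1) _; apply: meas_le => // e _ /=.
move=> /andP[-> /andP[h1 h2]]; rewrite /in_range /= fl0 /=.
rewrite (last_default _ fl0) in h2; rewrite h2 andbT; lia.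
Qed.

(* Each branch leaves the nodes active for [q] at most once; the ranges of the
   nodes where this happens by entering window [q] are disjoint for different
   nodes and levels, because entering one window excludes [mid] for all others. *)
Lemma exit_bound kappa pre t : valid F t ->
  \sum_(l <- coll leafpick pre t) \sum_(q < i.+1 | mid kappa q l.1 && active q pre) G q l.2
  <= range_mass t + \sum_(q < i.+1) \sum_(l <- coll (exitpick q) pre t) G q l.2.
Proof.
elim/tree_ind2: t pre => [p|n ts IH] pre V.
  rewrite /= big_seq1 /= big1; last first.
    move=> q /andP[/mid_window /andP[_ h1]]; rewrite /active => h2.
    by have := lt_le_trans h2 h1; rewrite ltxx.
  rewrite addr_ge0 ?meas_ge0 //; apply: sumr_ge0 => q _; apply: sumr_ge0 => l _; exact: G_ge0.
have Hpre l : l \in coll leafpick pre (Node n ts) -> prefix (rcons pre n) l.1.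
  rewrite /=; elim: (ts) => [//|t ts' IHts] /=; rewrite mem_cat => /orP[/coll_prefix //|].
  exact: IHts.
(* If window [q0] is entered here, only level [q0] counts: coarser windows lie above all weights
   still to come, and for a finer one [mid] forbids the crossing of [q0]. *)
have [[q0 [kq0 act0 win0]]|nex] := pselect (exists q : 'I_i.+1,
    [/\ (kappa <= q)%N, active q pre & in_window q (rcons pre n)]).
- apply: (@le_trans _ _ (\sum_(l <- coll leafpick pre (Node n ts)) G q0 l.2)).
    rewrite big_seq [leRHS]big_seq; apply: ler_sum => l /Hpre Hl.
    rewrite big_mkcond (bigD1 q0) //= big1 ?addr0; last first.
      move=> q qq0; case: ifP => // /andP[Hm Ha].
      have [lt|lt|/val_inj E] := ltngtP q q0; last by rewrite E eqxx in qq0.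
        have /andP[h1 _] := mid_window Hm; have /andP[_ h2] := win0.
        have := le_lt_trans (le_trans (w_prefix Hl) h2) (hi_lt_lo lt).
        by rewrite ltNge h1.
      by have := mid_nocross Hm kq0 lt Hl; rewrite win0.
    by case: ifP => // _; apply: G_ge0.
  rewrite -(big_map snd xpredT (G q0)) coll_leaves sum_G; last exact: leaves_uniq V.
  have [t0|t0] := eqVneq (leaves (Node n ts)) [::].
    rewrite t0 meas0; last by move=> e _ /=; rewrite andbF.
    by rewrite addr_ge0 ?meas_ge0 //; apply: sumr_ge0 => q _; apply: sumr_ge0 => l _; exact: G_ge0.
  pose a := head 0%N (leaves (Node n ts)); pose b := last 0%N (leaves (Node n ts)).
  have ab : (a <= b)%N by have /and3P[] := leaves_range V (head_mem t0).
  apply: (@le_trans _ _ (meas z [pred x | (x.2 == q0 :> nat) && (a <= x.1 <= b)%N])).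
    apply: meas_le => // e _ /= /andP[-> /(leaves_range V)/and3P[_ h1 h2]] /=.
    by rewrite h1.
  apply: le_trans (nxt_bound (q := q0) _ (leqW ab)) _; first by rewrite -ltnS.
  rewrite lerD //.
    by apply: meas_le => // e _ /= /andP[-> /andP[h1 h2]]; rewrite /in_range t0 h1.
  rewrite (bigD1 q0) //= act0 win0 t0 big_cat big_map /= -addrA lerDl addr_ge0 //.
    by apply: sumr_ge0 => l _; exact: G_ge0.
  by apply: sumr_ge0 => q _; apply: sumr_ge0 => l _; exact: G_ge0.
(* A counted level that ceased to be active here would have entered its window, since the weight of
   the leaf below is at least [lo q]. *)
- have Hstep : \sum_(l <- coll leafpick pre (Node n ts))
      \sum_(q < i.+1 | mid kappa q l.1 && active q pre) G q l.2 <=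
    \sum_(l <- coll leafpick pre (Node n ts))
      \sum_(q < i.+1 | mid kappa q l.1 && active q (rcons pre n)) G q l.2.
    rewrite big_seq [leRHS]big_seq; apply: ler_sum => l /Hpre Hl.
    rewrite big_mkcond [leRHS]big_mkcond; apply: ler_sum => q _.
    case: ifP => [/andP[Hm Ha]|_]; last by case: ifP => // _; apply: G_ge0.
    rewrite Hm /=; case: ifP => // /negbT; rewrite /active -leNgt => h.
    case: nex; exists q; split=> //; first by case/and3P: Hm.
    rewrite /in_window h andbT; have /andP[h1 _] := mid_window Hm.
    exact: le_trans h1 (w_prefix Hl).
  apply: le_trans Hstep _.
  apply: (@le_trans _ _ (\sum_(t <- ts) range_mass t + \sum_(q < i.+1)
      \sum_(l <- flatten (map (coll (exitpick q) (rcons pre n)) ts)) G q l.2)); last first.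
    apply: lerD; first exact: range_sum.
    apply: ler_sum => q _; rewrite /= big_cat /= lerDr.
    by apply: sumr_ge0 => l _; exact: G_ge0.
  have [Vts _ _ _] := V; rewrite /=.
  elim: ts IH Vts {V Hpre nex} => [|t ts IHts] /=.
    by rewrite !big_nil add0r; move=> _ _; apply: sumr_ge0 => q _; rewrite big_nil.
  move=> [Ht Hts] [Vt Vts]; rewrite big_cat big_cons /=.
  apply: le_trans (lerD (Ht _ Vt) (IHts Hts Vts)) _.
  have -> : \sum_(q < i.+1) \sum_(l <- coll (exitpick q) (rcons pre n) t ++
        flatten [seq coll (exitpick q) (rcons pre n) i0 | i0 <- ts]) G q l.2 =
      \sum_(q < i.+1) \sum_(l <- coll (exitpick q) (rcons pre n) t) G q l.2 +
      \sum_(q < i.+1) \sum_(l <- flatten [seq coll (exitpick q) (rcons pre n) i0 | i0 <- ts]) G q l.2.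
    by rewrite -big_split /=; apply: eq_bigr => q _; rewrite big_cat.
  lra.
Qed.

Lemma coll_mem pick pre t l : l \in coll pick pre t -> exists t', l.2 \in pick l.1 t'.
Proof.
elim/tree_ind2: t pre => [p|n ts IH] pre /=.
  by rewrite cats0 => /mapP[q Hq ->]; exists (Leaf p).
rewrite mem_cat => /orP[/mapP[q Hq ->]|]; first by exists (Node n ts).
elim: ts IH => [//|t ts IHts] /= [Ht Hts]; rewrite mem_cat => /orP[/Ht //|].
exact: IHts.
Qed.

Lemma bad_sum pick q t : (q <= i)%N -> (forall pre t, (size (pick pre t) <= 1)%N) ->
  (forall pre t p, p \in pick pre t -> in_range t p) -> valid F t ->
  \sum_(l <- coll pick [::] t | `[< bad q l.1 >]) G q l.2 <= 2 ^- q.+1 * theta (m q).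
Proof.
move=> qi ps pr V; apply: le_trans (BL_delta q).
apply: (coll_bound ps pr F_reg F_nil V (Q := fun ns => `[< bad q ns >])) => //.
- exact: G_ge0.
- by move=> ns /asboolP /BL_bad.
- move=> ns nsB B HB; rewrite sum_G; first exact: z_poor HB.
  have := (Fam_lfam ns F_reg).1 _ HB; move=> /path_sorted.
  by apply: sorted_uniq; [exact: ltn_trans|exact: ltnn].
Qed.

Lemma exit_sum t : valid F t ->
  \sum_(q < i.+1) \sum_(l <- coll (exitpick q) [::] t) G q l.2 <= 1.
Proof.
move=> V; apply: le_trans (geometric_sum R i.+1); apply: ler_sum => q _.
have qi : (q <= i)%N by rewrite -ltnS.
have Hb := bad_sum qi (exitpick_size q) (exitpick_range (q := q)) V.
apply: le_trans (le_trans _ Hb) _; last first.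
  rewrite ler_piMr ?invr_ge0 ?exprn_ge0 //; by have /andP[_ /ltW] := theta01 (m q).
rewrite [leRHS]big_mkcond big_seq [leRHS]big_seq; apply: ler_sum => l /coll_mem[t'].
case: t' => [//|n ts] /=; case: ifP => // /and3P[act _ _] _; case: asboolP => // nb.
case: nb; exists [::], l.1; split=> //; first by left.
by move: act; rewrite /active ltr_pdivrMr // mulrC.
Qed.

Lemma level_sum_le1 t q : valid F t -> (q <= i)%N -> \sum_(p <- leaves t) G q p <= 1.
Proof.
move=> V qi; rewrite sum_G; last exact: leaves_uniq V.
by rewrite -(z_mass qi); apply: meas_le => // e _ /andP[].
Qed.

Lemma vec_bound t : valid F t ->
  ev theta t (vec (fun q => theta (m q)) z) <= 2 + 2 * (eps^-1 + 2 / eps ^+ 2).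
Proof.
move=> V; have := ev_coll [::] t (vec (fun q => theta (m q)) z).
rewrite weight_nil mul1r => ->; set L := coll leafpick [::] t.
have LE (f : nat -> R) : \sum_(l <- L) f l.2 = \sum_(p <- leaves t) f p.
  by rewrite -(coll_leaves [::] t) big_map.
(* The root is active for every level, which starts [exit_bound]. *)
have actT (q : nat) : active q [::].
  rewrite /active weight_nil ltr_pdivrMr // mul1r; apply: le_lt_trans m0; exact: thm_le.
(* The three terms of [leaf_bound]: light leaves, bad paths, and leaves in a window. *)
pose A (l : seq nat * nat) (q : nat) := 2 ^- q.+1 * G q l.2.
pose B (l : seq nat * nat) q := (if `[< bad q l.1 >] then (theta (m q))^-1 else 0) * G q l.2.
pose C (l : seq nat * nat) q := (\sum_(kappa < q.+1 | mid kappa q l.1) qc kappa) * G q l.2.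
have Habc : \sum_(l <- L) w l.1 * `|vec (fun q : nat => theta (m q)) z l.2| <=
    \sum_(l <- L) \sum_(q < i.+1) (A l q + B l q + C l q).
  apply: ler_sum => l _; rewrite ger0_norm ?vec_ge0 // vec_G mulr_sumr.
  apply: ler_sum => q _; rewrite mulrA mulrAC -!mulrDl ler_wpM2r ?G_ge0 //.
  exact: leaf_bound.
apply: le_trans Habc _.
have -> : \sum_(l <- L) \sum_(q < i.+1) (A l q + B l q + C l q) =
   \sum_(q < i.+1) \sum_(l <- L) A l q + \sum_(q < i.+1) \sum_(l <- L) B l q +
   \sum_(l <- L) \sum_(q < i.+1) C l q.
  rewrite (exchange_big _ _ L) (exchange_big _ _ L) -!big_split /=.
  by apply: eq_bigr => l _; rewrite !big_split.
have HA : \sum_(q < i.+1) \sum_(l <- L) A l q <= 1.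
  apply: le_trans (geometric_sum R i.+1); apply: ler_sum => q _.
  rewrite -mulr_sumr (LE (G q)) ler_piMr ?invr_ge0 ?exprn_ge0 //.
  by apply: level_sum_le1 => //; rewrite -ltnS.
have HB : \sum_(q < i.+1) \sum_(l <- L) B l q <= 1.
  apply: le_trans (geometric_sum R i.+1); apply: ler_sum => q _.
  have qi : (q <= i)%N by rewrite -ltnS.
  have Hb := bad_sum qi leafpick_size leafpick_range V.
  have -> : \sum_(l <- L) B l q =
      (theta (m q))^-1 * \sum_(l <- L | `[< bad q l.1 >]) G q l.2.
    rewrite mulr_sumr [RHS]big_mkcond; apply: eq_bigr => l _.
    by rewrite /B; case: ifP => // _; rewrite mul0r.
  by rewrite ler_pdivrMl ?thm_gt0 // mulrC.
suff HC : \sum_(l <- L) \sum_(q < i.+1) C l q <= 2 * (eps^-1 + 2 / eps ^+ 2) by lra.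
have CE : \sum_(l <- L) \sum_(q < i.+1) C l q = \sum_(kappa < i.+1) qc kappa *
   (\sum_(l <- L) \sum_(q < i.+1 | mid kappa q l.1 && active q [::]) G q l.2).
  under [RHS]eq_bigr do rewrite mulr_sumr.
  rewrite [RHS]exchange_big; apply: eq_bigr => l _ /=.
  under [RHS]eq_bigr do rewrite mulr_sumr big_mkcond.
  rewrite [RHS]exchange_big; apply: eq_bigr => q _ /=; rewrite /C mulr_suml.
  rewrite (big_ord_widen_cond i.+1 (fun k => mid k q l.1) (fun k => qc k * G q l.2)) //.
  rewrite big_mkcond; apply: eq_bigr => k _; rewrite actT andbT.
  by case Hm: (mid k q l.1) => //=; rewrite ltnS; case/and3P: Hm => ->.
(* The factor 2 is 1 for the disjoint ranges plus 1 for the exit points. *)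
rewrite CE; apply: (@le_trans _ _ (\sum_(kappa < i.+1) qc kappa * 2)).
  apply: ler_sum => kappa _; rewrite ler_wpM2l ?qc_ge0 //.
  apply: le_trans (exit_bound kappa [::] V) _.
  have h1 : range_mass t <= 1.
    by rewrite -(z_mass (leqnn i)); apply: meas_le => // e _ /andP[].
  have h2 := exit_sum V; lra.
rewrite -mulr_suml mulrC ler_wpM2l //; exact: qc_sum.
Qed.

End Upper.

(** * The theorem *)

Lemma der_ofin_ext T (ab : nat -> T -> bool) (H : seq T -> Prop) k s :
  der ab H (ofin k) s -> exists s', H (s ++ s') /\ size s' = k.
Proof.
elim: k s => [|k IH] s /=; first by move=> Hs; exists [::]; rewrite cats0.
move=> /(_ 0%N)[x [_ /IH[s' [Hs' sz]]]]; exists (x :: s'); rewrite /= sz; split=> //.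
by rewrite cat_rcons in Hs'.
Qed.

(** Otherwise the supremum would be at most omega. Such an [F n] has members of every size, as
    [F_big] requires. *)
Lemma exists_omega_le alpha xi : oeq (BL alpha) (wexp (wexp xi)) -> olt BZ xi ->
  exists n, ole oomega (alpha n).
Proof.
move=> [_ H] xi0; apply: contrapT => /forallNP Hn.
have Hle : ole (BL alpha) oomega by move=> n; apply: oltW; apply: not_ole; apply: Hn.
have Hw : ole (wexp (wexp xi)) (wexp (ofin 1)).
  by apply: ole_trans H _; rewrite (omul1l oomega : wexp (ofin 1) = oomega).
apply: (@olt_irr (wexp (ofin 1))).
exact: olt_le_trans (wexp_lt (ofin_lt_Omega xi0 1)) Hw.
Qed.

Lemma schreier_tree_limit t xi : schreier_tree t -> oeq t (wexp xi) -> olt BZ xi ->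
  exists2 f, t = BL f & forall q, olt (f q) (wexp xi).
Proof.
move=> [Hinc _] [H1 H2] xi0; case: t Hinc H1 H2 => [|b|f] Hinc H1 H2.
- have : ole (BS BZ) BZ by apply: ole_trans (wexp_pos xi) H2.
  by [].
- case: (@olt_irr (BS b)); apply: olt_le_trans H2.
  exact: (@Omega_S xi xi0 b H1).
- exists f => // q; apply: olt_le_trans (Hinc f (st_refl _) q) _.
  by apply: ole_trans H1; apply: (@ole_BL _ _ q.+1).
Qed.

Lemma infinite_unbounded (M : set nat) : ~ finite_set M ->
  forall N, exists n, (N < n)%N /\ M n.
Proof.
move=> Minf N; apply: contrapT => /forallNP H; apply: Minf.
apply: sub_finite_set (finite_II N.+1) => n Mn /=.
by rewrite ltnS leqNgt; apply/negP => Nn; apply: (H n).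
Qed.

Section Assembly.
Variables (R : realType) (theta : nat -> R) (F : nat -> set (set nat)).
Variable N : (nat -> R) -> R.
Hypothesis theta01 : forall n, 0 < theta n < 1.
Hypothesis theta_dec : forall n, theta n.+1 <= theta n.
Hypothesis theta0 : theta @ \oo --> 0.
Hypothesis F_reg : forall n, regular (F n).

Lemma bad_finite (m : nat -> nat) (eps : R) q : 0 < eps ->
  exists BL : seq (seq nat), forall ns, ns \in BL <-> bad theta m eps q ns.
Proof.
move=> e0; have t0 : 0 < theta (m q) / eps by rewrite divr_gt0 //; have /andP[] := theta01 (m q).
(* For [q = 0] the prefix is empty and [q.-1] merely supplies a positive bound. *)
have l0 : 0 < lam theta m q.-1.
  rewrite mulr_gt0 ?invr_gt0 ?exprn_gt0 //; by have /andP[] := theta01 (m q.-1).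
have [l2 H2] := finite_paths theta01 theta_dec theta0 t0.
have [l1 H1] := finite_paths theta01 theta_dec theta0 l0.
exists [seq ns <- [seq a ++ b | a <- [::] :: l1, b <- l2] | `[< bad theta m eps q ns >]].
move=> ns; rewrite mem_filter; split=> [/andP[/asboolP //]|Hb].
apply/andP; split; first exact/asboolP.
have [ns1 [ns2 [-> Hp Hw]]] := Hb.
apply/allpairsP; exists (ns1, ns2); split=> //=.
  by rewrite inE; case: Hp => [->//|[q' E h]]; subst q; rewrite (H1 _ h) orbT.
by apply: H2; rewrite ler_pdivrMr // mulrC ltW.
Qed.

Lemma c00_sum (s : seq nat) (g : nat -> nat -> R) : (forall n, c00 (g n)) ->
  c00 (fun i => \sum_(n <- s) g n i).
Proof.
move=> Hg; elim: s => [|n s [IH0 [k Hk]]].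
  by split; [rewrite big_nil|exists 0%N => i _; rewrite big_nil].
have [g0 [k' Hk']] := Hg n; split; first by rewrite big_cons g0 IH0 addr0.
exists (maxn k k') => i; rewrite geq_max => /andP[ki k'i].
by rewrite big_cons Hk' // Hk // addr0.
Qed.

Lemma c00_vec c (z : seq (elt R)) : (forall e, e \in z -> (0 < e.1.1)%N) -> c00 (vec c z).
Proof.
move=> zpos; split.
  rewrite /vec big_seq_cond big1 // => e /andP[/zpos e0 /eqP E].
  by move: e0; rewrite E.
exists (\max_(e <- z) e.1.1).+1 => i ki.
rewrite /vec big_seq_cond big1 // => e /andP[ez /eqP E].
by move: ki; rewrite -E ltnNge (@leq_bigmax_seq _ z xpredT (fun e => e.1.1)).
Qed.

Lemma vec_support c (z : seq (elt R)) p : p \notin points z -> vec c z p = 0.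
Proof.
move=> pz; rewrite /vec big_seq_cond big1 // => e /andP[ez /eqP E].
by rewrite -E (map_f (fun e => e.1.1) ez : e.1.1 \in points z) in pz.
Qed.

Lemma vec_ge c (z : seq (elt R)) e : (forall q, 0 < c q) -> all (fun e => 0 <= e.2) z ->
  e \in z -> e.2 / c e.1.2 <= vec c z e.1.1.
Proof.
move=> c0 /allP z0 ez; rewrite /vec (big_rem e) //= eqxx lerDl big_seq_cond.
by apply: sumr_ge0 => e' /andP[/mem_rem /z0 e'0 _]; rewrite divr_ge0 // ltW.
Qed.

Hypothesis N_norm : tsirelson_norm theta F N.
Hypothesis F_big : exists n, forall k, exists s, lf (F n) s /\ size s = k.

(** One node over all level-[q] points: [theta (m q)] cancels the normalization of that level, and
    the other levels only add nonnegative amounts. *)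
Lemma lower_bound (m : nat -> nat) (x : nat -> seq (elt R)) q (s : seq nat) (b : nat -> R) :
  (forall j, all (fun e => 0 <= e.2) (x j)) ->
  (forall j e, e \in x j -> (0 < e.1.1)%N) ->
  (forall j k e e', (j < k)%N -> e \in x j -> e' \in x k -> (e.1.1 < e'.1.1)%N) ->
  uniq s -> (forall j, j \in s -> level_mass q (x j) = 1) ->
  lf (F (m q)) (flatten [seq level_points q (x j) | j <- s]) ->
  \sum_(n <- s) `|b n| <=
  N (fun p => \sum_(n <- s) b n * vec (fun q => theta (m q)) (x n) p).
Proof.
move=> x0 xpos xdisj us xmass xF; set c := fun q => theta (m q).
have c0 k : 0 < c k by have /andP[] := theta01 (m k).
set y := fun p => \sum_(n <- s) b n * vec c (x n) p; set U := flatten _ in xF.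
have cy : c00 y.
  by apply: c00_sum => n; apply: c00_scale; apply: c00_vec; apply: xpos.
have fU : flatten (map leaves (map Leaf U)) = U.
  by rewrite -map_comp; elim: U {xF} => //= p U ->.
have V : valid F (Node (m q) (map Leaf U)).
  have Upos : all (fun p => 0 < p)%N U.
    by have := xF.1; rewrite (path_sortedE ltn_trans) => /andP[].
  split; rewrite ?fU; [|by elim: U {xF fU Upos}|exact: xF.1|].
    by elim: U Upos {xF fU} => //= p U IH /andP[p0 /IH].
  by rewrite -!map_comp (_ : map _ U = U) //; elim: U {xF fU Upos} => //= p U ->.
apply: le_trans (ev_le_N theta01 N_norm cy V); rewrite evE big_map /=.
have -> : \sum_(j <- U) `|y j| = \sum_(n <- s) \sum_(p <- level_points q (x n)) `|y p|.
  rewrite /U; elim: (s) => [|n s' IH]; first by rewrite !big_nil.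
  by rewrite big_cons /= big_cat IH.
rewrite mulr_sumr big_seq [leRHS]big_seq; apply: ler_sum => n ns.
have yE e : e \in x n -> y e.1.1 = b n * vec c (x n) e.1.1.
  move=> ex; rewrite /y (bigD1_seq n) //= big1 ?addr0 // => j jn.
  rewrite vec_support ?mulr0 //; apply/negP => /mapP[e' e'x E].
  have [lt|lt|E'] := ltngtP j n; last by rewrite E' eqxx in jn.
    by have := xdisj _ _ _ _ lt e'x ex; rewrite E ltnn.
  by have := xdisj _ _ _ _ lt ex e'x; rewrite E ltnn.
rewrite /level_points big_map big_filter.
apply: (@le_trans _ _ (theta (m q) * \sum_(e <- x n | e.1.2 == q) `|b n| * (e.2 / c q))).
  rewrite -mulr_sumr -mulr_suml.
  have -> : \sum_(e <- x n | e.1.2 == q) e.2 = 1 by apply: xmass ns.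
  by rewrite mul1r mulrCA mulfV ?mulr1 // gt_eqF // c0.
rewrite ler_wpM2l ?(ltW (c0 q)) // big_seq_cond [leRHS]big_seq_cond.
apply: ler_sum => e /andP[ex /eqP eq]; rewrite yE // normrM ler_wpM2l //.
rewrite -eq; apply: le_trans (vec_ge c0 (x0 n) ex) _; exact: ler_norm.
Qed.

End Assembly.

(* Indices n of theta_n, F_n, alpha_n are shifted by one (paper's n = our n+1). *)
Theorem theorem4 (R : realType) (theta : nat -> R) (F : nat -> set (set nat))
    (N : (nat -> R) -> R) (alpha : nat -> bord) (xi : bord) :
  (forall n, 0 < theta n < 1) ->
  (forall n, theta n.+1 <= theta n) ->
  theta @ \oo --> 0 ->
  (forall n, regular (F n)) ->
  tsirelson_norm theta F N ->
  (forall n, CB_index (F n) (alpha n)) ->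
  (forall n, olt (ofin 1) (alpha n)) ->
  (forall n, ~ oeq (BL alpha) (alpha n)) ->
  oeq (BL alpha) (wexp (wexp xi)) ->
  olt BZ xi ->
  dagger theta alpha xi ->
  forall t : bord, schreier_tree t -> oeq t (wexp xi) ->
  forall M : set nat, M `<=` Npos -> ~ finite_set M ->
  exists xs : nat -> nat -> R, l1_spreading_model_in N M (schreier t) xs.
Proof.
move=> theta01 theta_dec theta0 F_reg N_norm F_index alpha1 alpha_neq alpha_sup xi0
  [eps [eps0 dag]] t Ht Htxi M _ Minf.
have [f Et Hf] := schreier_tree_limit Ht Htxi xi0; subst t.
have F_nil n : lf (F n) [::] := F_rich F_reg F_index (a := BZ) (n := n) I.
have F_big : exists n, forall k, exists s, lf (F n) s /\ size s = k.
  have [n Hn] := exists_omega_le alpha_sup xi0; exists n => k.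
  have Hk : ole (ofin k) (alpha n) by apply: ole_trans Hn; apply: (@ole_BL _ _ k); apply: ole_refl.
  have [s' Hs'] := der_ofin_ext (F_rich F_reg F_index Hk).
  by exists s'.
have [m [rho [m0 mS poor rich]]] := levels_exist theta01 theta_dec theta0 F_reg F_index
  alpha1 alpha_neq alpha_sup xi0 eps0 dag Hf.
have [BL HBL] := choice (fun q => bad_finite theta01 theta_dec theta0 m q eps0).
have thm q : 0 < theta (m q) by have /andP[] := theta01 (m q).
have p2 q : 0 < 2 ^- q.+1 :> R by rewrite invr_gt0 exprn_gt0.
(* Shared among all bad paths, so that together they carry mass at most [2 ^- q.+1 * theta (m q)] at
   level [q]; the successor avoids division by 0. *)
pose delta q : R := 2 ^- q.+1 * theta (m q) / (size (BL q)).+1%:R.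
have delta0 q : 0 < delta q by rewrite divr_gt0 // mulr_gt0.
have BLd q : (size (BL q))%:R * delta q <= 2 ^- q.+1 * theta (m q).
  rewrite /delta mulrA ler_pdivrMr // mulrC ler_wpM2l ?ler_nat //.
  by rewrite mulr_ge0 // ltW.
have BLpoor q ns : ns \in BL q -> ~ nder (Fam F ns) (wexp (rho q)) [::].
  by move=> /HBL[ns1 [ns2 [-> Hp Hw]]]; apply: poor.
have [x [xobj xpos xdisj xSF]] := sequence_exists (M := M) (infinite_unbounded Minf)
  (fun q => regular_lfam (F_reg (m q))) (fun ns => lfam_sfam (Fam_lfam ns F_reg))
  BLpoor delta0 rich.
pose c q := theta (m q).
have x0 j : all (fun e => 0 <= e.2) (x j).
  by have [_ H _ _ _] := xobj j; apply/allP => e /H[].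
have xmass j q : (q <= j)%N -> level_mass q (x j) = 1.
  by move=> qj; have [_ _ H _ _] := xobj j; apply: H.
have cx j : c00 (vec c (x j)) by apply: c00_vec; apply: xpos.
pose C : R := 2 + 2 * (eps^-1 + 2 / eps ^+ 2).
have C0 : 0 < C.
  by rewrite addr_gt0 // mulr_gt0 // addr_gt0 ?divr_gt0 ?exprn_gt0 ?invr_gt0.
have Nle j : N (vec c (x j)) <= C.
  have [srt lev _ Hd Hr] := xobj j.
  apply: (N_le theta01 theta_dec F_reg N_norm F_big (cx j)) => T VT.
  apply: (vec_bound theta01 F_reg F_nil eps0 m0 mS (fun q ns => (HBL q ns).2) BLd srt (i := j)) => //.
    by move=> e /lev[_ /andP[_ h] _].
  by move=> q; apply: xmass.
have Ngt j : 0 < N (vec c (x j)).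
  have [e ex e0] : exists2 e, e \in x j & 0 < e.2.
    apply: contrapT => Hn; have := xmass j 0%N (leq0n j).
    rewrite /level_mass /meas big_seq_cond big1 => [/eqP|e /andP[ex _]].
      by rewrite eq_sym oner_eq0.
    apply/eqP; rewrite eq_le (allP (x0 j) _ ex) andbT leNgt; apply/negP => e0.
    by apply: Hn; exists e.
  have Hv := vec_ge (c := c) thm (x0 j) ex.
  have Hv' := le_trans Hv (le_trans (ler_norm _) (N_abs N_norm e.1.1 (cx j))).
  by apply: lt_le_trans Hv'; apply: divr_gt0 => //; apply: thm.
pose xs n p := (N (vec c (x n)))^-1 * vec c (x n) p.
have cxs n : c00 (xs n) by apply: c00_scale.
exists xs; split.
  move=> n; split.
    by have h := inX_c00 theta01 N_norm F_big (cxs n); exact: h.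
  split.
    move=> p Mp; rewrite /xs vec_support ?mulr0 //; apply/negP => /mapP[e ex E].
    by apply: Mp; rewrite E; have [_ H _ _ _] := xobj n; have [] := H e ex.
  rewrite (normX_c00 N (cxs n)) (N_scale theta01 theta_dec F_reg N_norm F_big) //.
  by rewrite gtr0_norm ?invr_gt0 // mulVf // gt_eqF.
exists C; split=> // s us Hs a.
have [k [Hk sk]] := Hs.
pose s' := sort leq s.
have ss' : perm_eq s' s by rewrite perm_sort.
have s'path : path ltn k s'.
  rewrite (path_sortedE ltn_trans) ltn_sorted_uniq_leq sort_uniq us.
  apply/andP; split; last exact: (sort_sorted leq_total).
  by apply/allP => i; rewrite (perm_mem ss') => /sk.
have s'S : SF f k s'.
  split=> //; split; first exact: path_ltn_le s'path.
  have -> : setof s' = setof s by apply/seteqP; split=> i; rewrite /setof /= (perm_mem ss').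
  exact: Hk.
have Hlow := lower_bound theta01 N_norm (fun n => a n / N (vec c (x n)))
  x0 xpos xdisj (q := k) (m := m) (s := s').
rewrite normX_c00; last first.
  by apply: c00_sum => n; apply: c00_scale.
(* Normalizing the vectors costs only the constant [C], which bounds all their norms. *)
apply: (@le_trans _ _ (\sum_(n <- s') `|a n / N (vec c (x n))|)).
  rewrite (perm_big _ ss') mulr_sumr /=; apply: ler_sum => n _.
  rewrite normrM normfV (gtr0_norm (Ngt n)) mulrC ler_wpM2l // lef_pV2 ?posrE //.
have -> : (fun i => \sum_(n <- s) a n * xs n i) =
   (fun p => \sum_(n <- s') a n / N (vec c (x n)) * vec c (x n) p).
  apply: funext => p; rewrite [RHS](perm_big _ ss') /=.
  by apply: eq_bigr => n _; rewrite /xs mulrA.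
apply: Hlow.
- by rewrite sort_uniq.
- move=> j js; apply: xmass; apply: ltnW.
  by move: s'path; rewrite (path_sortedE ltn_trans) => /andP[/allP /(_ j js)].
- exact: xSF s'S.
Qed.
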